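(* Let $\mathfrak{C}$ be an $A$-coring and $\mathfrak{D}$ a $B$-coring such that ${}_A\mathfrak{C}$, $\mathfrak{C}_A$, ${}_B\mathfrak{D}$ and $\mathfrak{D}_B$ are flat. Let $X\in{}^{\mathfrak{C}}\mathcal{M}^{\mathfrak{D}}$ and $\Lambda\in{}^{\mathfrak{D}}\mathcal{M}^{\mathfrak{C}}$. The following statements are equivalent: (1) $(-\square_{\mathfrak{C}}X,-\square_{\mathfrak{D}}\Lambda)$ is a pair of inverse equivalences; (2) there exist bicomodule isomorphisms $f:X\square_{\mathfrak{D}}\Lambda\to\mathfrak{C}$ in ${}^{\mathfrak{C}}\mathcal{M}^{\mathfrak{C}}$ and $g:\Lambda\square_{\mathfrak{C}}X\to\mathfrak{D}$ in ${}^{\mathfrak{D}}\mathcal{M}^{\mathfrak{D}}$, such that (a) ${}_AX$ and ${}_B\Lambda$ are flat, and $\omega_{X,\Lambda}=\rho_X\otimes_B\Lambda-X\otimes_B\lambda_\Lambda$ is pure in ${}_A\mathcal{M}$ and $\omega_{\Lambda,X}=\rho_\Lambda\otimes_AX-\Lambda\otimes_A\lambda_X$ is pure in ${}_B\mathcal{M}$, or (b) ${}_{\mathfrak{C}}X$ and ${}_{\mathfrak{D}}\Lambda$ are coflat. In such a case the following two diagrams commute: the composite $\Lambda\square_{\mathfrak{C}}X\square_{\mathfrak{D}}\Lambda\xrightarrow{\Lambda\square_{\mathfrak{C}}f}\Lambda\square_{\mathfrak{C}}\mathfrak{C}\simeq\Lambda$ equals $\Lambda\square_{\mathfrak{C}}X\square_{\mathfrak{D}}\Lambda\xrightarrow{g\square_{\mathfrak{D}}\Lambda}\mathfrak{D}\square_{\mathfrak{D}}\Lambda\simeq\Lambda$,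 and the composite $X\square_{\mathfrak{D}}\Lambda\square_{\mathfrak{C}}X\xrightarrow{f\square_{\mathfrak{C}}X}\mathfrak{C}\square_{\mathfrak{C}}X\simeq X$ equals $X\square_{\mathfrak{D}}\Lambda\square_{\mathfrak{C}}X\xrightarrow{X\square_{\mathfrak{D}}g}X\square_{\mathfrak{D}}\mathfrak{D}\simeq X$. If $A$ and $B$ are von Neumann regular rings, or if $\mathfrak{C}$ and $\mathfrak{D}$ are coseparable corings (in this case without assuming $\mathfrak{C}_A$ and $\mathfrak{D}_B$ flat), the conditions (a) and (b) can be deleted.
   Context: $k$ is a commutative ring; $A,B$ are associative unital $k$-algebras. An $A$-coring is an $A$-bimodule $\mathfrak{C}$ with $A$-bimodule maps $\Delta_{\mathfrak C}:\mathfrak{C}\to\mathfrak{C}\otimes_A\mathfrak{C}$ (coassociative) and $\epsilon_{\mathfrak C}:\mathfrak{C}\to A$ (counit). A right $\mathfrak{C}$-comodule is a right $A$-module $M$ with a coassociative, counital right $A$-linear coaction $\rho_M:M\to M\otimes_A\mathfrak{C}$; category $\mathcal{M}^{\mathfrak{C}}$; left comodules are symmetric (coaction $\lambda$). A $(\mathfrak{C},\mathfrak{D})$-bicomodule (category ${}^{\mathfrak{C}}\mathcal{M}^{\mathfrak{D}}$) is an $(A,B)$-bimodule that is a left $\mathfrak{C}$-comodule with $B$-linear coaction $\lambda$ and a right $\mathfrak{D}$-comodule with $A$-linear coaction $\rho$, with $(\lambda\otimes_B\mathfrak{D})\rho=(\mathfrak{C}\otimes_A\rho)\lambda$. Cotensor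 product: $M\square_{\mathfrak{C}}N=\ker(\rho_M\otimes_AN-M\otimes_A\lambda_N: M\otimes_AN\to M\otimes_A\mathfrak{C}\otimes_AN)$; it defines functors $-\square_{\mathfrak C}X:\mathcal M^{\mathfrak C}\to\mathcal M^{\mathfrak D}$ and $-\square_{\mathfrak D}\Lambda:\mathcal M^{\mathfrak D}\to\mathcal M^{\mathfrak C}$. ${}_A\mathcal M$ is the category of left $A$-modules. A left $\mathfrak C$-comodule $N$ is coflat if $-\square_{\mathfrak C}N:\mathcal M^{\mathfrak C}\to\mathcal M_k$ is exact. A morphism $h:M\to N$ of left $A$-modules is pure if for every right $A$-module $W$ the sequence $0\to W\otimes_A\ker h\to W\otimes_AM\xrightarrow{W\otimes h}W\otimes_AN$ is exact. $\mathfrak C$ is coseparable if $\Delta_{\mathfrak C}$ is a split monomorphism of $\mathfrak C$-bicomodules.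
   Formalization: The two diagrams are shown to commute for suitably chosen isomorphisms f and g as in (2), not for every such pair: with A=B=C=D=X=Λ=k, f=u and g=v (units), they commute only if u=v. *)

(* Defs.v *)
From HB Require Import structures.
From mathcomp Require Import all_boot all_order all_algebra.
From mathcomp Require Import boolp.

Set Implicit Arguments.
Unset Strict Implicit.
Unset Printing Implicit Defensive.

Import GRing.Theory.
Local Open Scope ring_scope.
Local Open Scope quotient_scope.

(* An associative unital [k]-algebra, possibly zero (which [algType k]        *)
(* excludes), as a ring with a ring morphism from [k] to its center.          *)
Record kalg (k : comPzRingType) := Kalg {
  kring :> pzRingType;
  kmap : {rmorphism k -> kring};
  kmapC : forall c (a : kring), kmap c * a = a * kmap c }.

Definition kself (k : comPzRingType) : kalg k :=
  @Kalg k k (@idfun k : {rmorphism k -> k}) (fun c a => mulrC c a).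

Definition von_neumann_regular (A : pzRingType) : Prop :=
  forall a : A, exists x : A, a = a * x * a.

(* [(A, B)]-bimodules over [k]-algebras, on which [k] acts centrally.  A      *)
(* right [A]-module is the same thing as a [bimod (kself k) A], a left        *)
(* [A]-module the same thing as a [bimod A (kself k)], and a [k]-module a     *)
(* [bimod (kself k) (kself k)]: in each case [bkact] says that the extra      *)
(* action of [k] is the one induced by the algebra.                           *)
Record bimod (k : comPzRingType) (A B : kalg k) := Bimod {
  bcar :> zmodType;
  lact : A -> bcar -> bcar;
  ract : bcar -> B -> bcar;
  lactDr : forall a x y, lact a (x + y) = lact a x + lact a y;
  lactDl : forall a b x, lact (a + b) x = lact a x + lact b x;
  lactM : forall a b x, lact (a * b) x = lact a (lact b x);
  lact1 : forall x, lact 1 x = x;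
  ractDl : forall x y b, ract (x + y) b = ract x b + ract y b;
  ractDr : forall x a b, ract x (a + b) = ract x a + ract x b;
  ractM : forall x a b, ract x (a * b) = ract (ract x a) b;
  ract1 : forall x, ract x 1 = x;
  lractA : forall a x b, ract (lact a x) b = lact a (ract x b);
  bkact : forall c x, lact (kmap A c) x = ract x (kmap B c) }.

Record bihom (k : comPzRingType) (A B : kalg k) (M N : bimod A B) := Bihom {
  bfun :> M -> N;
  bfunB : zmod_morphism bfun;
  bfunL : forall a x, bfun (lact a x) = lact a (bfun x);
  bfunR : forall x b, bfun (ract x b) = ract (bfun x) b }.

HB.instance Definition _ k A B M N (f : @bihom k A B M N) :=
  GRing.isZmodMorphism.Build M N f (bfunB f).

Section BimodTheory.
Context {k : comPzRingType}.
Implicit Types A B : kalg k.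

Lemma zmorphD (U V : zmodType) (f : U -> V) :
  {morph f : x y / x + y} -> zmod_morphism f.
Proof.
move=> fD; have f0 : f 0 = 0 by apply: (addIr (f 0)); rewrite -fD !add0r.
by move=> x y; rewrite fD; congr (_ + _); apply: (addIr (f y));
   rewrite -fD !addNr.
Qed.

Lemma lact0r A B (M : bimod A B) a : lact a (0 : M) = 0.
Proof. by apply: (addIr (lact a 0)); rewrite -lactDr !add0r. Qed.
Lemma ract0l A B (M : bimod A B) b : ract (0 : M) b = 0.
Proof. by apply: (addIr (ract 0 b)); rewrite -ractDl !add0r. Qed.
Lemma lactNr A B (M : bimod A B) a (x : M) : lact a (- x) = - lact a x.
Proof. by apply: (addIr (lact a x)); rewrite -lactDr !addNr lact0r. Qed.
Lemma ractNl A B (M : bimod A B) (x : M) b : ract (- x) b = - ract x b.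
Proof. by apply: (addIr (ract x b)); rewrite -ractDl !addNr ract0l. Qed.

Lemma bfun0 A B (M N : bimod A B) (f : bihom M N) : f 0 = 0.
Proof. exact: raddf0. Qed.
Lemma bfunD A B (M N : bimod A B) (f : bihom M N) x y : f (x + y) = f x + f y.
Proof. exact: raddfD. Qed.

Definition bid A B (M : bimod A B) : bihom M M.
Proof. by exists id. Defined.

Definition bcomp A B (M N P : bimod A B) (g : bihom N P) (f : bihom M N) :
  bihom M P.
Proof.
exists (fun x => g (f x)).
- by move=> x y; rewrite !bfunB.
- by move=> a x; rewrite !bfunL.
- by move=> x b; rewrite !bfunR.
Defined.

Definition bsub A B (M N : bimod A B) (f g : bihom M N) : bihom M N.
Proof.
exists (fun x => f x - g x).
- by move=> x y; rewrite !bfunB !opprD addrACA.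
- by move=> a x; rewrite !bfunL lactDr lactNr.
- by move=> x b; rewrite !bfunR ractDl ractNl.
Defined.

Definition bzero A B (M N : bimod A B) : bihom M N.
Proof.
exists (fun=> 0).
- by move=> x y; rewrite subr0.
- by move=> a x; rewrite lact0r.
- by move=> x b; rewrite ract0l.
Defined.

Definition breg A : bimod A A.
Proof.
exists A (fun a x => a * x) (fun x b => x * b).
- by move=> a x y; rewrite mulrDr.
- by move=> a b x; rewrite mulrDl.
- by move=> a b x; rewrite mulrA.
- by move=> x; rewrite mul1r.
- by move=> x y b; rewrite mulrDl.
- by move=> a b x; rewrite mulrDr.
- by move=> a b x; rewrite mulrA.
- by move=> x; rewrite mulr1.
- by move=> a x b; rewrite mulrA.
- exact: kmapC.
Defined.

End BimodTheory.

Section Kernel.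
Context {k : comPzRingType} {A B : kalg k} {M N : bimod A B} (h : bihom M N).

Definition kerp : {pred M} := [pred x | h x == 0].

Fact kerp_zmod_closed : zmod_closed kerp.
Proof.
split=> [|x y]; rewrite !inE ?bfun0 // => /eqP hx /eqP hy.
by rewrite bfunB hx hy subr0.
Qed.
HB.instance Definition _ := GRing.isZmodClosed.Build M kerp kerp_zmod_closed.

Record kerT := KerT { kval : M; kvalP : kval \in kerp }.
HB.instance Definition _ := [isSub for kval].
HB.instance Definition _ := [Choice of kerT by <:].
HB.instance Definition _ := [SubChoice_isSubZmodule of kerT by <:].

Lemma kvalD (x y : kerT) : kval (x + y) = kval x + kval y.
Proof. by []. Qed.
Lemma kvalB (x y : kerT) : kval (x - y) = kval x - kval y.
Proof. by []. Qed.

Lemma kvalE (x : kerT) : h (kval x) = 0.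
Proof. by apply/eqP; have := kvalP x; rewrite inE. Qed.

Fact ker_lact a (x : kerT) : lact a (kval x) \in kerp.
Proof. by rewrite inE bfunL kvalE lact0r. Qed.
Fact ker_ract (x : kerT) b : ract (kval x) b \in kerp.
Proof. by rewrite inE bfunR kvalE ract0l. Qed.

Definition kerb : bimod A B.
Proof.
exists kerT (fun a x => KerT (ker_lact a x)) (fun x b => KerT (ker_ract x b)).
- by move=> a x y; apply: val_inj; rewrite /= lactDr.
- by move=> a b x; apply: val_inj; rewrite /= lactDl.
- by move=> a b x; apply: val_inj; rewrite /= lactM.
- by move=> x; apply: val_inj; rewrite /= lact1.
- by move=> x y b; apply: val_inj; rewrite /= ractDl.
- by move=> a b x; apply: val_inj; rewrite /= ractDr.
- by move=> a b x; apply: val_inj; rewrite /= ractM.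
- by move=> x; apply: val_inj; rewrite /= ract1.
- by move=> a x b; apply: val_inj; rewrite /= lractA.
- by move=> c x; apply: val_inj; rewrite /= bkact.
Defined.

Definition kin : bihom kerb M.
Proof. by exists (kval : kerb -> M) => // x y; rewrite kvalB. Defined.

Lemma kin_inj : injective kin. Proof. exact: (@val_inj _ _ kerT). Qed.

Lemma kinE x : h (kin x) = 0. Proof. exact: kvalE. Qed.

Definition kmk (x : M) (hx : h x = 0) : kerb.
Proof. by exists x; rewrite inE hx. Defined.

Definition klift (K : bimod A B) (f : bihom K M) (hf : forall x, h (f x) = 0) :
  bihom K kerb.
Proof.
exists (fun x => kmk (hf x)).
- by move=> x y; apply: kin_inj; exact: (bfunB f).
- by move=> a x; apply: kin_inj; exact: (bfunL f).
- by move=> x b; apply: kin_inj; exact: (bfunR f).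
Defined.

End Kernel.

(* The tensor product of a right and a left module over a ring [A], given by  *)
(* generators (the symbols [(m, n)]) and relations.  A list stands for a      *)
(* finite sum of generators; opposites need not be added to the generators,   *)
(* since [(- m, n)] is opposite to [(m, n)], but the relation [teq0], which   *)
(* holds automatically in a group, has to be imposed.                         *)
Section Tensor.
Variables (A : Type) (M N : zmodType) (ra : M -> A -> M) (la : A -> N -> N).

Inductive teq : seq (M * N) -> seq (M * N) -> Prop :=
| teq_refl s : teq s s
| teq_sym s t : teq s t -> teq t s
| teq_trans s t u : teq s t -> teq t u -> teq s u
| teq_cat s s' t t' : teq s s' -> teq t t' -> teq (s ++ t) (s' ++ t')
| teq_catC s t : teq (s ++ t) (t ++ s)
| teq0 n : teq [:: (0, n)] [::]
| teqDl m m' n : teq [:: (m + m', n)] [:: (m, n); (m', n)]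
| teqDr m n n' : teq [:: (m, n + n')] [:: (m, n); (m, n')]
| teqM m a n : teq [:: (ra m a, n)] [:: (m, la a n)].

Definition teqb s t := `[< teq s t >].

Fact teqb_refl : reflexive teqb.
Proof. by move=> s; apply/asboolP/teq_refl. Qed.
Fact teqb_sym : symmetric teqb.
Proof. by move=> s t; apply: asbool_equiv_eq; split; apply: teq_sym. Qed.
Fact teqb_trans : transitive teqb.
Proof.
by move=> s t u /asboolP ts /asboolP su; apply/asboolP; apply: teq_trans ts su.
Qed.

Canonical teqb_equiv := EquivRel teqb teqb_refl teqb_sym teqb_trans.

Definition tens := {eq_quot teqb_equiv}.
HB.instance Definition _ := Choice.on tens.
HB.instance Definition _ := Quotient.on tens.

Lemma teqP s t : teq s t <-> \pi_tens s = \pi_tens t.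
Proof. by split=> [st|/eqmodP /asboolP //]; apply/eqmodP/asboolP. Qed.

Lemma teq_repr s : teq (repr (\pi_tens s)) s.
Proof. by apply/teqP; rewrite reprK. Qed.

Lemma tens_pi (x : tens) : exists s, x = \pi_tens s.
Proof. by exists (repr x); rewrite reprK. Qed.

Definition tadd (x y : tens) : tens := \pi_tens (repr x ++ repr y).
Definition topp (x : tens) : tens := \pi_tens [seq (- u.1, u.2) | u <- repr x].

Lemma pi_cat s t : tadd (\pi_tens s) (\pi_tens t) = \pi_tens (s ++ t).
Proof. by apply/teqP; apply: teq_cat; apply: teq_repr. Qed.

Lemma taddA : associative tadd.
Proof.
move=> x y z; have [s ->] := tens_pi x; have [t ->] := tens_pi y.
by have [u ->] := tens_pi z; rewrite !pi_cat catA.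
Qed.
Lemma taddC : commutative tadd.
Proof.
move=> x y; have [s ->] := tens_pi x; have [t ->] := tens_pi y.
by rewrite !pi_cat; apply/teqP/teq_catC.
Qed.
Lemma tadd0 : left_id (\pi_tens [::]) tadd.
Proof. by move=> x; have [s ->] := tens_pi x; rewrite pi_cat. Qed.

Lemma tnegs s : teq ([seq (- u.1, u.2) | u <- s] ++ s) [::].
Proof.
elim: s => [|[m n] s IHs] /=; first exact: teq_refl.
set s' := map _ s in IHs *.
have h : teq (s' ++ ([:: (m, n)] ++ s)) ([:: (m, n)] ++ (s' ++ s)).
  rewrite catA; exact: (teq_cat (teq_catC s' [:: (m, n)]) (teq_refl s)).
apply: teq_trans (teq_cat (teq_refl [:: (- m, n)]) h) _.
apply: (teq_cat (s := [:: (- m, n); (m, n)]) (s' := [::]) _ IHs).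
apply: teq_trans (teq_sym (teqDl _ _ _)) _.
by rewrite addNr; apply: teq0.
Qed.

Lemma taddN : left_inverse (\pi_tens [::]) topp tadd.
Proof.
move=> x; rewrite /topp -[X in tadd _ X](reprK x) pi_cat; exact/teqP/tnegs.
Qed.

HB.instance Definition _ := GRing.isZmodule.Build tens taddA taddC tadd0 taddN.

Definition tpure (m : M) (n : N) : tens := \pi_tens [:: (m, n)].

Lemma tpureDl m m' n : tpure (m + m') n = tpure m n + tpure m' n.
Proof. by rewrite -[RHS]/(tadd _ _) pi_cat; apply/teqP/teqDl. Qed.
Lemma tpureDr m n n' : tpure m (n + n') = tpure m n + tpure m n'.
Proof. by rewrite -[RHS]/(tadd _ _) pi_cat; apply/teqP/teqDr. Qed.
Lemma tpureM m a n : tpure (ra m a) n = tpure m (la a n).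
Proof. exact/teqP/teqM. Qed.

Lemma tens_ind (P : tens -> Prop) :
  P 0 -> (forall x y, P x -> P y -> P (x + y)) -> (forall m n, P (tpure m n)) ->
  forall t, P t.
Proof.
move=> P0 PD Pp t; have [s ->] := tens_pi t; elim: s => [|[m n] s IHs] //.
have -> : \pi_tens ((m, n) :: s) = tpure m n + \pi_tens s.
  by rewrite -[RHS]/(tadd _ _) pi_cat.
exact: PD.
Qed.

Record balanced (P : zmodType) (b : M -> N -> P) : Prop := Balanced {
  balDl : forall m m' n, b (m + m') n = b m n + b m' n;
  balDr : forall m n n', b m (n + n') = b m n + b m n';
  balM : forall m a n, b (ra m a) n = b m (la a n) }.

Definition tlift (P : zmodType) (b : M -> N -> P) (t : tens) : P :=
  \sum_(u <- repr t) b u.1 u.2.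

Section Lift.
Variables (P : zmodType) (b : M -> N -> P) (hb : balanced b).

Lemma tlift_pi s : tlift b (\pi_tens s) = \sum_(u <- s) b u.1 u.2.
Proof.
have H x y : teq x y -> \sum_(u <- x) b u.1 u.2 = \sum_(u <- y) b u.1 u.2.
  elim=> {x y} //=.
  - by move=> s1 t u _ -> _ ->.
  - by move=> s1 s2 t1 t2 _ h1 _ h2; rewrite !big_cat /= h1 h2.
  - by move=> s1 t; rewrite !big_cat /= addrC.
  - move=> n; rewrite big_seq1 big_nil /=.
    by apply: (addIr (b 0 n)); rewrite -balDl // !add0r.
  - by move=> m m' n; rewrite big_seq1 big_cons big_seq1 /= balDl.
  - by move=> m n n'; rewrite big_seq1 big_cons big_seq1 /= balDr.
  - by move=> m a n; rewrite !big_seq1 /= balM.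
by apply: H; apply: teq_repr.
Qed.

Lemma tliftE m n : tlift b (tpure m n) = b m n.
Proof. by rewrite tlift_pi big_seq1. Qed.

Lemma tliftD : {morph tlift b : x y / x + y}.
Proof.
move=> x y; have [s ->] := tens_pi x; have [t ->] := tens_pi y.
by rewrite -[_ + _]/(tadd _ _) pi_cat !tlift_pi big_cat.
Qed.
End Lift.

End Tensor.

Arguments tpure {A M N ra la} m n.

Lemma tens_eq (A : Type) (M N : zmodType) (ra : M -> A -> M) (la : A -> N -> N)
    (P : zmodType) (f g : tens ra la -> P) :
  {morph f : x y / x + y} -> {morph g : x y / x + y} ->
  (forall m n, f (tpure m n) = g (tpure m n)) -> forall t, f t = g t.
Proof.
move=> fD gD fg; elim/tens_ind => // [|x y hx hy]; last by rewrite fD gD hx hy.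
have f0 : f 0 = 0 by apply: (addIr (f 0)); rewrite -fD !add0r.
have g0 : g 0 = 0 by apply: (addIr (g 0)); rewrite -gD !add0r.
by rewrite f0 g0.
Qed.

Section TensorBimod.
Context {k : comPzRingType}.
Implicit Types A B C : kalg k.

Section Def.
Context {A B C : kalg k} (M : bimod A B) (N : bimod B C).
Let T := tens (@ract _ _ _ M) (@lact _ _ _ N).

Let lb a (m : M) (n : N) : T := tpure (lact a m) n.
Let rb c (m : M) (n : N) : T := tpure m (ract n c).

Fact tlact_bal a : balanced (@ract _ _ _ M) (@lact _ _ _ N) (lb a).
Proof.
split=> [m m' n|m n n'|m b n]; rewrite /lb.
- by rewrite lactDr tpureDl.
- by rewrite tpureDr.
- by rewrite -lractA tpureM.
Qed.
Fact tract_bal c : balanced (@ract _ _ _ M) (@lact _ _ _ N) (rb c).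
Proof.
split=> [m m' n|m n n'|m b n]; rewrite /rb.
- by rewrite tpureDl.
- by rewrite ractDl tpureDr.
- by rewrite lractA tpureM.
Qed.

Definition tl a : T -> T := tlift (lb a).
Definition tr (t : T) c : T := tlift (rb c) t.

Fact tlE a m n : tl a (tpure m n) = tpure (lact a m) n.
Proof. exact: tliftE (tlact_bal a) _ _. Qed.
Fact tlD a x y : tl a (x + y) = tl a x + tl a y.
Proof. exact: tliftD (tlact_bal a) _ _. Qed.
Fact trE c m n : tr (tpure m n) c = tpure m (ract n c).
Proof. exact: tliftE (tract_bal c) _ _. Qed.
Fact trD x y c : tr (x + y) c = tr x c + tr y c.
Proof. exact: tliftD (tract_bal c) _ _. Qed.

Fact tlDl a b t : tl (a + b) t = tl a t + tl b t.
Proof.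
move: t; apply: tens_eq => [x y|x y|m n]; rewrite ?tlD ?tlE //.
  by rewrite addrACA.
by rewrite lactDl tpureDl.
Qed.
Fact tlM a b t : tl (a * b) t = tl a (tl b t).
Proof.
by move: t; apply: tens_eq => [x y|x y|m n]; rewrite ?tlD ?tlE // lactM.
Qed.
Fact tl1 t : tl 1 t = t.
Proof.
by move: t; apply: tens_eq => [x y|x y|m n]; rewrite ?tlD ?tlE // lact1.
Qed.
Fact trDr t a b : tr t (a + b) = tr t a + tr t b.
Proof.
move: t; apply: tens_eq => [x y|x y|m n]; rewrite ?trD ?trE //.
  by rewrite addrACA.
by rewrite ractDr tpureDr.
Qed.
Fact trM t a b : tr t (a * b) = tr (tr t a) b.
Proof.
by move: t; apply: tens_eq => [x y|x y|m n]; rewrite ?trD ?trE // ractM.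
Qed.
Fact tr1 t : tr t 1 = t.
Proof.
by move: t; apply: tens_eq => [x y|x y|m n]; rewrite ?trD ?trE // ract1.
Qed.
Fact tlrA a t c : tr (tl a t) c = tl a (tr t c).
Proof.
by move: t; apply: tens_eq => [x y|x y|m n]; rewrite ?tlD ?trD ?tlD ?trE ?tlE ?trE.
Qed.
Fact tlkact c t : tl (kmap A c) t = tr t (kmap C c).
Proof.
move: t; apply: tens_eq => [x y|x y|m n]; rewrite ?tlD ?trD //.
by rewrite tlE trE bkact tpureM bkact.
Qed.

Definition tensb : bimod A C :=
  @Bimod k A C T tl tr tlD tlDl tlM tl1 trD trDr trM tr1 tlrA tlkact.

Definition bpure (m : M) (n : N) : tensb := tpure m n.

End Def.

Local Notation "m ⊗ n" := (bpure m n) (at level 40, left associativity).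

Section Theory.
Context {A B C : kalg k} {M : bimod A B} {N : bimod B C}.

Lemma bpureDl (m m' : M) (n : N) : (m + m') ⊗ n = m ⊗ n + m' ⊗ n.
Proof. exact: tpureDl. Qed.
Lemma bpureDr (m : M) (n n' : N) : m ⊗ (n + n') = m ⊗ n + m ⊗ n'.
Proof. exact: tpureDr. Qed.
Lemma bpure0l (n : N) : (0 : M) ⊗ n = 0.
Proof. by apply: (addIr (0 ⊗ n)); rewrite -bpureDl !add0r. Qed.
Lemma bpure0r (m : M) : m ⊗ (0 : N) = 0.
Proof. by apply: (addIr (m ⊗ 0)); rewrite -bpureDr !add0r. Qed.
Lemma bpureM (m : M) b (n : N) : ract m b ⊗ n = m ⊗ lact b n.
Proof. exact: tpureM. Qed.
Lemma lact_bpure a (m : M) (n : N) : lact a (m ⊗ n) = lact a m ⊗ n.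
Proof. exact: tlE. Qed.
Lemma ract_bpure c (m : M) (n : N) : ract (m ⊗ n) c = m ⊗ ract n c.
Proof. exact: trE. Qed.

Lemma bpure_ind (P : tensb M N -> Prop) :
  P 0 -> (forall x y, P x -> P y -> P (x + y)) -> (forall m n, P (m ⊗ n)) ->
  forall t, P t.
Proof. exact: tens_ind. Qed.

End Theory.

Definition bpure_0 := (@bfun0 k, @bpure0l, @bpure0r, @lact0r k, @ract0l k).
Definition bpure_D := (@bfunD k, @bpureDl, @bpureDr, @lactDr k, @ractDl k).

End TensorBimod.

(* Conversion should compare tensor products and kernels before unfolding     *)
(* them.                                                                      *)
Strategy 100 [kerb tensb].

Infix "⊗" := bpure (at level 40, left associativity) : ring_scope.
Infix "⊗b" := tensb (at level 40, left associativity) : type_scope.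

Ltac tind t :=
  let x := fresh in let y := fresh in let hx := fresh in let hy := fresh in
  move: t; apply: bpure_ind => [|x y hx hy|];
    [by rewrite ?bpure_0|by rewrite ?bpure_D hx hy|].

Section TensorMaps.
Context {k : comPzRingType}.
Implicit Types A B C E : kalg k.

Definition blift A B C (M : bimod A B) (N : bimod B C) (P : bimod A C)
    (b : M -> N -> P) (hb : balanced (@ract _ _ _ M) (@lact _ _ _ N) b)
    (bL : forall a m n, b (lact a m) n = lact a (b m n))
    (bR : forall m n c, b m (ract n c) = ract (b m n) c) : bihom (tensb M N) P.
Proof.
exists (tlift b).
- exact/zmorphD/tliftD.
- move=> a; apply: tens_eq => [x y|x y|m n].
  + by rewrite lactDr tliftD.
  + by rewrite tliftD // lactDr.
  by rewrite -[tpure m n]/(bpure m n) lact_bpure !tliftE.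
- move=> t c; move: t; apply: tens_eq => [x y|x y|m n].
  + by rewrite ractDl tliftD.
  + by rewrite tliftD // ractDl.
  by rewrite -[tpure m n]/(bpure m n) ract_bpure !tliftE.
Defined.

Lemma bliftE A B C (M : bimod A B) (N : bimod B C) (P : bimod A C)
    (b : M -> N -> P) hb bL bR m n : @blift A B C M N P b hb bL bR (m ⊗ n) = b m n.
Proof. exact: tliftE. Qed.

Section Tmap.
Context {A B C : kalg k} {M M' : bimod A B} {N N' : bimod B C}.
Variables (f : bihom M M') (g : bihom N N').
Let b (m : M) (n : N) := f m ⊗ g n.

Fact tmap_bal : balanced (@ract _ _ _ M) (@lact _ _ _ N) b.
Proof.
split=> [m m' n|m n n'|m c n]; rewrite /b ?bpure_D //.
by rewrite bfunR bfunL bpureM.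
Qed.
Fact tmapL a m n : b (lact a m) n = lact a (b m n).
Proof. by rewrite /b bfunL lact_bpure. Qed.
Fact tmapR m n c : b m (ract n c) = ract (b m n) c.
Proof. by rewrite /b bfunR ract_bpure. Qed.

Definition tmap : bihom (M ⊗b N) (M' ⊗b N') := blift tmap_bal tmapL tmapR.

Lemma tmapE m n : tmap (m ⊗ n) = f m ⊗ g n.
Proof. exact: bliftE. Qed.
End Tmap.

Section Unit.
Context {A B : kalg k} (M : bimod A B).

Fact lunit_bal : balanced (@ract _ _ _ (breg A)) (@lact _ _ _ M)
  (fun a m => lact (a : A) m).
Proof.
split=> [a b m|a m n|a b m] /=; [exact: lactDl|exact: lactDr|exact: lactM].
Qed.
Fact lunitL (a b : A) (m : M) : lact (a * b) m = lact a (lact b m).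
Proof. exact: lactM. Qed.
Fact lunitR (a : A) (m : M) c : lact a (ract m c) = ract (lact a m) c.
Proof. by rewrite lractA. Qed.

Definition lunit : bihom (breg A ⊗b M) M := blift lunit_bal lunitL lunitR.

Lemma lunitE (a : A) m : lunit ((a : breg A) ⊗ m) = lact a m.
Proof. exact: bliftE. Qed.

Fact runit_bal : balanced (@ract _ _ _ M) (@lact _ _ _ (breg B))
  (fun m b => ract m (b : B)).
Proof.
split=> [m n b|m a b|m a b] /=; [exact: ractDl|exact: ractDr|].
by rewrite ractM.
Qed.
Fact runitL a (m : M) (b : B) : ract (lact a m) b = lact a (ract m b).
Proof. exact: lractA. Qed.
Fact runitR (m : M) (b c : B) : ract m (b * c) = ract (ract m b) c.
Proof. exact: ractM. Qed.

Definition runit : bihom (M ⊗b breg B) M := blift runit_bal runitL runitR.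

Lemma runitE m (b : B) : runit (m ⊗ (b : breg B)) = ract m b.
Proof. exact: bliftE. Qed.
End Unit.

Section Assoc.
Context {A B C D : kalg k} (M : bimod A B) (N : bimod B C) (P : bimod C D).

Section Curry.
Variable p : P.
Let b (m : M) (n : N) := m ⊗ (n ⊗ p).
Fact assoc1_bal : balanced (@ract _ _ _ M) (@lact _ _ _ N) b.
Proof.
split=> [m m' n|m n n'|m c n]; rewrite /b ?bpure_D //.
by rewrite bpureM lact_bpure.
Qed.
Definition assoc1 : M ⊗b N -> M ⊗b (N ⊗b P) := tlift b.
Fact assoc1E m n : assoc1 (m ⊗ n) = m ⊗ (n ⊗ p).
Proof. exact: tliftE assoc1_bal _ _. Qed.
Fact assoc1D x y : assoc1 (x + y) = assoc1 x + assoc1 y.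
Proof. exact: tliftD assoc1_bal _ _. Qed.
Fact assoc10 : assoc1 0 = 0.
Proof. by apply: (addIr (assoc1 0)); rewrite -assoc1D !add0r. Qed.
End Curry.

Let b t (p : P) := assoc1 p t.
Fact assoc_bal : balanced (@ract _ _ _ (M ⊗b N)) (@lact _ _ _ P) b.
Proof.
split=> [t t' p|t p p'|t c p]; rewrite /b; first exact: assoc1D.
  move: t; apply: bpure_ind => [|x y hx hy|m n].
  - by rewrite !assoc10 addr0.
  - by rewrite !assoc1D hx hy addrACA.
  by rewrite !assoc1E !bpure_D.
move: t; apply: bpure_ind => [|x y hx hy|m n].
- by rewrite ract0l !assoc10.
- by rewrite ractDl !assoc1D hx hy.
by rewrite ract_bpure !assoc1E bpureM.
Qed.
Fact assocL a t p : b (lact a t) p = lact a (b t p).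
Proof.
rewrite /b; move: t; apply: bpure_ind => [|x y hx hy|m n].
- by rewrite lact0r !assoc10 lact0r.
- by rewrite lactDr !assoc1D hx hy lactDr.
by rewrite lact_bpure !assoc1E lact_bpure.
Qed.
Fact assocR t p d : b t (ract p d) = ract (b t p) d.
Proof.
rewrite /b; move: t; apply: bpure_ind => [|x y hx hy|m n].
- by rewrite !assoc10 ract0l.
- by rewrite !assoc1D hx hy ractDl.
by rewrite !assoc1E !ract_bpure.
Qed.

Definition assoc : bihom (M ⊗b N ⊗b P) (M ⊗b (N ⊗b P)) :=
  blift assoc_bal assocL assocR.

Lemma assocE m n p : assoc (m ⊗ n ⊗ p) = m ⊗ (n ⊗ p).
Proof. by rewrite /assoc bliftE /b assoc1E. Qed.

Section CurryV.
Variable m : M.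
Let c (n : N) (p : P) := m ⊗ n ⊗ p.
Fact assocV1_bal : balanced (@ract _ _ _ N) (@lact _ _ _ P) c.
Proof.
split=> [n n' p|n p p'|n d p]; rewrite /c ?bpure_D //.
by rewrite -ract_bpure bpureM.
Qed.
Definition assocV1 : N ⊗b P -> M ⊗b N ⊗b P := tlift c.
Fact assocV1E n p : assocV1 (n ⊗ p) = m ⊗ n ⊗ p.
Proof. exact: tliftE assocV1_bal _ _. Qed.
Fact assocV1D x y : assocV1 (x + y) = assocV1 x + assocV1 y.
Proof. exact: tliftD assocV1_bal _ _. Qed.
Fact assocV10 : assocV1 0 = 0.
Proof. by apply: (addIr (assocV1 0)); rewrite -assocV1D !add0r. Qed.
End CurryV.

Let c (m : M) t := assocV1 m t.
Fact assocV_bal : balanced (@ract _ _ _ M) (@lact _ _ _ (N ⊗b P)) c.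
Proof.
split=> [m m' t|m t t'|m b0 t]; rewrite /c; [|exact: assocV1D|].
- move: t; apply: bpure_ind => [|x y hx hy|n p].
  + by rewrite !assocV10 addr0.
  + by rewrite !assocV1D hx hy addrACA.
  by rewrite !assocV1E !bpure_D.
move: t; apply: bpure_ind => [|x y hx hy|n p].
- by rewrite lact0r !assocV10.
- by rewrite lactDr !assocV1D hx hy.
by rewrite lact_bpure !assocV1E bpureM.
Qed.
Fact assocVL a m t : c (lact a m) t = lact a (c m t).
Proof.
rewrite /c; move: t; apply: bpure_ind => [|x y hx hy|n p].
- by rewrite !assocV10 lact0r.
- by rewrite !assocV1D hx hy lactDr.
by rewrite !assocV1E !lact_bpure.
Qed.
Fact assocVR m t d : c m (ract t d) = ract (c m t) d.
Proof.
rewrite /c; move: t; apply: bpure_ind => [|x y hx hy|n p].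
- by rewrite ract0l !assocV10 ract0l.
- by rewrite ractDl !assocV1D hx hy ractDl.
by rewrite ract_bpure !assocV1E ract_bpure.
Qed.

Definition assocV : bihom (M ⊗b (N ⊗b P)) (M ⊗b N ⊗b P) :=
  blift assocV_bal assocVL assocVR.

Lemma assocVE m n p : assocV (m ⊗ (n ⊗ p)) = m ⊗ n ⊗ p.
Proof. by rewrite /assocV bliftE /c assocV1E. Qed.

Lemma assocK : cancel assoc assocV.
Proof.
move=> t; tind t => t p; tind t => m n; by rewrite assocE assocVE.
Qed.
Lemma assocVK : cancel assocV assoc.
Proof.
move=> t; tind t => m t; tind t => n p; by rewrite assocVE assocE.
Qed.
End Assoc.

End TensorMaps.

Arguments blift : simpl never.
Arguments tmap : simpl never.
Arguments assoc : simpl never.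
Arguments assocV : simpl never.
Arguments lunit : simpl never.
Arguments runit : simpl never.

Definition exact (U V W : zmodType) (f : U -> V) (g : V -> W) : Prop :=
  forall y, g y = 0 <-> exists x, f x = y.

Definition left_exact (U V W : zmodType) (f : U -> V) (g : V -> W) : Prop :=
  injective f /\ exact f g.

Definition short_exact (U V W : zmodType) (f : U -> V) (g : V -> W) : Prop :=
  [/\ injective f, exact f g & forall z, exists y, g y = z].

Section Flatness.
Context {k : comPzRingType}.

(* [flat_l V] : the left [A]-module [V] is flat. *)
Definition flat_l (A F : kalg k) (V : bimod A F) : Prop :=
  forall (W1 W2 W3 : bimod (kself k) A) (f : bihom W1 W2) (g : bihom W2 W3),
  exact f g -> exact (tmap f (bid V)) (tmap g (bid V)).

(* [flat_r V] : the right [A]-module [V] is flat. *)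
Definition flat_r (F A : kalg k) (V : bimod F A) : Prop :=
  forall (W1 W2 W3 : bimod A (kself k)) (f : bihom W1 W2) (g : bihom W2 W3),
  exact f g -> exact (tmap (bid V) f) (tmap (bid V) g).

(* Purity of [h] as a morphism of left [A]-modules; the right action of [F]   *)
(* plays no role.                                                             *)
Definition pure (A F : kalg k) (M N : bimod A F) (h : bihom M N) : Prop :=
  forall W : bimod (kself k) A,
  left_exact (tmap (bid W) (kin h)) (tmap (bid W) h).

End Flatness.

Section Comodules.
Context {k : comPzRingType}.

Record coring (A : kalg k) := Coring {
  corb :> bimod A A;
  cdelta : bihom corb (corb ⊗b corb);
  ceps : bihom corb (breg A);
  cdeltaA : forall c, assoc corb corb corb (tmap cdelta (bid corb) (cdelta c)) =
                      tmap (bid corb) cdelta (cdelta c);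
  cdelta_epsl : forall c, lunit corb (tmap ceps (bid corb) (cdelta c)) = c;
  cdelta_epsr : forall c, runit corb (tmap (bid corb) ceps (cdelta c)) = c }.

(* Right comodules carrying a compatible left action of an algebra [E]; the   *)
(* category of right [C]-comodules is the case [E = kself k].                 *)
Record rcomod (E A : kalg k) (C : coring A) := Rcomod {
  rcb :> bimod E A;
  rho : bihom rcb (rcb ⊗b C);
  rhoA : forall x, assoc rcb C C (tmap rho (bid C) (rho x)) =
                   tmap (bid rcb) (cdelta C) (rho x);
  rho_eps : forall x, runit rcb (tmap (bid rcb) (ceps C) (rho x)) = x }.

Record lcomod (A F : kalg k) (C : coring A) := Lcomod {
  lcb :> bimod A F;
  lam : bihom lcb (C ⊗b lcb);
  lamA : forall x, assoc C C lcb (tmap (cdelta C) (bid lcb) (lam x)) =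
                   tmap (bid C) lam (lam x);
  lam_eps : forall x, lunit lcb (tmap (ceps C) (bid lcb) (lam x)) = x }.

Record bicomod (A B : kalg k) (C : coring A) (D : coring B) := Bicomod {
  bicb : bimod A B;
  blam : bihom bicb (C ⊗b bicb);
  blamA : forall x, assoc C C bicb (tmap (cdelta C) (bid bicb) (blam x)) =
                    tmap (bid C) blam (blam x);
  blam_eps : forall x, lunit bicb (tmap (ceps C) (bid bicb) (blam x)) = x;
  brho : bihom bicb (bicb ⊗b D);
  brhoA : forall x, assoc bicb D D (tmap brho (bid D) (brho x)) =
                    tmap (bid bicb) (cdelta D) (brho x);
  brho_eps : forall x, runit bicb (tmap (bid bicb) (ceps D) (brho x)) = x;
  blam_rho : forall x, assoc C bicb D (tmap blam (bid D) (brho x)) =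
                       tmap (bid C) brho (blam x) }.

Coercion lcomod_of (A B : kalg k) (C : coring A) (D : coring B)
  (X : bicomod C D) : lcomod B C := Lcomod (@blamA _ _ _ _ X) (@blam_eps _ _ _ _ X).
Coercion rcomod_of (A B : kalg k) (C : coring A) (D : coring B)
  (X : bicomod C D) : rcomod A D := Rcomod (@brhoA _ _ _ _ X) (@brho_eps _ _ _ _ X).

Definition cor_bicomod (A : kalg k) (C : coring A) : bicomod C C :=
  Bicomod (@cdeltaA _ C) (@cdelta_epsl _ C) (@cdeltaA _ C) (@cdelta_epsr _ C)
    (@cdeltaA _ C).

Record rchom (E A : kalg k) (C : coring A) (M N : rcomod E C) := Rchom {
  rch :> bihom M N;
  rchE : forall x, rho N (rch x) = tmap rch (bid C) (rho M x) }.

Record lchom (A F : kalg k) (C : coring A) (M N : lcomod F C) := Lchom {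
  lch :> bihom M N;
  lchE : forall x, lam N (lch x) = tmap (bid C) lch (lam M x) }.

Record bichom (A B : kalg k) (C : coring A) (D : coring B) (X Y : bicomod C D) :=
  Bichom {
  bich : bihom (bicb X) (bicb Y);
  bichL : forall x, blam Y (bich x) = tmap (bid C) bich (blam X x);
  bichR : forall x, brho Y (bich x) = tmap bich (bid D) (brho X x) }.

Coercion lchom_of (A B : kalg k) (C : coring A) (D : coring B)
  (X Y : bicomod C D) (f : bichom X Y) : lchom X Y :=
  @Lchom _ _ _ (lcomod_of X) (lcomod_of Y) (bich f) (bichL f).
Coercion rchom_of (A B : kalg k) (C : coring A) (D : coring B)
  (X Y : bicomod C D) (f : bichom X Y) : rchom X Y :=
  @Rchom _ _ _ (rcomod_of X) (rcomod_of Y) (bich f) (bichR f).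

Definition rc_iso (E A : kalg k) (C : coring A) (M N : rcomod E C)
  (f : rchom M N) : Prop := exists g : rchom N M, cancel f g /\ cancel g f.

Definition bic_iso (A B : kalg k) (C : coring A) (D : coring B)
  (X Y : bicomod C D) (f : bichom X Y) : Prop :=
  exists g : bichom Y X, cancel (bich f) (bich g) /\ cancel (bich g) (bich f).

End Comodules.

Section TmapTheory.
Context {k : comPzRingType}.

Lemma bcompE (A B : kalg k) (M N P : bimod A B) (g : bihom N P) (f : bihom M N)
  x : bcomp g f x = g (f x).
Proof. by []. Qed.

Lemma tmap_id (A B C : kalg k) (M : bimod A B) (N : bimod B C)
  (f : bihom M M) (g : bihom N N) : f =1 id -> g =1 id -> tmap f g =1 id.
Proof. by move=> hf hg t; tind t => m n; rewrite tmapE hf hg. Qed.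

Lemma tmap_ext (A B C : kalg k) (M M' : bimod A B) (N N' : bimod B C)
  (f f' : bihom M M') (g g' : bihom N N') :
  f =1 f' -> g =1 g' -> tmap f g =1 tmap f' g'.
Proof. by move=> hf hg t; tind t => m n; rewrite !tmapE hf hg. Qed.

Lemma tmap_comp (A B C : kalg k) (M M' M'' : bimod A B) (N N' N'' : bimod B C)
  (f : bihom M M') (f' : bihom M' M'') (g : bihom N N') (g' : bihom N' N'') t :
  tmap f' g' (tmap f g t) = tmap (bcomp f' f) (bcomp g' g) t.
Proof. by tind t => m n; rewrite !tmapE. Qed.

Lemma tmap_bsubl (A B C : kalg k) (M M' : bimod A B) (N N' : bimod B C)
  (f f' : bihom M M') (g : bihom N N') t :
  tmap (bsub f f') g t = tmap f g t - tmap f' g t.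
Proof.
move: t; apply: bpure_ind => [|x y hx hy|m n].
- by rewrite !bfun0 subr0.
- by rewrite !bfunD hx hy opprD addrACA.
rewrite !tmapE /=; apply: (addIr (f' m ⊗ g n)).
by rewrite -bpureDl !subrK.
Qed.

Lemma tmap_bsubr (A B C : kalg k) (M M' : bimod A B) (N N' : bimod B C)
  (f : bihom M M') (g g' : bihom N N') t :
  tmap f (bsub g g') t = tmap f g t - tmap f g' t.
Proof.
move: t; apply: bpure_ind => [|x y hx hy|m n].
- by rewrite !bfun0 subr0.
- by rewrite !bfunD hx hy opprD addrACA.
rewrite !tmapE /=; apply: (addIr (f m ⊗ g' n)).
by rewrite -bpureDr !subrK.
Qed.

Lemma assoc_nat (A B C D : kalg k) (M M' : bimod A B) (N N' : bimod B C)
  (P P' : bimod C D) (f : bihom M M') (g : bihom N N') (h : bihom P P') t :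
  assoc M' N' P' (tmap (tmap f g) h t) = tmap f (tmap g h) (assoc M N P t).
Proof. by tind t => u p; tind u => m n; rewrite !(tmapE, assocE). Qed.

Lemma assocV_nat (A B C D : kalg k) (M M' : bimod A B) (N N' : bimod B C)
  (P P' : bimod C D) (f : bihom M M') (g : bihom N N') (h : bihom P P') t :
  assocV M' N' P' (tmap f (tmap g h) t) = tmap (tmap f g) h (assocV M N P t).
Proof. by tind t => m u; tind u => n p; rewrite !(tmapE, assocVE). Qed.

Lemma runit_nat (A B : kalg k) (M N : bimod A B) (f : bihom M N) t :
  f (runit M t) = runit N (tmap f (bid _) t).
Proof. by tind t => m b; rewrite tmapE !runitE bfunR. Qed.

Lemma lunit_nat (A B : kalg k) (M N : bimod A B) (f : bihom M N) t :
  f (lunit M t) = lunit N (tmap (bid _) f t).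
Proof. by tind t => b m; rewrite tmapE !lunitE bfunL. Qed.

End TmapTheory.

Section TensorComodules.
Context {k : comPzRingType}.

Section Right.
Context {E A B : kalg k} {D : coring B} (M : bimod E A) (N : rcomod A D).

Definition tens_rho : bihom (M ⊗b N) (M ⊗b N ⊗b D) :=
  bcomp (assocV M N D) (tmap (bid M) (rho N)).

Lemma tens_rhoE m n : tens_rho (m ⊗ n) = assocV M N D (m ⊗ rho N n).
Proof. by rewrite bcompE tmapE. Qed.

Fact tens_rhoA t : assoc (M ⊗b N) D D (tmap tens_rho (bid D) (tens_rho t)) =
  tmap (bid (M ⊗b N)) (cdelta D) (tens_rho t).
Proof.
tind t => m n; rewrite tens_rhoE.
have h1 s : tmap (bid (M ⊗b N)) (cdelta D) (assocV M N D (m ⊗ s)) =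
    assocV M N _ (m ⊗ tmap (bid N) (cdelta D) s).
  by tind s => n' d; rewrite !(tmapE, assocVE).
rewrite h1 -rhoA; move: (rho N n) => s; tind s => n' d.
rewrite !(tmapE, assocVE) tens_rhoE; move: (rho N n') => s; tind s => n'' d'.
by rewrite !(assocE, assocVE).
Qed.

Fact tens_rho_eps t :
  runit (M ⊗b N) (tmap (bid (M ⊗b N)) (ceps D) (tens_rho t)) = t.
Proof.
tind t => m n; rewrite tens_rhoE -[in RHS](rho_eps n).
move: (rho N n) => s; tind s => n' d.
by rewrite !(tmapE, assocVE, runitE) ract_bpure.
Qed.

Definition tens_rcomod : rcomod E D := Rcomod tens_rhoA tens_rho_eps.
End Right.

Section Left.
Context {A B F : kalg k} {C : coring A} (M : lcomod B C) (N : bimod B F).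

Definition tens_lam : bihom (M ⊗b N) (C ⊗b (M ⊗b N)) :=
  bcomp (assoc C M N) (tmap (lam M) (bid N)).

Lemma tens_lamE m n : tens_lam (m ⊗ n) = assoc C M N (lam M m ⊗ n).
Proof. by rewrite bcompE tmapE. Qed.

Fact tens_lamA t :
  assoc C C (M ⊗b N) (tmap (cdelta C) (bid (M ⊗b N)) (tens_lam t)) =
  tmap (bid C) tens_lam (tens_lam t).
Proof.
tind t => m n; rewrite tens_lamE.
have h1 s : tmap (cdelta C) (bid (M ⊗b N)) (assoc C M N (s ⊗ n)) =
    assoc _ M N (tmap (cdelta C) (bid M) s ⊗ n).
  by tind s => c m'; rewrite !(tmapE, assocE).
have h2 s : assoc C C (M ⊗b N) (assoc _ M N (s ⊗ n)) =
    tmap (bid C) (assoc C M N) (assoc C _ N (assoc C C M s ⊗ n)).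
  by tind s => u m'; tind u => c c'; rewrite !(tmapE, assocE).
rewrite h1 h2 lamA; move: (lam M m) => s; tind s => c m'.
by rewrite !(tmapE, assocE) tens_lamE.
Qed.

Fact tens_lam_eps t :
  lunit (M ⊗b N) (tmap (ceps C) (bid (M ⊗b N)) (tens_lam t)) = t.
Proof.
tind t => m n; rewrite tens_lamE -[in RHS](lam_eps m).
move: (lam M m) => s; tind s => c m'.
by rewrite !(tmapE, assocE, lunitE) lact_bpure.
Qed.

Definition tens_lcomod : lcomod F C := Lcomod tens_lamA tens_lam_eps.
End Left.

Section Both.
Context {A B B' : kalg k} {C : coring A} {D : coring B'}.
Variables (M : lcomod B C) (N : rcomod B D).

Fact tens_lam_rho t : assoc C (M ⊗b N) D (tmap (tens_lam M N) (bid D) (tens_rho M N t)) =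
  tmap (bid C) (tens_rho M N) (tens_lam M N t).
Proof.
tind t => m n; rewrite tens_rhoE tens_lamE.
have h1 s : assoc C (M ⊗b N) D (tmap (tens_lam M N) (bid D) (assocV M N D (m ⊗ s))) =
    tmap (bid C) (assocV M N D) (assoc C M (N ⊗b D) (lam M m ⊗ s)).
  tind s => n' d; rewrite !(tmapE, assocVE) tens_lamE; move: (lam M m) => u.
  by tind u => c m'; rewrite !(tmapE, assocE, assocVE).
rewrite h1; move: (lam M m) => u; tind u => c m'.
by rewrite !(tmapE, assocE) tens_rhoE.
Qed.

Definition tens_bicomod : bicomod C D :=
  Bicomod (@tens_lamA _ _ _ _ M N) (@tens_lam_eps _ _ _ _ M N) (@tens_rhoA _ _ _ _ M N)
    (@tens_rho_eps _ _ _ _ M N) tens_lam_rho.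
End Both.

End TensorComodules.

(* If tensoring with the coring preserves the kernel of a comodule morphism,  *)
(* then this kernel is a comodule, for the unique coaction that makes the     *)
(* inclusion colinear ([ker_rhoE], [ker_lamE]).                               *)
Section KernelComodules.
Context {k : comPzRingType}.

Definition rstable (E A : kalg k) (M N : bimod E A) (h : bihom M N)
    (V : bimod A A) : Prop :=
  left_exact (tmap (kin h) (bid V)) (tmap h (bid V)) /\
  injective (tmap (tmap (kin h) (bid V)) (bid V)).

Definition lstable (E A : kalg k) (M N : bimod A E) (h : bihom M N)
    (V : bimod A A) : Prop :=
  left_exact (tmap (bid V) (kin h)) (tmap (bid V) h) /\
  injective (tmap (bid V) (tmap (bid V) (kin h))).

Section Right.
Context {E A : kalg k} {C : coring A} {M N : rcomod E C} (h : rchom M N).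
Hypothesis hS : rstable h C.
Let i := kin h.

Fact ker_rho_ex x : exists s, tmap i (bid C) s = rho M (i x).
Proof. by apply/(proj2 (proj1 hS)); rewrite -rchE kinE bfun0. Qed.

Definition ker_rho_fun x := projT1 (cid (ker_rho_ex x)).

Fact ker_rho_funE x : tmap i (bid C) (ker_rho_fun x) = rho M (i x).
Proof. exact: projT2 (cid (ker_rho_ex x)). Qed.

Fact ker_rho_funB : zmod_morphism ker_rho_fun.
Proof.
by move=> x y; apply: (proj1 (proj1 hS)); rewrite bfunB !ker_rho_funE !bfunB.
Qed.
Fact ker_rho_funL a x : ker_rho_fun (lact a x) = lact a (ker_rho_fun x).
Proof.
by apply: (proj1 (proj1 hS)); rewrite bfunL !ker_rho_funE !bfunL.
Qed.
Fact ker_rho_funR x a : ker_rho_fun (ract x a) = ract (ker_rho_fun x) a.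
Proof.
by apply: (proj1 (proj1 hS)); rewrite bfunR !ker_rho_funE !bfunR.
Qed.

Definition ker_rho : bihom (kerb h) (kerb h ⊗b C) :=
  Bihom ker_rho_funB ker_rho_funL ker_rho_funR.

Lemma ker_rhoE x : tmap i (bid C) (ker_rho x) = rho M (i x).
Proof. exact: ker_rho_funE. Qed.

Fact ker_rhoA x : assoc _ C C (tmap ker_rho (bid C) (ker_rho x)) =
  tmap (bid _) (cdelta C) (ker_rho x).
Proof.
have inj : injective (tmap i (tmap (bid C) (bid C))).
  move=> s t; rewrite -[s](assocVK s) -[t](assocVK t) -!assoc_nat.
  by move=> /(can_inj (@assocK _ _ _ _ _ _ _ _))/(proj2 hS) ->.
apply: inj; rewrite -assoc_nat tmap_comp.
rewrite (@tmap_ext _ _ _ _ _ _ _ _ _ (bcomp (rho M) i) _ (bcomp (bid C) (bid C)))//.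
  rewrite -tmap_comp ker_rhoE rhoA tmap_comp.
  rewrite [RHS](@tmap_ext _ _ _ _ _ _ _ _ _
    (bcomp (bid _) i) _ (bcomp (cdelta C) (bid C))) => [|//|y].
    by rewrite -tmap_comp ker_rhoE.
  by rewrite !bcompE tmap_id.
by move=> y; rewrite !bcompE ker_rhoE.
Qed.

Fact ker_rho_eps x : runit _ (tmap (bid _) (ceps C) (ker_rho x)) = x.
Proof.
apply: (@kin_inj _ _ _ _ _ h); rewrite runit_nat tmap_comp.
rewrite (@tmap_ext _ _ _ _ _ _ _ _ _ (bcomp (bid _) i) _ (bcomp (ceps C) (bid C)))//.
by rewrite -tmap_comp ker_rhoE rho_eps.
Qed.

Definition ker_rcomod : rcomod E C := Rcomod ker_rhoA ker_rho_eps.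
End Right.

Section Left.
Context {E A : kalg k} {C : coring A} {M N : lcomod E C} (h : lchom M N).
Hypothesis hS : lstable h C.
Let i := kin h.

Fact ker_lam_ex x : exists s, tmap (bid C) i s = lam M (i x).
Proof. by apply/(proj2 (proj1 hS)); rewrite -lchE kinE bfun0. Qed.

Definition ker_lam_fun x := projT1 (cid (ker_lam_ex x)).

Fact ker_lam_funE x : tmap (bid C) i (ker_lam_fun x) = lam M (i x).
Proof. exact: projT2 (cid (ker_lam_ex x)). Qed.

Fact ker_lam_funB : zmod_morphism ker_lam_fun.
Proof.
by move=> x y; apply: (proj1 (proj1 hS)); rewrite bfunB !ker_lam_funE !bfunB.
Qed.
Fact ker_lam_funL a x : ker_lam_fun (lact a x) = lact a (ker_lam_fun x).
Proof.
by apply: (proj1 (proj1 hS)); rewrite bfunL !ker_lam_funE !bfunL.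
Qed.
Fact ker_lam_funR x a : ker_lam_fun (ract x a) = ract (ker_lam_fun x) a.
Proof.
by apply: (proj1 (proj1 hS)); rewrite bfunR !ker_lam_funE !bfunR.
Qed.

Definition ker_lam : bihom (kerb h) (C ⊗b kerb h) :=
  Bihom ker_lam_funB ker_lam_funL ker_lam_funR.

Lemma ker_lamE x : tmap (bid C) i (ker_lam x) = lam M (i x).
Proof. exact: ker_lam_funE. Qed.

Fact ker_lamA x : assoc C C _ (tmap (cdelta C) (bid _) (ker_lam x)) =
  tmap (bid C) ker_lam (ker_lam x).
Proof.
apply: (proj2 hS); rewrite -assoc_nat tmap_comp.
rewrite (@tmap_ext _ _ _ _ _ _ _ _ _
  (bcomp (cdelta C) (bid C)) _ (bcomp (bid _) i)) => [|y|//]; last first.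
  by rewrite !bcompE tmap_id.
rewrite -tmap_comp ker_lamE lamA tmap_comp.
rewrite [RHS](@tmap_ext _ _ _ _ _ _ _ _ _
    (bcomp (bid C) (bid _)) _ (bcomp (lam M) i)) => [|//|y].
  by rewrite -tmap_comp ker_lamE.
by rewrite !bcompE ker_lamE.
Qed.

Fact ker_lam_eps x : lunit _ (tmap (ceps C) (bid _) (ker_lam x)) = x.
Proof.
apply: (@kin_inj _ _ _ _ _ h); rewrite lunit_nat tmap_comp.
rewrite (@tmap_ext _ _ _ _ _ _ _ _ _ (bcomp (ceps C) (bid C)) _ (bcomp (bid _) i))//.
by rewrite -tmap_comp ker_lamE lam_eps.
Qed.

Definition ker_lcomod : lcomod E C := Lcomod ker_lamA ker_lam_eps.
End Left.

Section Both.
Context {A B : kalg k} {C : coring A} {D : coring B} {X Y : bicomod C D}.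
Variable h : bichom X Y.

Definition bistable : Prop :=
  [/\ lstable (bich h) C, rstable (bich h) D &
      injective (tmap (bid C) (tmap (kin (bich h)) (bid D)))].

Hypothesis hS : bistable.
Let hL : lstable (lchom_of h) C. Proof. by case: hS. Qed.
Let hR : rstable (rchom_of h) D. Proof. by case: hS. Qed.

Fact ker_lam_rho x : assoc C _ D (tmap (ker_lam hL) (bid D) (ker_rho hR x)) =
  tmap (bid C) (ker_rho hR) (ker_lam hL x).
Proof.
have [_ _ inj] := hS; apply: inj; rewrite -assoc_nat !tmap_comp.
have lE := ker_lamE hL; have rE := ker_rhoE hR.
rewrite (@tmap_ext _ _ _ _ _ _ _ _ _
  (bcomp (blam X) (kin (bich h))) _ (bcomp (bid D) (bid D))) => [|y|//]; last first.
  by rewrite !bcompE lE.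
rewrite -tmap_comp rE blam_rho -(lE x) !tmap_comp.
by apply: tmap_ext => // y; rewrite !bcompE rE.
Qed.

Definition ker_bicomod : bicomod C D :=
  Bicomod (ker_lamA hL) (ker_lam_eps hL) (ker_rhoA hR) (ker_rho_eps hR)
    ker_lam_rho.
End Both.

End KernelComodules.

Section Cotensor.
Context {k : comPzRingType}.

Section Def.
Context {E A F : kalg k} {C : coring A} (M : rcomod E C) (N : lcomod F C).

Definition omega_l : bihom (M ⊗b N) (M ⊗b (C ⊗b N)) :=
  bcomp (assoc M C N) (tmap (rho M) (bid N)).
Definition omega_r : bihom (M ⊗b N) (M ⊗b (C ⊗b N)) := tmap (bid M) (lam N).

Definition omega := bsub omega_l omega_r.

Definition cotens : bimod E F := kerb omega.

Lemma omegaE t : omega t = omega_l t - omega_r t.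
Proof. by []. Qed.

Lemma omegaP t : omega t = 0 <-> omega_l t = omega_r t.
Proof. by split=> [/subr0_eq|h] //; apply/eqP; rewrite subr_eq0 h. Qed.
End Def.

Section Colinear.
Context {E A F : kalg k} {C : coring A}.

Section Right.
Context {D : coring F} (M : rcomod E C) (X : bicomod C D).
Let S := tens_rcomod M (tens_rcomod C X).

Fact omega_l_rc t : tens_rho M (tens_rcomod C X) (omega_l M X t) =
  tmap (omega_l M X) (bid D) (tens_rho M X t).
Proof.
tind t => m x; rewrite /omega_l !bcompE !tmapE.
have h1 u : assocV M (C ⊗b bicb X) D (tmap (bid M) (tens_rho C X) (assoc M C X (u ⊗ x))) =
    tmap (assoc M C X) (bid D) (assocV (M ⊗b C) X D (u ⊗ brho X x)).
  tind u => m' c; rewrite assocE tmapE tens_rhoE; move: (rho X x) => s.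
  by tind s => x' d; rewrite !(assocVE, assocE, tmapE).
rewrite [LHS]h1; move: (brho X x) => s; tind s => x' d.
by rewrite !(assocVE, assocE, tmapE, bcompE).
Qed.

Fact omega_r_rc t : tens_rho M (tens_rcomod C X) (omega_r M X t) =
  tmap (omega_r M X) (bid D) (tens_rho M X t).
Proof.
tind t => m x; rewrite /omega_r tmapE !tens_rhoE bcompE.
rewrite -[tmap (bid C) _ _](blam_rho x) assocK.
by move: (brho X x) => s; tind s => x' d; rewrite !(assocVE, assocE, tmapE).
Qed.

Fact omega_rcP t : rho S (omega M X t) =
  tmap (omega M X) (bid D) (rho (tens_rcomod M X) t).
Proof. by rewrite tmap_bsubl bfunB omega_l_rc omega_r_rc. Qed.

Definition omega_rchom : rchom (tens_rcomod M X) S :=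
  @Rchom _ _ _ _ (tens_rcomod M X) S (omega M X) omega_rcP.
End Right.

Section Left.
Context {D : coring E} (X : bicomod D C) (N : lcomod F C).
Let S := tens_lcomod X (C ⊗b N).

Fact omega_l_lc t : tens_lam X (C ⊗b N) (omega_l X N t) =
  tmap (bid D) (omega_l X N) (tens_lam X N t).
Proof.
tind t => x n; rewrite /omega_l !bcompE !tmapE.
have h1 s : assoc D X (C ⊗b N) (tmap (blam X) (bid _) (assoc X C N (s ⊗ n))) =
   tmap (bid D) (assoc X C N) (assoc D _ N (assoc D X C (tmap (blam X) (bid C) s) ⊗ n)).
  tind s => x' c; rewrite !(assocE, tmapE); move: (blam X x') => u.
  by tind u => d x''; rewrite !(assocVE, assocE, tmapE).
rewrite [LHS]h1 blam_rho; move: (blam X x) => s; tind s => d x'.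
by rewrite !(assocVE, assocE, tmapE, bcompE).
Qed.

Fact omega_r_lc t : tens_lam X (C ⊗b N) (omega_r X N t) =
  tmap (bid D) (omega_r X N) (tens_lam X N t).
Proof.
tind t => x n; rewrite /omega_r tmapE !tens_lamE.
by move: (lam X x) => s; tind s => d x'; rewrite !(assocVE, assocE, tmapE).
Qed.

Fact omega_lcP t : lam S (omega X N t) =
  tmap (bid D) (omega X N) (lam (tens_lcomod X N) t).
Proof. by rewrite tmap_bsubr bfunB omega_l_lc omega_r_lc. Qed.

Definition omega_lchom : lchom (tens_lcomod X N) S :=
  @Lchom _ _ _ _ (tens_lcomod X N) S (omega X N) omega_lcP.
End Left.

Definition omega_bichom (D : coring E) (D' : coring F)
    (X : bicomod D C) (Y : bicomod C D') :
    bichom (tens_bicomod X Y) (tens_bicomod X (tens_rcomod C Y)) :=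
  @Bichom _ _ _ _ _ (tens_bicomod X Y) (tens_bicomod X (tens_rcomod C Y))
    (omega X Y) (@omega_lcP D X Y) (@omega_rcP D' X Y).

End Colinear.

Section Flat.

Section Forget.
Context {E A : kalg k}.

Definition rforget (M : bimod E A) : bimod (kself k) A.
Proof.
exists M (fun c x => ract x (kmap A c)) (@ract _ _ _ M).
- by move=> c x y; rewrite ractDl.
- by move=> c d x; rewrite /= rmorphD ractDr.
- by move=> c d x; rewrite /= -ractM -rmorphM mulrC.
- by move=> x; rewrite /= rmorph1 ract1.
- exact: ractDl.
- exact: ractDr.
- exact: ractM.
- exact: ract1.
- by move=> c x b; rewrite -!ractM kmapC.
- by [].
Defined.

Definition rforget_hom (M N : bimod E A) (f : bihom M N) :
  bihom (rforget M) (rforget N).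
Proof.
by refine (@Bihom _ _ _ (rforget M) (rforget N) (bfun f) _ _ _);
  [exact: (bfunB f)|move=> c x; exact: (bfunR f)|exact: (bfunR f)].
Defined.

Definition lforget (M : bimod A E) : bimod A (kself k).
Proof.
exists M (@lact _ _ _ M) (fun x c => lact (kmap A c) x).
- exact: lactDr.
- exact: lactDl.
- exact: lactM.
- exact: lact1.
- by move=> x y c; rewrite lactDr.
- by move=> x c d; rewrite /= rmorphD lactDl.
- by move=> x c d; rewrite /= -lactM -rmorphM mulrC.
- by move=> x; rewrite /= rmorph1 lact1.
- by move=> a x c; rewrite -!lactM kmapC.
- by [].
Defined.

Definition lforget_hom (M N : bimod A E) (f : bihom M N) :
  bihom (lforget M) (lforget N).
Proof.
by refine (@Bihom _ _ _ (lforget M) (lforget N) (bfun f) _ _ _);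
  [exact: (bfunB f)|exact: (bfunL f)|move=> x c; exact: (bfunL f)].
Defined.
End Forget.

Lemma flat_l_exact (E A F : kalg k) (V : bimod A F) : flat_l V ->
  forall (M N P : bimod E A) (f : bihom M N) (g : bihom N P),
  exact f g -> exact (tmap f (bid V)) (tmap g (bid V)).
Proof. by move=> hV M N P f g fg; apply: (hV _ _ _ (rforget_hom f) (rforget_hom g)). Qed.

Lemma flat_r_exact (E A F : kalg k) (V : bimod F A) : flat_r V ->
  forall (M N P : bimod A E) (f : bihom M N) (g : bihom N P),
  exact f g -> exact (tmap (bid V) f) (tmap (bid V) g).
Proof. by move=> hV M N P f g fg; apply: (hV _ _ _ (lforget_hom f) (lforget_hom g)). Qed.

Lemma tmap_zerol (A B C : kalg k) (M M' : bimod A B) (N N' : bimod B C)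
  (g : bihom N N') t : tmap (bzero M M') g t = 0.
Proof.
by move: t; apply: bpure_ind => [|x y hx hy|m n];
  rewrite ?bfun0 ?bfunD ?hx ?hy ?addr0 // tmapE bpure0l.
Qed.

Lemma tmap_zeror (A B C : kalg k) (M M' : bimod A B) (N N' : bimod B C)
  (f : bihom M M') t : tmap f (bzero N N') t = 0.
Proof.
by move: t; apply: bpure_ind => [|x y hx hy|m n];
  rewrite ?bfun0 ?bfunD ?hx ?hy ?addr0 // tmapE bpure0r.
Qed.

Lemma exact_zero_inj (A B : kalg k) (K M N : bimod A B) (f : bihom M N) :
  exact (bzero K M) f <-> injective f.
Proof.
split=> [ex x y fxy|fI y]; last first.
  split=> [fy0|[x <-]]; last exact: bfun0.
  by exists 0; apply: fI; rewrite fy0 !bfun0.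
apply/eqP; rewrite -subr_eq0; apply/eqP.
have /ex[z <-] // : f (x - y) = 0 by rewrite bfunB fxy subrr.
Qed.

Lemma kin_exact (A B : kalg k) (M N : bimod A B) (h : bihom M N) :
  exact (kin h) h.
Proof.
by move=> y; split=> [hy|[x <-]]; [exists (kmk hy)|exact: kinE].
Qed.

Lemma flat_l_inj (E A F : kalg k) (V : bimod A F) : flat_l V ->
  forall (M N : bimod E A) (f : bihom M N),
  injective f -> injective (tmap f (bid V)).
Proof.
move=> hV M N f fI; apply/(@exact_zero_inj _ _ (M ⊗b V)).
have := flat_l_exact hV ((exact_zero_inj M f).2 fI).
move=> ex y; split=> [/ex[x <-]|[x <-]]; last by rewrite bfun0.
by exists 0; rewrite tmap_zerol.
Qed.

Lemma flat_r_inj (E A F : kalg k) (V : bimod F A) : flat_r V ->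
  forall (M N : bimod A E) (f : bihom M N),
  injective f -> injective (tmap (bid V) f).
Proof.
move=> hV M N f fI; apply/(@exact_zero_inj _ _ (V ⊗b M)).
have := flat_r_exact hV ((exact_zero_inj M f).2 fI).
move=> ex y; split=> [/ex[x <-]|[x <-]]; last by rewrite bfun0.
by exists 0; rewrite tmap_zeror.
Qed.

Lemma flat_rstable (E A : kalg k) (V : bimod A A) : flat_l V ->
  forall (M N : bimod E A) (h : bihom M N), rstable h V.
Proof.
move=> hV M N h; have iI := flat_l_inj hV (@kin_inj _ _ _ _ _ h).
by split; [split=> //; apply: flat_l_exact (kin_exact h)|apply: flat_l_inj].
Qed.

Lemma flat_lstable (E A : kalg k) (V : bimod A A) : flat_r V ->
  forall (M N : bimod A E) (h : bihom M N), lstable h V.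
Proof.
move=> hV M N h; have iI := flat_r_inj hV (@kin_inj _ _ _ _ _ h).
by split; [split=> //; apply: flat_r_exact (kin_exact h)|apply: flat_r_inj].
Qed.

Lemma flat_bistable (A B : kalg k) (C : coring A) (D : coring B) :
  flat_r C -> flat_l D ->
  forall (X Y : bicomod C D) (h : bichom X Y), bistable h.
Proof.
move=> hC hD X Y h; split; [exact: flat_lstable|exact: flat_rstable|].
exact/(flat_r_inj hC)/(flat_l_inj hD)/kin_inj.
Qed.
End Flat.

Definition coseparable (A : kalg k) (C : coring A) : Prop :=
  exists p : bichom (tens_bicomod (cor_bicomod C) (cor_bicomod C)) (cor_bicomod C),
  forall c, bich p (cdelta C c) = c.

Section Coseparable.

Section Split.
Context {A B : kalg k} {M N : bimod A B} (h : bihom M N).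
Variables (e : bihom M M) (sg : bihom N M).
Hypotheses (he : forall t, h (e t) = 0) (eE : forall t, t = e t + sg (h t)).

Let r : bihom M (kerb h) := klift he.

Fact splitK x : r (kin h x) = x.
Proof. by apply: (@kin_inj _ _ _ _ _ h); rewrite [RHS]eE kinE bfun0 addr0. Qed.

Fact split_exactr (E : kalg k) (V : bimod B E) :
  left_exact (tmap (kin h) (bid V)) (tmap h (bid V)).
Proof.
split=> [|t].
  apply: (can_inj (g := tmap r (bid V))) => t.
  by rewrite tmap_comp tmap_id // => x; rewrite bcompE splitK.
split=> [t0|[s <-]]; last first.
  rewrite tmap_comp -[RHS](@tmap_zerol _ _ _ (kerb h) N V V (bid V) s).
  by apply: tmap_ext => // x; apply: kinE.
exists (tmap r (bid V) t); rewrite tmap_comp.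
rewrite [RHS](_ : t = tmap (bcomp (kin h) r) (bid V) t + tmap sg (bid V) (tmap h (bid V) t)).
  by rewrite t0 bfun0 addr0; apply: tmap_ext.
clear t0; move: t; apply: bpure_ind => [|x y hx hy|m v].
- by rewrite !bfun0 addr0.
- by rewrite !bfunD addrACA -hx -hy.
by rewrite !tmapE -bpureDl; congr (_ ⊗ _); apply: eE.
Qed.

Fact split_exactl (E : kalg k) (V : bimod E A) :
  left_exact (tmap (bid V) (kin h)) (tmap (bid V) h).
Proof.
split=> [|t].
  apply: (can_inj (g := tmap (bid V) r)) => t.
  by rewrite tmap_comp tmap_id // => x; rewrite bcompE splitK.
split=> [t0|[s <-]]; last first.
  rewrite tmap_comp -[RHS](@tmap_zeror _ _ _ V V (kerb h) N (bid V) s).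
  by apply: tmap_ext => // x; apply: kinE.
exists (tmap (bid V) r t); rewrite tmap_comp.
rewrite [RHS](_ : t = tmap (bid V) (bcomp (kin h) r) t + tmap (bid V) sg (tmap (bid V) h t)).
  by rewrite t0 bfun0 addr0; apply: tmap_ext.
clear t0; move: t; apply: bpure_ind => [|x y hx hy|v m].
- by rewrite !bfun0 addr0.
- by rewrite !bfunD addrACA -hx -hy.
by rewrite !tmapE -bpureDr; congr (_ ⊗ _); apply: eE.
Qed.

Fact split_rstable (V : bimod B B) : rstable h V.
Proof.
split; first exact: split_exactr.
apply: (can_inj (g := tmap (tmap r (bid V)) (bid V))) => t.
rewrite tmap_comp tmap_id // => u; rewrite bcompE tmap_comp tmap_id // => x.
by rewrite bcompE splitK.
Qed.

Fact split_lstable (V : bimod A A) : lstable h V.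
Proof.
split; first exact: split_exactl.
apply: (can_inj (g := tmap (bid V) (tmap (bid V) r))) => t.
rewrite tmap_comp tmap_id // => u; rewrite bcompE tmap_comp tmap_id // => x.
by rewrite bcompE splitK.
Qed.

Fact split_inj (U : bimod A A) (V : bimod B B) :
  injective (tmap (bid U) (tmap (kin h) (bid V))).
Proof.
apply: (can_inj (g := tmap (bid U) (tmap r (bid V)))) => t.
rewrite tmap_comp tmap_id // => u; rewrite bcompE tmap_comp tmap_id // => x.
by rewrite bcompE splitK.
Qed.
End Split.

Section SplitOmega.
Context {A B F : kalg k} {D : coring B}.
Variable p : bichom (tens_bicomod (cor_bicomod D) (cor_bicomod D)) (cor_bicomod D).
Hypothesis pK : forall d, bich p (cdelta D d) = d.
Variables (X : rcomod A D) (L : lcomod F D).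

Let pi : bihom (D ⊗b D) D := bich p.
Let del : bihom (D ⊗b D) (breg B) := bcomp (ceps D) pi.

Let pL t : cdelta D (pi t) = tmap (bid D) pi (tens_lam (cor_bicomod D) D t).
Proof. exact: (bichL p). Qed.
Let pR t : cdelta D (pi t) = tmap pi (bid D) (tens_rho D (cor_bicomod D) t).
Proof. exact: (bichR p). Qed.

Let contr : bihom (X ⊗b D ⊗b (D ⊗b L)) (X ⊗b L) :=
  bcomp (tmap (bid X) (bcomp (lunit L) (tmap del (bid L))))
    (bcomp (tmap (bid X) (assocV D D L)) (assoc X D (D ⊗b L))).

Let contrE x d d' l : contr ((x ⊗ d) ⊗ (d' ⊗ l)) = x ⊗ lact (del (d ⊗ d')) l.
Proof. by rewrite !bcompE assocE !tmapE assocVE bcompE tmapE lunitE. Qed.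

Let mid : bihom (X ⊗b D ⊗b (D ⊗b L)) (X ⊗b (D ⊗b L)) :=
  bcomp (tmap (bid X) (tmap pi (bid L)))
    (bcomp (tmap (bid X) (assocV D D L)) (assoc X D (D ⊗b L))).

Let midE x d d' l : mid ((x ⊗ d) ⊗ (d' ⊗ l)) = x ⊗ (pi (d ⊗ d') ⊗ l).
Proof. by rewrite !bcompE assocE !tmapE assocVE tmapE. Qed.

Let sg : bihom (X ⊗b (D ⊗b L)) (X ⊗b L) := bcomp contr (tmap (rho X) (bid _)).
Let e : bihom (X ⊗b L) (X ⊗b L) := bcomp contr (tmap (rho X) (lam L)).

Let q : bihom (D ⊗b D ⊗b D) D :=
  bcomp (runit D) (bcomp (tmap (bid D) del) (assoc D D D)).
Let q' : bihom (D ⊗b (D ⊗b D)) D :=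
  bcomp (lunit D) (bcomp (tmap del (bid D)) (assocV D D D)).

Let qE d d' : q (cdelta D d ⊗ d') = pi (d ⊗ d').
Proof.
rewrite -[RHS](cdelta_epsr (pi _)) pL tens_lamE !bcompE.
move: (cdelta D d) => s.
by rewrite tmap_comp; congr (runit _ _); apply: tmap_ext.
Qed.

Let q'E d d' : q' (d ⊗ cdelta D d') = pi (d ⊗ d').
Proof.
rewrite -[RHS](cdelta_epsl (pi _)) pR tens_rhoE !bcompE.
by rewrite tmap_comp; congr (lunit _ _); apply: tmap_ext.
Qed.

Let omega_l_contr x v : omega_l X L (contr (rho X x ⊗ v)) = mid (rho X x ⊗ v).
Proof.
pose Q : bihom (X ⊗b (D ⊗b D) ⊗b (D ⊗b L)) (X ⊗b (D ⊗b L)) :=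
  bcomp (tmap (bid X) (tmap q (bid L)))
    (bcomp (tmap (bid X) (assocV (D ⊗b D) D L)) (assoc X (D ⊗b D) (D ⊗b L))).
have QE y z d l : Q (y ⊗ z ⊗ (d ⊗ l)) = y ⊗ (q (z ⊗ d) ⊗ l).
  by rewrite !bcompE assocE !tmapE assocVE tmapE.
tind v => d l.
have h1 u : omega_l X L (contr (u ⊗ (d ⊗ l))) =
    Q (assoc X D D (tmap (rho X) (bid D) u) ⊗ (d ⊗ l)).
  tind u => y d'; rewrite contrE tmapE bcompE tmapE.
  move: (rho X y) => w; tind w => y' d''; rewrite !assocE QE.
  by rewrite !bcompE assocE tmapE runitE bpureM.
have h2 u : Q (tmap (bid X) (cdelta D) u ⊗ (d ⊗ l)) = mid (u ⊗ (d ⊗ l)).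
  by tind u => y d'; rewrite tmapE QE midE qE.
by rewrite h1 rhoA h2.
Qed.

Let omega_r_contr u l : omega_r X L (contr (u ⊗ lam L l)) = mid (u ⊗ lam L l).
Proof.
pose Q : bihom (X ⊗b D ⊗b (D ⊗b (D ⊗b L))) (X ⊗b (D ⊗b L)) :=
  bcomp (tmap (bid X) (bcomp (tmap q' (bid L)) (assocV D (D ⊗b D) L)))
    (bcomp (tmap (bid X) (tmap (bid D) (assocV D D L)))
           (assoc X D (D ⊗b (D ⊗b L)))).
have QE y d d' v : Q ((y ⊗ d) ⊗ (d' ⊗ v)) = y ⊗ lact (del (d ⊗ d')) v.
  tind v => d'' l'; rewrite !bcompE assocE !tmapE assocVE bcompE assocVE tmapE.
  by rewrite !bcompE assocVE tmapE lunitE lact_bpure.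
have QE' y d z l' : Q ((y ⊗ d) ⊗ assoc D D L (z ⊗ l')) = y ⊗ (q' (d ⊗ z) ⊗ l').
  by rewrite !bcompE assocE !tmapE assocK bcompE assocVE tmapE.
tind u => y d.
have h1 v : omega_r X L (contr ((y ⊗ d) ⊗ v)) =
    Q ((y ⊗ d) ⊗ tmap (bid D) (lam L) v).
  by tind v => d' l'; rewrite contrE !tmapE QE bfunL.
have h2 v : Q ((y ⊗ d) ⊗ assoc D D L (tmap (cdelta D) (bid L) v)) =
    mid ((y ⊗ d) ⊗ v).
  by tind v => d' l'; rewrite tmapE QE' midE q'E.
by rewrite h1 -lamA h2.
Qed.

Let omega_e t : omega X L (e t) = 0.
Proof.
apply/omegaP; tind t => x l.
have -> : e (x ⊗ l) = contr (rho X x ⊗ lam L l) by rewrite bcompE tmapE.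
by rewrite omega_l_contr omega_r_contr.
Qed.

Let e_sg t : t = e t + sg (omega X L t).
Proof.
have -> : omega X L t = omega_l X L t - omega_r X L t by [].
rewrite bfunB.
have -> : sg (omega_r X L t) = e t.
  by rewrite bcompE tmap_comp bcompE; congr (contr _); apply: tmap_ext.
rewrite addrC subrK; apply/esym; tind t => x l.
have -> : omega_l X L (x ⊗ l) = assoc X D L (rho X x ⊗ l) by rewrite bcompE tmapE.
pose Q : bihom (X ⊗b (D ⊗b D) ⊗b L) (X ⊗b L) :=
  bcomp (tmap (bid X) (bcomp (lunit L) (tmap del (bid L)))) (assoc X (D ⊗b D) L).
have QE y z l' : Q (y ⊗ z ⊗ l') = y ⊗ lact (del z) l'.
  by rewrite bcompE assocE tmapE bcompE tmapE lunitE.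
have h1 u : sg (assoc X D L (u ⊗ l)) =
    Q (assoc X D D (tmap (rho X) (bid D) u) ⊗ l).
  tind u => y d; rewrite assocE bcompE !tmapE; move: (rho X y) => w.
  by tind w => y' d'; rewrite contrE assocE QE.
have h2 u : Q (tmap (bid X) (cdelta D) u ⊗ l) =
    runit X (tmap (bid X) (ceps D) u) ⊗ l.
  by tind u => y d; rewrite !tmapE QE runitE bpureM /del bcompE [pi _]pK.
by rewrite h1 rhoA h2 rho_eps.
Qed.

Lemma cosep_split : exists (e : bihom (X ⊗b L) (X ⊗b L))
    (sg : bihom (X ⊗b (D ⊗b L)) (X ⊗b L)),
  (forall t, omega X L (e t) = 0) /\ (forall t, t = e t + sg (omega X L t)).
Proof. by exists e, sg. Qed.
End SplitOmega.

Lemma cosep_bistable (A B F : kalg k) (C : coring A) (D : coring B)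
    (C' : coring F) (X : bicomod C D) (Y : bicomod D C') :
  coseparable D -> bistable (omega_bichom X Y).
Proof.
case=> p pK; have [e [sg [he eE]]] := cosep_split pK X Y.
split; [exact: split_lstable he eE _|exact: split_rstable he eE _|].
exact: split_inj he eE _ _.
Qed.

End Coseparable.

End Cotensor.

Section Functors.
Context {k : comPzRingType}.

Section Maps.
Context {E A F : kalg k} {C : coring A}.

Fact cotmapl_subproof (M M' : rcomod E C) (N : lcomod F C) (f : rchom M M')
  (x : cotens M N) : omega M' N (tmap f (bid N) (kin (omega M N) x)) = 0.
Proof.
rewrite -[RHS](bfun0 (tmap f (bid (C ⊗b N)))) -(kinE x).
move: (kin _ x) => t; rewrite !omegaE bfunB; congr (_ - _); rewrite ?/omega_l ?/omega_r.
  tind t => m n; rewrite !bcompE !tmapE rchE; move: (rho M m) => s.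
  by tind s => m' c; rewrite !(tmapE, assocE).
by tind t => m n; rewrite !tmapE.
Qed.

Definition cotmapl (M M' : rcomod E C) (N : lcomod F C) (f : rchom M M') :
    bihom (cotens M N) (cotens M' N) :=
  @klift _ _ _ _ _ (omega M' N) _
    (bcomp (tmap f (bid N)) (kin (omega M N))) (cotmapl_subproof f).

Fact cotmapr_subproof (M : rcomod E C) (N N' : lcomod F C) (g : lchom N N')
  (x : cotens M N) : omega M N' (tmap (bid M) g (kin (omega M N) x)) = 0.
Proof.
rewrite -[RHS](bfun0 (tmap (bid M) (tmap (bid C) g))) -(kinE x).
move: (kin _ x) => t; rewrite !omegaE bfunB; congr (_ - _); rewrite ?/omega_l ?/omega_r.
  tind t => m n; rewrite !bcompE !tmapE; move: (rho M m) => s.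
  by tind s => m' c; rewrite !(tmapE, assocE).
by tind t => m n; rewrite !tmapE lchE.
Qed.

Definition cotmapr (M : rcomod E C) (N N' : lcomod F C) (g : lchom N N') :
    bihom (cotens M N) (cotens M N') :=
  @klift _ _ _ _ _ (omega M N') _
    (bcomp (tmap (bid M) g) (kin (omega M N))) (cotmapr_subproof g).

End Maps.

Definition cot_unitr (E A : kalg k) (C : coring A) (M : rcomod E C) :
    bihom (cotens M (cor_bicomod C)) M :=
  bcomp (runit M) (bcomp (tmap (bid M) (ceps C)) (kin (omega M (cor_bicomod C)))).

Definition cot_unitl (A F : kalg k) (C : coring A) (N : lcomod F C) :
    bihom (cotens (cor_bicomod C) N) N :=
  bcomp (lunit N) (bcomp (tmap (ceps C) (bid N)) (kin (omega (cor_bicomod C) N))).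

(* Since the category of right comodules is only considered when the coring   *)
(* is flat as a left module, exactness there is exactness of the underlying   *)
(* sequences of modules.                                                      *)
Definition coflat (A F : kalg k) (C : coring A) (N : lcomod F C) : Prop :=
  forall (M1 M2 M3 : rcomod (kself k) C) (f : rchom M1 M2) (g : rchom M2 M3),
  short_exact f g -> short_exact (cotmapl N f) (cotmapl N g).

Record cfunctor (A B : kalg k) (C : coring A) (D : coring B) := Cfunctor {
  fob :> rcomod (kself k) C -> rcomod (kself k) D;
  fmor : forall M N, rchom M N -> rchom (fob M) (fob N);
  fmor_id : forall M (f : rchom M M), f =1 id -> fmor f =1 id;
  fmor_comp : forall M N P (f : rchom M N) (g : rchom N P) (h : rchom M P),
    (forall x, h x = g (f x)) -> forall x, fmor h x = fmor g (fmor f x) }.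

Definition cfid (A : kalg k) (C : coring A) : cfunctor C C.
Proof. by exists id (fun M N f => f). Defined.

Definition cfcomp (A B A' : kalg k) (C : coring A) (D : coring B) (C' : coring A')
  (G : cfunctor D C') (F : cfunctor C D) : cfunctor C C'.
Proof.
exists (fun M => G (F M)) (fun M N f => fmor G (fmor F f)).
- by move=> M f f1; apply/fmor_id/fmor_id.
- by move=> M N P f g h hE; apply/fmor_comp/fmor_comp.
Defined.

Definition natiso (A B : kalg k) (C : coring A) (D : coring B)
    (F G : cfunctor C D) : Prop :=
  exists eta : forall M, rchom (F M) (G M),
    (forall M, rc_iso (eta M)) /\
    (forall M N (f : rchom M N) x, eta N (fmor F f x) = fmor G f (eta M x)).

Definition inverse_equivalences (A B : kalg k) (C : coring A) (D : coring B)
    (F : cfunctor C D) (G : cfunctor D C) : Prop :=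
  natiso (cfid C) (cfcomp G F) /\ natiso (cfcomp F G) (cfid D).

Section CotFunctor.
Context {A B : kalg k} {C : coring A} {D : coring B} (X : bicomod C D).
Hypothesis hD : flat_l D.

Definition cot_rcomod (E : kalg k) (M : rcomod E C) : rcomod E D :=
  ker_rcomod (flat_rstable hD (omega_rchom M X)).

Lemma cot_rhoE (E : kalg k) (M : rcomod E C) (x : cot_rcomod M) :
  tmap (kin (omega M X)) (bid D) (rho (cot_rcomod M) x) =
  tens_rho M X (kin (omega M X) x).
Proof. exact: (ker_rhoE (flat_rstable hD (omega_rchom M X))). Qed.

Fact cotmapl_rc (E : kalg k) (M M' : rcomod E C) (f : rchom M M')
    (x : cot_rcomod M) :
  rho (cot_rcomod M') (cotmapl X f x) =
  tmap (cotmapl X f) (bid D) (rho (cot_rcomod M) x).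
Proof.
apply: (flat_l_inj hD (@kin_inj _ _ _ _ _ (omega M' X))).
rewrite [LHS](@cot_rhoE _ M') [RHS]tmap_comp.
rewrite [RHS](@tmap_ext _ _ _ _ _ _ _ _ _
  (bcomp (tmap f (bid X)) (kin (omega M X))) _ (bcomp (bid D) (bid D))) //.
rewrite -[RHS]tmap_comp cot_rhoE.
have -> : kin (omega M' X) (cotmapl X f x) = tmap f (bid X) (kin (omega M X) x) by [].
move: (kin _ x) => t; tind t => m y; rewrite tmapE !tens_rhoE.
move: (rho X y) => s; by tind s => y' d; rewrite !(assocVE, tmapE).
Qed.

Definition cot_rchom (E : kalg k) (M M' : rcomod E C) (f : rchom M M') :
    rchom (cot_rcomod M) (cot_rcomod M') :=
  @Rchom _ _ _ _ (cot_rcomod M) (cot_rcomod M') (cotmapl X f) (cotmapl_rc f).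

Definition cot_functor : cfunctor C D.
Proof.
exists (@cot_rcomod _) (@cot_rchom _).
- move=> M f f1 x; apply: (@kin_inj _ _ _ _ _ (omega M X)).
  exact: (@tmap_id _ _ _ _ _ _ f (bid X) f1).
- move=> M N P f g h hE x; apply: (@kin_inj _ _ _ _ _ (omega P X)).
  change (tmap h (bid X) (kin (omega M X) x) =
    tmap g (bid X) (tmap f (bid X) (kin (omega M X) x))).
  by rewrite tmap_comp; apply: tmap_ext.
Defined.

End CotFunctor.

(* The bicomodule [X ◻_D Y]; the hypothesis holds as soon as [C] is flat as a *)
(* right module and [C'] flat as a left module ([flat_bistable]), or [D] is   *)
(* coseparable ([cosep_bistable]).                                            *)
Definition cot_bicomod (A B F : kalg k) (C : coring A) (D : coring B)
    (C' : coring F) (X : bicomod C D) (Y : bicomod D C')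
    (hS : bistable (omega_bichom X Y)) : bicomod C C' := ker_bicomod hS.

Section Triple.
Context {A B : kalg k} {C : coring A} {D : coring B}.

(* The canonical isomorphism (X ◻_D L) ◻_C Y -> X ◻_D (L ◻_C Y): the one      *)
(* compatible with the embeddings into X ⊗_B L ⊗_A Y.                         *)
Definition is_cot_assoc (X : bicomod C D) (L : bicomod D C) (Y : bicomod C D)
    (hXL : bistable (omega_bichom X L)) (hLY : bistable (omega_bichom L Y))
    (al : bihom (cotens (cot_bicomod hXL) Y) (cotens X (cot_bicomod hLY))) : Prop :=
  bijective al /\
  forall v, tmap (bid X) (kin (omega L Y)) (kin (omega X (cot_bicomod hLY)) (al v)) =
    assoc X L Y (tmap (kin (omega X L)) (bid Y) (kin (omega (cot_bicomod hXL) Y) v)).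

(* The two composites X ◻_D L ◻_C X -> X through f ◻_C X : _ -> C ◻_C X and   *)
(* X ◻_D g : _ -> X ◻_D D agree; exchanging the roles of the two bicomodules  *)
(* gives the square for L ◻_C X ◻_D L.                                        *)
Definition triple_square (X : bicomod C D) (L : bicomod D C)
    (hXL : bistable (omega_bichom X L)) (hLX : bistable (omega_bichom L X))
    (f : bichom (cot_bicomod hXL) (cor_bicomod C))
    (g : bichom (cot_bicomod hLX) (cor_bicomod D)) : Prop :=
  exists al, @is_cot_assoc X L X hXL hLX al /\
    forall v, cot_unitl X (cotmapl X f v) = cot_unitr X (cotmapr X g (al v)).

End Triple.

End Functors.

(* Main.v *)
(* Write F and G for the cotensor functors by X and L.  A right C-comodule M    *)
(* has GF(M) embedded in M ⊗ (X ⊗ L).  Naturality of a unit 1 -> GF along the   *)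
(* maps c |-> w ⊗ c : C -> W ⊗ C and along the coaction M -> M ⊗ C shows that   *)
(* it is m |-> (M ⊗ phi)(rho m) for one bicolinear phi : C -> X ⊗ L; it is      *)
(* bijective on all W ⊗ C iff W ⊗ phi is a bijection onto ker (W ⊗ omega) for   *)
(* all W, which says that phi is an isomorphism onto X ◻ L and that omega is    *)
(* pure.  The same formula gives the unit back when ker omega_{M,X} is          *)
(* preserved by - ⊗ L.  For an adjoint equivalence, the triangle identities at  *)
(* C and D are the two commuting squares.                                       *)
Require Import Defs.
From HB Require Import structures.
From mathcomp Require Import all_boot all_algebra.
From mathcomp Require Import boolp functions.

Set Implicit Arguments.
Unset Strict Implicit.
Unset Printing Implicit Defensive.

Import GRing.Theory.
Local Open Scope ring_scope.
Local Open Scope quotient_scope.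

(** The bridge between functors and bicomodules is a bicolinear map [phi : C -> X ⊗ L] satisfying
    [is_cot_inverse]: for every right module W, [W ⊗ phi] is injective with image the kernel of
    [W ⊗ omega]. Such a map is the same thing as an isomorphism of C with X ◻ L together with purity
    of [omega X L] ([cot_inverse_iso], [cot_inverse_pure], [iso_cot_inverse]).

    Given an equivalence, [adjoint_equivalence] first corrects it to an adjoint one.
    [unit_cot_inverse] extracts phi from the unit, and psi from the inverse of the counit. The
    triangle identities, evaluated at C and at D, become the relation (phi ⊗ X) lam = (X ⊗ psi) rho
    and its mirror image ([triangle_coherence]), from which [coherence_triple_square] gets the two
    squares. Flatness of X holds because an equivalence preserves injections and (W ⊗ C) ◻ X is W ⊗
    X ([equivalence_inj], [flat_l_of_cot]). Hence an equivalence implies (a).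

    Conversely, if - ⊗ L preserves the kernels of [omega M X], then (M ◻ X) ◻ L is the submodule of
    M ⊗ (X ⊗ L) cut out by two equations ([cot_embP]), and [M ⊗ phi] maps M ◻ C, which is M, onto it
    ([cot_inverse_unit]). This stability holds when L is flat or C is coseparable. Condition (b)
    implies (a) by [coflat_flat_l] and [coflat_pure]. Over regular rings all modules are flat and
    all morphisms pure ([vnr_flat_l], [vnr_pure]), and coseparability splits omega. *)

Section Bihoms.
Context {k : comPzRingType}.

Lemma inj_surj_bij (T U : Type) (f : T -> U) :
  injective f -> (forall y, exists x, f x = y) -> bijective f.
Proof.
move=> fI fS; exists (fun y => projT1 (cid (fS y))) => x.
  by apply: fI; apply: (projT2 (cid (fS (f x)))).
exact: (projT2 (cid (fS x))).
Qed.

Lemma bij_surj (T U : Type) (f : T -> U) : bijective f -> forall y, exists x, f x = y.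
Proof. by case=> g _ gK y; exists (g y). Qed.

Lemma bihom_inj (A B : kalg k) (M N : bimod A B) (f : bihom M N) :
  (forall x, f x = 0 -> x = 0) -> injective f.
Proof.
by move=> f0 x y fxy; apply/subr0_eq/f0; rewrite bfunB fxy subrr.
Qed.

Lemma bihom_factor (A B : kalg k) (K M N : bimod A B) (i : bihom K N)
    (f : bihom M N) : injective i -> (forall x, exists y, i y = f x) ->
  exists g : bihom M K, forall x, i (g x) = f x.
Proof.
move=> iI ex; pose g x := projT1 (cid (ex x)).
have gE x : i (g x) = f x by apply: (projT2 (cid (ex x))).
unshelve eexists (@Bihom _ _ _ M K g _ _ _).
- by move=> x y; apply: iI; rewrite bfunB !gE bfunB.
- by move=> a x; apply: iI; rewrite bfunL !gE bfunL.
- by move=> x b; apply: iI; rewrite bfunR !gE bfunR.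
exact: gE.
Qed.

Lemma bihom_inv (A B : kalg k) (M N : bimod A B) (f : bihom M N) :
  bijective f -> exists g : bihom N M, cancel f g /\ cancel g f.
Proof.
case=> f' fK f'K.
have [|y|g gE] := @bihom_factor _ _ M N N f (bid N); first exact: can_inj fK.
  by exists (f' y); apply: f'K.
by exists g; split=> // x; apply: (can_inj fK); apply: gE.
Qed.

(* On a [bimod (kself k) B] the left action is determined by the right one. *)
Definition bihomR (B : kalg k) (M N : bimod (kself k) B) (f : M -> N)
  (fB : zmod_morphism f) (fR : forall x b, f (ract x b) = ract (f x) b) :
  bihom M N.
Proof.
exists f => // c x.
have -> : lact c x = ract x (kmap B c) by rewrite -[RHS]bkact.
by rewrite fR -[LHS]bkact.
Defined.

Lemma tmap_swap (A B F : kalg k) (M M' : bimod A B) (N N' : bimod B F)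
  (f : bihom M M') (g : bihom N N') t :
  tmap f (bid N') (tmap (bid M) g t) = tmap (bid M') g (tmap f (bid N) t).
Proof. by rewrite !tmap_comp; apply: tmap_ext. Qed.

Lemma tmap_bij (A B F : kalg k) (M M' : bimod A B) (N N' : bimod B F)
  (f : bihom M M') (g : bihom N N') :
  bijective f -> bijective g -> bijective (tmap f g).
Proof.
move=> /bihom_inv[f' [fK f'K]] /bihom_inv[g' [gK g'K]].
by exists (tmap f' g') => t; rewrite tmap_comp tmap_id.
Qed.

Lemma bid_bij (A B : kalg k) (M : bimod A B) : bijective (bid M).
Proof. by exists id. Qed.

Lemma assoc_bij (A B F E : kalg k) (M : bimod A B) (N : bimod B F) (P : bimod F E) :
  bijective (assoc M N P).
Proof. exists (assocV M N P); [exact: assocK|exact: assocVK]. Qed.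

End Bihoms.

(** * Morphisms of comodules *)

Section Comodules.
Context {k : comPzRingType}.
Implicit Types E A B : kalg k.

Definition rccomp E A (C : coring A) (M N P : rcomod E C)
  (g : rchom N P) (f : rchom M N) : rchom M P.
Proof.
exists (bcomp g f) => x.
by rewrite bcompE !rchE tmap_comp; apply: tmap_ext.
Defined.

Definition rcid E A (C : coring A) (M : rcomod E C) : rchom M M.
Proof. by exists (bid M) => x; rewrite tmap_id. Defined.

Definition rczero E A (C : coring A) (M N : rcomod E C) : rchom M N.
Proof. by exists (bzero M N) => x; rewrite bfun0 tmap_zerol. Defined.

Lemma rc_iso_bij E A (C : coring A) (M N : rcomod E C) (f : rchom M N) :
  bijective f -> rc_iso f.
Proof.
move=> /bihom_inv[g [fK gK]].
have gE x : rho M (g x) = tmap g (bid C) (rho N x).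
  by rewrite -{2}[x]gK rchE tmap_comp tmap_id.
by exists (Rchom gE).
Qed.

Lemma bic_iso_bij A B (C : coring A) (D : coring B) (X Y : bicomod C D)
  (f : bichom X Y) : bijective (bich f) -> bic_iso f.
Proof.
move=> /bihom_inv[g [fK gK]].
have gL x : blam X (g x) = tmap (bid C) g (blam Y x).
  by rewrite -{2}[x]gK bichL tmap_comp tmap_id.
have gR x : brho X (g x) = tmap g (bid D) (brho Y x).
  by rewrite -{2}[x]gK bichR tmap_comp tmap_id.
by exists (Bichom gL gR).
Qed.

End Comodules.

(** * Equivalences of comodule categories *)

Section Equivalences.
Context {k : comPzRingType} {A B : kalg k} {C : coring A} {D : coring B}.

Definition isnat (F G : cfunctor C D) (eta : forall M, rchom (F M) (G M)) : Prop :=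
  forall M N (f : rchom M N) x, eta N (fmor F f x) = fmor G f (eta M x).

Lemma natiso_sym (F G : cfunctor C D) : natiso F G -> natiso G F.
Proof.
case=> eta [etaI etaN].
pose ze M := projT1 (cid (etaI M)).
have etaK M : cancel (eta M) (ze M) by case: (projT2 (cid (etaI M))).
have zeK M : cancel (ze M) (eta M) by case: (projT2 (cid (etaI M))).
exists ze; split=> [M|M N f x]; first by exists (eta M).
by apply: (can_inj (etaK N)); rewrite zeK etaN zeK.
Qed.

Lemma natiso_of_bij (F G : cfunctor C D) (eta : forall M, rchom (F M) (G M)) :
  (forall M, bijective (eta M)) -> isnat eta -> natiso F G.
Proof. by move=> etaB etaN; exists eta; split=> // M; apply: rc_iso_bij. Qed.

(** [fmor_comp] accepts any morphism that is pointwise the composite, so f can be taken as g after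
    the identity. *)
Lemma fmor_ext (F : cfunctor C D) M N (f g : rchom M N) :
  f =1 g -> fmor F f =1 fmor F g.
Proof.
move=> fg x; rewrite (@fmor_comp _ _ _ _ _ F _ _ _ (rcid M) g f) //.
by rewrite (@fmor_id _ _ _ _ _ F).
Qed.

Lemma fmor_sq (F : cfunctor C D) M N N' P (f : rchom M N) (g : rchom N P)
    (f' : rchom M N') (g' : rchom N' P) : (forall x, g (f x) = g' (f' x)) ->
  forall x, fmor F g (fmor F f x) = fmor F g' (fmor F f' x).
Proof.
move=> fg x; rewrite -(@fmor_comp _ _ _ _ _ F _ _ _ f g (rccomp g f)) //.
exact: fmor_comp.
Qed.

Lemma fmor_bij (F : cfunctor C D) M N (f : rchom M N) :
  bijective f -> bijective (fmor F f).
Proof.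
move=> /rc_iso_bij[g [fK gK]]; exists (fmor F g) => x.
  rewrite -(@fmor_comp _ _ _ _ _ F _ _ _ f g (rcid M)) => [|y].
    exact: (@fmor_id _ _ _ _ _ F).
  by rewrite fK.
rewrite -(@fmor_comp _ _ _ _ _ F _ _ _ g f (rcid N)) => [|y].
  exact: (@fmor_id _ _ _ _ _ F).
by rewrite gK.
Qed.

End Equivalences.

Section Adjoint.
Context {k : comPzRingType} {A B : kalg k} {C : coring A} {D : coring B}.
Variables (F : cfunctor C D) (G : cfunctor D C).

(** Since D is flat, the kernel of [F f] is a comodule, so G applies to its inclusion i. Naturality
    of the unit and injectivity of f make G kill i, and the counit carries this back to i = 0. *)
Lemma equivalence_inj : flat_l D -> inverse_equivalences F G ->
  forall (M N : rcomod (kself k) C) (f : rchom M N),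
  injective f -> injective (fmor F f).
Proof.
move=> hD [[eta [etaI etaN]] [ze [zeI zeN]]] M N f fI.
pose hS := flat_rstable hD (fmor F f); pose K := ker_rcomod hS.
have iE (x : K) : rho (F M) (kin (fmor F f) x) =
  tmap (kin (fmor F f)) (bid D) (rho K x) by rewrite (@ker_rhoE _ _ _ _ _ _ (fmor F f)).
pose i : rchom K (F M) := Rchom iE.
(* Functors are not assumed additive, so [G i] is compared with the image of the zero morphism
   rather than with zero. *)
have Gi : fmor G i =1 fmor G (rczero K (F M)).
  move=> x; have [eta' [etaK eta'K]] := etaI M.
  rewrite -[LHS]eta'K -[RHS]eta'K; congr (eta M _); apply: fI.
  have [eta'' [eta''K _]] := etaI N; apply: (can_inj eta''K).
  rewrite [LHS]etaN [RHS]etaN !eta'K /=.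
  rewrite -(@fmor_comp _ _ _ _ _ G _ _ _ i (fmor F f) (rczero K (F N))); last first.
    by move=> y; rewrite [RHS]kinE.
  rewrite -(@fmor_comp _ _ _ _ _ G _ _ _ (rczero K (F M)) (fmor F f) (rczero K (F N))) //.
  by move=> y; rewrite [RHS]bfun0.
apply: bihom_inj => x fx0.
have := zeN _ _ i; have := zeN _ _ (rczero K (F M)) => h0 h1.
have [ze' [_ ze'K]] := zeI K.
have := h1 (ze' (kmk fx0)); rewrite /= (fmor_ext Gi) h0 /=.
by rewrite ze'K.
Qed.

(** The two given isomorphisms may fail the triangle identities; the second one is replaced by the
    usual correction. Both transformations leave the identity functor, so [eta'] is the inverse of a
    counit and the triangle identities read F eta = eta' F and G eta' = eta G. *)
Lemma adjoint_equivalence : inverse_equivalences F G ->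
  exists (eta : forall M, rchom M (G (F M))) (eta' : forall N, rchom N (F (G N))),
  [/\ (forall M, bijective (eta M)) /\ @isnat _ _ _ _ _ (cfid C) (cfcomp G F) eta,
      (forall N, bijective (eta' N)) /\ @isnat _ _ _ _ _ (cfid D) (cfcomp F G) eta',
      forall M x, fmor F (eta M) x = eta' (F M) x &
      forall N y, fmor G (eta' N) y = eta (G N) y].
Proof.
case=> [[eta [etaI etaN]] /natiso_sym[th [thI thN]]].
have rcB (E A' : kalg k) (C' : coring A') (M N : rcomod E C') (f : rchom M N) :
  rc_iso f -> bijective f by case=> g [fK gK]; exists g.
have etaB M : bijective (eta M) by apply: rcB.
have thB M : bijective (th M) by apply: rcB.
pose ze N := projT1 (cid (thI N)).
have thK N : cancel (th N) (ze N) by case: (projT2 (cid (thI N))).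
have zeK N : cancel (ze N) (th N) by case: (projT2 (cid (thI N))).
have zeB N : bijective (ze N) by exists (th N).
pose eta' N : rchom N (F (G N)) :=
  rccomp (fmor F (fmor G (ze N))) (rccomp (fmor F (eta (G N))) (th N)).
have eta'E N x : eta' N x = fmor F (fmor G (ze N)) (fmor F (eta (G N)) (th N x)) by [].
have eta'B N : bijective (eta' N).
  have b1 : bijective (fmor F (eta (G N))) by apply: fmor_bij.
  have b2 : bijective (fmor F (fmor G (ze N))) by do 2 apply: fmor_bij.
  exact: (bij_comp b2 (bij_comp b1 (thB N))).
have eta'N : @isnat _ _ _ _ _ (cfid D) (cfcomp F G) eta'.
  move=> M N f x; change (eta' N (f x) = fmor F (fmor G f) (eta' M x)).
  rewrite !eta'E [th N _](thN M N f) [fmor (cfcomp F G) f _]/=.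
  rewrite (fmor_sq (f' := eta (G M)) (g' := fmor G (fmor F (fmor G f)))).
    apply: fmor_sq => z; apply: fmor_sq => {}z.
    by apply: (can_inj (thK N)); rewrite zeK [RHS]thN zeK.
  by move=> z; rewrite [LHS](etaN _ _ (fmor G f)).
have t1 M x : fmor F (eta M) x = eta' (F M) x.
  (* Naturality of eta along its own component [eta M], which can be cancelled because it is
     surjective. *)
  have e1 : eta (G (F M)) =1 fmor G (fmor F (eta M)).
    by move=> y; have [g _ gK] := etaB M; rewrite -[y]gK -[RHS]etaN.
  rewrite eta'E (fmor_ext e1) -[X in fmor F (fmor G _) X](thN _ _ (fmor F (eta M))) /=.
  have e2 (N : rcomod (kself k) D) (u : F (G N)) : th (F (G N)) u = fmor F (fmor G (th N)) u.
    by have [g _ gK] := thB N; rewrite -[u]gK -[RHS]thN.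
  rewrite e2 (fmor_sq (f' := rcid _) (g' := rcid _)) => [|y].
    by rewrite !(@fmor_id _ _ _ _ _ F).
  rewrite (fmor_sq (f' := rcid _) (g' := rcid _)) => [|z].
    by rewrite !(@fmor_id _ _ _ _ _ G).
  by rewrite thK.
exists eta, eta'; split=> // N y.
(* Faithfulness of F reduces the second identity to its image under F, which is the first identity
   at [G N] combined with naturality of [eta'] along itself. *)
have Finj (M M' : rcomod (kself k) D) (f g : rchom (G M) (G M')) :
    fmor F f =1 fmor F g -> f =1 g.
  move=> fg x; apply: (bij_inj (etaB (G M'))).
  rewrite [LHS](etaN _ _ f) [RHS](etaN _ _ g) /=.
  exact: (fmor_ext fg).
apply: (Finj N (F (G N)) (fmor G (eta' N)) (eta (G N))) => z.
rewrite t1; have [g _ gK] := eta'B N; rewrite -[z]gK.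
by rewrite [RHS](eta'N _ _ (eta' N)).
Qed.

End Adjoint.

(** * Exactness of the tensor product *)

Section Cokernel.
Context {k : comPzRingType} {A B : kalg k} {M N : bimod A B} (f : bihom M N).

Definition imp : {pred N} := [pred y | `[< exists x, f x = y >]].

Fact imp_zmod_closed : zmod_closed imp.
Proof.
split=> [|x y]; rewrite !inE; first by apply/asboolP; exists 0; apply: bfun0.
by move=> /asboolP[x' <-] /asboolP[y' <-]; apply/asboolP; exists (x' - y'); rewrite bfunB.
Qed.
HB.instance Definition _ := GRing.isZmodClosed.Build N imp imp_zmod_closed.

Definition cokT : zmodType := Quotient.quot imp.

Definition cokpi (x : N) : cokT := \pi_(Quotient.quot imp) x.

Fact cokpiB : zmod_morphism cokpi.
Proof. by move=> x y; rewrite /cokpi !piE. Qed.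

Fact cokpiD x y : cokpi (x + y) = cokpi x + cokpi y.
Proof. by rewrite /cokpi !piE. Qed.

Fact cokpi_surj z : exists x, cokpi x = z.
Proof. by exists (repr z); rewrite /cokpi reprK. Qed.

Lemma cokpiP x y : cokpi x = cokpi y <-> exists z, f z = x - y.
Proof.
rewrite /cokpi; split=> [/eqP|[z fz]].
  by rewrite -Quotient.idealrBE inE => /asboolP.
by apply/eqP; rewrite -Quotient.idealrBE inE; apply/asboolP; exists z.
Qed.

Definition cokl a (z : cokT) : cokT := cokpi (lact a (repr z : N)).
Definition cokr (z : cokT) b : cokT := cokpi (ract (repr z : N) b).

Fact coklE a x : cokl a (cokpi x) = cokpi (lact a x).
Proof.
apply/cokpiP; have [|z fz] := (cokpiP (repr (cokpi x)) x).1; first by rewrite /cokpi reprK.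
by exists (lact a z); rewrite bfunL fz lactDr lactNr.
Qed.
Fact cokrE x b : cokr (cokpi x) b = cokpi (ract x b).
Proof.
apply/cokpiP; have [|z fz] := (cokpiP (repr (cokpi x)) x).1; first by rewrite /cokpi reprK.
by exists (ract z b); rewrite bfunR fz ractDl ractNl.
Qed.

Definition coker : bimod A B.
Proof.
exists cokT cokl cokr.
- move=> a x y; have [x' <-] := cokpi_surj x; have [y' <-] := cokpi_surj y.
  by rewrite -cokpiD !coklE lactDr cokpiD.
- by move=> a b x; have [x' <-] := cokpi_surj x; rewrite !coklE lactDl cokpiD.
- by move=> a b x; have [x' <-] := cokpi_surj x; rewrite !coklE lactM.
- by move=> x; have [x' <-] := cokpi_surj x; rewrite !coklE lact1.
- move=> x y b; have [x' <-] := cokpi_surj x; have [y' <-] := cokpi_surj y.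
  by rewrite -cokpiD !cokrE ractDl cokpiD.
- by move=> x a b; have [x' <-] := cokpi_surj x; rewrite !cokrE ractDr cokpiD.
- by move=> x a b; have [x' <-] := cokpi_surj x; rewrite !cokrE ractM.
- by move=> x; have [x' <-] := cokpi_surj x; rewrite !cokrE ract1.
- by move=> a x b; have [x' <-] := cokpi_surj x; rewrite !(cokrE, coklE) lractA.
- by move=> c x; have [x' <-] := cokpi_surj x; rewrite !(cokrE, coklE) bkact.
Defined.

Definition cokp : bihom N coker.
Proof.
exists (cokpi : N -> coker); first exact: cokpiB.
- by move=> a x; rewrite -coklE.
- by move=> x b; rewrite -cokrE.
Defined.

Lemma cokp_surj z : exists x, cokp x = z. Proof. exact: cokpi_surj. Qed.

Lemma cokp_exact : exact f cokp.
Proof.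
move=> y; have h : cokp 0 = 0 := bfun0 cokp; split=> [y0|[x <-]].
  have [|x fx] := (cokpiP y 0).1; first by rewrite -[LHS]/(cokp y) y0.
  by exists x; rewrite fx subr0.
by rewrite -h; apply/cokpiP; exists x; rewrite subr0.
Qed.

End Cokernel.

Section RightExact.
Context {k : comPzRingType}.

(* A section of [g] turns a derivation of [teq] in [I ⊗ V] into a relation    *)
(* modulo the image of [f ⊗ V] in [N ⊗ V].                                    *)
Lemma tens_right_exact (E A F : kalg k) (V : bimod A F) (M N I : bimod E A)
    (f : bihom M N) (g : bihom N I) :
  exact f g -> (forall z, exists y, g y = z) ->
  forall t, tmap g (bid V) t = 0 -> exists s, tmap f (bid V) s = t.
Proof.
move=> fg gS t; pose sg z := projT1 (cid (gS z)).
have sgE z : g (sg z) = z by apply: (projT2 (cid (gS z))).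
have sgK z y : g y = g z -> exists x, f x = y - z.
  by move=> yz; apply/fg; rewrite bfunB yz subrr.
pose im (u : N ⊗b V) := exists s, tmap f (bid V) s = u.
have im0 : im 0 by exists 0; apply: bfun0.
have imD u v : im u -> im v -> im (u + v).
  by move=> [x <-] [y <-]; exists (x + y); rewrite bfunD.
have imN u : im u -> im (- u).
  by move=> [x <-]; exists (- x); rewrite raddfN.
have im1 x v : im (f x ⊗ v) by exists (x ⊗ v); rewrite tmapE.
have imS y z v : g y = g z -> im (y ⊗ v - z ⊗ v).
  move=> /sgK[x fx]; suff -> : y ⊗ v - z ⊗ v = f x ⊗ v by apply: im1.
  by apply/eqP; rewrite subr_eq -bpureDl fx subrK.
pose S (s : seq (I * V)) : N ⊗b V := \sum_(u <- s) (sg u.1 ⊗ u.2).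
have SE s s' : @teq A I V (@ract _ _ _ I) (@lact _ _ _ V) s s' -> im (S s - S s').
  elim=> {s s'}.
  - by move=> s; rewrite subrr.
  - by move=> s s' _ h; rewrite -opprB; apply: imN.
  - by move=> s s' s'' _ h1 _ h2; rewrite -[S s](subrK (S s')) -addrA; apply: imD.
  - move=> s s' u u' _ h1 _ h2; rewrite /S !big_cat /= opprD addrACA.
    exact: imD.
  - by move=> s s'; rewrite /S !big_cat /= addrC subrr.
  - move=> v; rewrite /S big_seq1 big_nil.
    by have := imS (sg 0) 0 v; rewrite bpure0l; apply; rewrite sgE bfun0.
  - move=> m m' v; rewrite /S big_cons big_cons big_seq1 big_nil addr0 -bpureDl.
    by apply: imS; rewrite sgE bfunD !sgE.
  - by move=> m v v'; rewrite /S big_cons big_cons big_seq1 big_nil addr0 -bpureDr subrr.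
  - move=> m a v; rewrite /S !big_seq1 /= -bpureM.
    by apply: imS; rewrite sgE bfunR sgE.
have [s ->] : exists s : seq (N * V), t = \sum_(u <- s) u.1 ⊗ u.2.
  move: t; apply: bpure_ind => [|x y [s1 ->] [s2 ->]|m v].
  - by exists [::]; rewrite big_nil.
  - by exists (s1 ++ s2); rewrite big_cat.
  - by exists [:: (m, v)]; rewrite big_seq1.
have piE (s' : seq (I * V)) : \pi_(tens (@ract _ _ _ I) (@lact _ _ _ V)) s' =
    \sum_(u <- s') (u.1 ⊗ u.2 : I ⊗b V).
  elim: s' => [|u s' IHs]; first by rewrite big_nil.
  by rewrite big_cons -IHs -[RHS]/(tadd _ _) pi_cat; case: u.
rewrite raddf_sum => t0.
have /SE : @teq A I V (@ract _ _ _ I) (@lact _ _ _ V) [seq (g u.1, u.2) | u <- s] [::].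
  apply/teqP; rewrite piE big_map /=; etransitivity; last exact: t0.
  apply: eq_bigr => u _. by rewrite -(tmapE g (bid V)).
rewrite /S big_nil subr0 big_map /= => h.
have h' : im (\sum_(u <- s) (u.1 ⊗ u.2 - sg (g u.1) ⊗ u.2)).
  elim: s {t0 h} => [|u s IHs]; first by rewrite big_nil.
  by rewrite big_cons; apply: imD => //; apply: imS; rewrite sgE.
by have := imD _ _ h' h; rewrite -big_split /=; under eq_bigr do rewrite subrK.
Qed.

Lemma tens_surj (E A F : kalg k) (V : bimod A F) (M N : bimod E A) (f : bihom M N) :
  (forall z, exists y, f y = z) -> forall t, exists s, tmap f (bid V) s = t.
Proof.
move=> fS; apply: bpure_ind => [|x y [x' <-] [y' <-]|m v].
- by exists 0; apply: bfun0.
- by exists (x' + y'); rewrite bfunD.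
by have [m' <-] := fS m; exists (m' ⊗ v); rewrite tmapE.
Qed.

Lemma tens_exact0 (E A F : kalg k) (V : bimod A F) (M N I : bimod E A)
    (f : bihom M N) (g : bihom N I) :
  exact f g -> forall s, tmap g (bid V) (tmap f (bid V) s) = 0.
Proof.
move=> fg s; rewrite tmap_comp -[RHS](@tmap_zerol _ _ _ _ M I V V (bid V) s).
by apply: tmap_ext => // x; apply/fg; exists x.
Qed.

(** Factor g through its image, realized as the kernel of its cokernel: right exactness treats the
    surjection, the hypothesis treats the inclusion. *)
Lemma flat_l_of_inj (A F : kalg k) (V : bimod A F) :
  (forall (M N : bimod (kself k) A) (f : bihom M N),
     injective f -> injective (tmap f (bid V))) -> flat_l V.
Proof.
move=> VI M N P f g fg t; split=> [t0|[s <-]]; last exact: tens_exact0.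
have cg y : cokp g (g y) = 0 by apply/cokp_exact; exists y.
pose g' : bihom N (kerb (cokp g)) := klift cg.
have gE y : g y = kin _ (g' y) by [].
apply: (tens_right_exact (g := g')) => [y|z|].
- rewrite -fg gE; split=> [->|h]; first exact: bfun0.
  by apply: kin_inj; rewrite bfun0.
- have [y gy] := (cokp_exact g (kin _ z)).1 (kinE z); exists y.
  exact: kin_inj.
apply: (VI _ _ _ (@kin_inj _ _ _ _ _ (cokp g))); rewrite bfun0 -[RHS]t0 tmap_comp.
exact: tmap_ext.
Qed.

End RightExact.

(** * Free modules on a set *)

Lemma big_seq_supp (S : eqType) (V : zmodType) (F : S -> V) (l l' : seq S) :
  uniq l -> uniq l' -> (forall x, x \notin l -> F x = 0) ->
  (forall x, x \notin l' -> F x = 0) -> \sum_(x <- l) F x = \sum_(x <- l') F x.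
Proof.
have E (s s' : seq S) : (forall x, x \notin s' -> F x = 0) ->
    \sum_(x <- s) F x = \sum_(x <- [seq x <- s | x \in s']) F x.
  move=> F0; rewrite big_filter [RHS]big_mkcond /=; apply: eq_bigr => x _.
  by case: ifPn => // /F0.
move=> ul ul' F0 F0'; rewrite (E l l') // (E l' l) //; apply: perm_big.
apply: uniq_perm; rewrite ?filter_uniq // => x.
by rewrite !mem_filter andbC.
Qed.

Lemma ract0r (k : comPzRingType) (A B : kalg k) (M : bimod A B) (x : M) :
  ract x (0 : B) = 0.
Proof. by apply: (addIr (ract x 0)); rewrite -ractDr !add0r. Qed.

Section Coordinate.
Context {k : comPzRingType} {A F : kalg k}.
Implicit Types (J : bimod (kself k) A) (V : bimod A F).

Section Def.
Variables (J : bimod (kself k) A) (p : bihom J (rforget (breg A))) (V : bimod A F).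

Let b (j : J) (v : V) : rforget V := lact (p j : A) v.

Fact coord_bal : balanced (@ract _ _ _ J) (@lact _ _ _ V) b.
Proof.
split=> [j j' v|j v v'|j a v]; rewrite /b; first rewrite bfunD.
  exact: (@lactDl _ _ _ V (p j : A) (p j' : A) v).
  exact: (@lactDr _ _ _ V).
by rewrite bfunR; apply: (@lactM _ _ _ V (p j : A) a v).
Qed.
Fact coordL c j v : b (lact c j) v = lact c (b j v).
Proof.
rewrite /b bfunL; transitivity (lact (p j : A) (lact (kmap A c) v)).
  exact: (@lactM _ _ _ V (p j : A) (kmap A c) v).
by rewrite bkact -lractA.
Qed.
Fact coordR j v c : b j (ract v c) = ract (b j v) c.
Proof. by rewrite /b /= lractA. Qed.

(** Contraction of the first factor by a functional p. For the coordinate functionals of a free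
    module it yields the components of a tensor. The left action on V is forgotten because J is only
    a right module. *)
Definition coord : bihom (J ⊗b V) (rforget V) := blift coord_bal coordL coordR.

Lemma coordE j v : coord (j ⊗ v) = lact (p j : A) v.
Proof. exact: bliftE. Qed.
End Def.

Lemma coord_natl J J' (p : bihom J' (rforget (breg A))) (h : bihom J J') V t :
  coord p V (tmap h (bid V) t) = coord (bcomp p h) V t.
Proof. by tind t => j v; rewrite tmapE !coordE. Qed.

Lemma coord_natr J (p : bihom J (rforget (breg A))) V V' (h : bihom V V') t :
  coord p V' (tmap (bid J) h t) = h (coord p V t).
Proof.
move: t; apply: bpure_ind => [|x y hx hy|j v].
- by rewrite !bfun0.
- by rewrite !bfunD hx hy.
by rewrite tmapE !coordE bfunL.
Qed.

End Coordinate.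

Section Free.
Context {k : comPzRingType} {A : kalg k} (S : eqType).

Definition fsp : {pred S -> A} :=
  [pred f | `[< exists l : seq S, forall x, x \notin l -> f x = 0 >]].

Fact fsp_zmod_closed : zmod_closed fsp.
Proof.
split=> [|f g]; rewrite !inE; first by apply/asboolP; exists [::].
move=> /asboolP[l hl] /asboolP[l' hl']; apply/asboolP; exists (l ++ l') => x.
by rewrite mem_cat negb_or => /andP[xl xl']; rewrite -[LHS]/(f x - g x) hl ?hl' ?subr0.
Qed.
HB.instance Definition _ := GRing.isZmodClosed.Build (S -> A) fsp fsp_zmod_closed.

Record fsT := FsT { fsval : S -> A; fsvalP : fsval \in fsp }.
HB.instance Definition _ := [isSub for fsval].
HB.instance Definition _ := [Choice of fsT by <:].
HB.instance Definition _ := [SubChoice_isSubZmodule of fsT by <:].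

Fact fs_mul (f : fsT) a : (fun x => fsval f x * a) \in fsp.
Proof.
have := fsvalP f; rewrite !inE => /asboolP[l hl]; apply/asboolP; exists l => x xl.
by rewrite hl // mul0r.
Qed.
Definition fsmul f a : fsT := FsT (fs_mul f a).

Fact fs_ext (f g : fsT) : (forall x, fsval f x = fsval g x) -> f = g.
Proof. by move=> fg; apply: val_inj; apply: funext. Qed.

Definition free : bimod (kself k) A.
Proof.
exists fsT (fun c f => fsmul f (kmap A c)) fsmul.
- by move=> c f g; apply: fs_ext => x; apply: (mulrDl (fsval f x) (fsval g x)).
- by move=> c d f; apply: fs_ext => x; rewrite /= rmorphD mulrDr.
- by move=> c d f; apply: fs_ext => x; rewrite /= mulrC rmorphM mulrA.
- by move=> f; apply: fs_ext => x; rewrite /= rmorph1 mulr1.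
- by move=> f g c; apply: fs_ext => x; apply: (mulrDl (fsval f x) (fsval g x)).
- by move=> f c d; apply: fs_ext => x; rewrite /= mulrDr.
- by move=> f c d; apply: fs_ext => x; rewrite /= mulrA.
- by move=> f; apply: fs_ext => x; rewrite /= mulr1.
- by move=> c f a; apply: fs_ext => x; rewrite /= -!mulrA kmapC.
- by [].
Defined.

Definition fpi (x : S) : bihom free (rforget (breg A)).
Proof. by apply: (@bihomR _ _ free (rforget (breg A)) (fun f : fsT => fsval f x)). Defined.

Fact fone_subproof (x : S) : (fun y => if y == x then 1 else 0) \in fsp.
Proof.
rewrite inE; apply/asboolP; exists [:: x] => y; rewrite inE.
by move=> /negPf ->.
Qed.
Definition fone x : free := FsT (fone_subproof x).

Lemma foneE x y : fpi x (fone y) = (if x == y then 1 else 0) :> A.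
Proof. by []. Qed.

Lemma free_ext (p q : free) : (forall x, fpi x p = fpi x q) -> p = q.
Proof. exact: fs_ext. Qed.

Lemma fsupp_ex (p : free) : exists l, uniq l && `[< forall x, x \notin l -> fpi x p = 0 >].
Proof.
have := fsvalP p; rewrite inE => /asboolP[l hl]; exists (undup l).
by rewrite undup_uniq; apply/asboolP => x; rewrite mem_undup; apply: hl.
Qed.
Definition fsupp p := projT1 (cid (fsupp_ex p)).
Lemma fsupp_uniq p : uniq (fsupp p).
Proof. by have /andP[] := projT2 (cid (fsupp_ex p)). Qed.
Lemma fsuppP p x : x \notin fsupp p -> fpi x p = 0.
Proof. by move: x; have /andP[_ /asboolP] := projT2 (cid (fsupp_ex p)). Qed.

Lemma free_sum (l : seq S) (p : free) : uniq l -> (forall x, x \notin l -> fpi x p = 0) ->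
  p = \sum_(x <- l) ract (fone x) (fpi x p).
Proof.
move=> ul hl; apply: free_ext => y; rewrite raddf_sum /=.
have E : \sum_(x <- l) ((fpi y (ract (fone x) (fpi x p : A)) : rforget (breg A)) : A) = fpi y p.
  under eq_bigr do rewrite bfunR foneE [ract _ _]/=.
  have [yl|yl] := boolP (y \in l); last first.
    rewrite hl // big_seq big1 // => x xl; case: eqP => [yx|_]; last by rewrite mul0r.
    by rewrite yx xl in yl.
  rewrite (bigD1_seq y) //= eqxx mul1r big1 ?addr0 // => x xy.
  by rewrite eq_sym (negPf xy) mul0r.
by rewrite -[LHS]E.
Qed.

Section Decomposition.
Context {F : kalg k} (V : bimod A F).

Lemma free_decomp (t : free ⊗b V) :
  exists l, t = \sum_(x <- l) fone x ⊗ (coord (fpi x) V t : V).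
Proof.
(* Allowing every larger list makes the statement additive: two tensors are expanded over a common
   list. *)
suff [l hl] : exists l : seq S, forall l' : seq S, uniq l' -> {subset l <= l'} ->
    t = \sum_(x <- l') fone x ⊗ (coord (fpi x) V t : V).
  by exists (undup l); apply: hl => [|x]; rewrite ?undup_uniq ?mem_undup.
move: t; apply: bpure_ind => [|t u [l hl] [l' hl']|p v].
- by exists [::] => l _ _; rewrite big1 // => x _; rewrite bfun0 bpure0r.
- exists (l ++ l') => l'' ul sl.
  rewrite [in LHS](hl l'') // => [|x xl]; last by apply: sl; rewrite mem_cat xl.
  rewrite [in X in _ + X](hl' l'') // => [|x xl]; last by apply: sl; rewrite mem_cat xl orbT.
  by rewrite -big_split; apply: eq_bigr => x _; rewrite bfunD bpureDr.
exists (fsupp p) => l ul sl.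
have {1}-> : p = \sum_(x <- l) ract (fone x) (fpi x p).
  by apply: free_sum => // x xl; apply: fsuppP; apply: contra xl => /sl.
transitivity (\sum_(x <- l) ract (fone x) (fpi x p) ⊗ v).
  by elim: l {ul sl} => [|x l IHl]; rewrite ?big_nil ?bpure0l // !big_cons bpureDl IHl.
by apply: eq_bigr => x _; rewrite coordE bpureM.
Qed.

Lemma free_coord_eq0 (t : free ⊗b V) : (forall x, coord (fpi x) V t = 0) -> t = 0.
Proof.
move=> t0; have [l ->] := free_decomp t.
by rewrite big1 // => x _; rewrite t0 bpure0r.
Qed.

Lemma free_lift (V' : bimod A F) (h : bihom V' V) (t : free ⊗b V) :
  (forall x, exists y, h y = coord (fpi x) V t) -> exists s, tmap (bid free) h s = t.
Proof.
move=> ht; have [l ->] := free_decomp t.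
elim: l => [|x l [s IHs]]; first by exists 0; rewrite big_nil bfun0.
have [y hy] := ht x; exists (fone x ⊗ y + s).
by rewrite big_cons bfunD tmapE IHs hy.
Qed.
End Decomposition.

Section Out.
Context {W : bimod (kself k) A} (w : S -> W).

Let out (p : free) : W := \sum_(x <- fsupp p) ract (w x) (fpi x p).

Let outE (l : seq S) (p : free) : uniq l -> (forall x, x \notin l -> fpi x p = 0) ->
  out p = \sum_(x <- l) ract (w x) (fpi x p).
Proof.
move=> ul hl; rewrite /out; apply: big_seq_supp (fsupp_uniq p) ul _ _ => x xl.
  by rewrite fsuppP //; apply: ract0r.
by rewrite hl //; apply: ract0r.
Qed.

Definition free_out : bihom free W.
Proof.
apply: (@bihomR _ _ free W out).
  apply: zmorphD => p q; pose l := undup (fsupp p ++ fsupp q).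
  have ul : uniq l by apply: undup_uniq.
  have hp x : x \notin l -> fpi x p = 0.
    by rewrite mem_undup mem_cat negb_or => /andP[/fsuppP].
  have hq x : x \notin l -> fpi x q = 0.
    by rewrite mem_undup mem_cat negb_or => /andP[_ /fsuppP].
  rewrite (outE ul hp) (outE ul hq) (outE ul) => [|x xl]; last first.
    by rewrite bfunD hp // hq // addr0.
  by rewrite -big_split /=; apply: eq_bigr => x _; rewrite -ractDr.
move=> p a; rewrite (outE (fsupp_uniq p)) => [|x xl]; last first.
  by rewrite bfunR fsuppP //= mul0r.
rewrite /out; elim: (fsupp p) => [|x l IHl]; first by rewrite !big_nil ract0l.
by rewrite !big_cons ractDl IHl -ractM.
Defined.

Lemma free_outE x : free_out (fone x) = w x.
Proof.
rewrite [LHS](@outE [:: x]) // => [|y]; last first.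
  by rewrite inE foneE => /negPf ->.
by rewrite big_seq1 foneE eqxx ract1.
Qed.
End Out.

End Free.

(** * Modules over von Neumann regular rings *)

Section VonNeumannRegular.
Context {k : comPzRingType} {A : kalg k}.
Hypothesis hA : von_neumann_regular A.

(** In a regular ring a finitely generated right ideal has an idempotent generator; this is the
    version for the ideal generated by the values of p on s, lifted to J. The clause on q records
    what is used of j0 being a right combination of s. *)
Lemma vnr_gen (J : bimod (kself k) A) (p : bihom J (rforget (breg A))) (s : seq J) :
  exists j0 : J, (forall u, u \in s -> (p j0 : A) * (p u : A) = p u) /\
  forall q : bihom J (rforget (breg A)), (forall u, u \in s -> q u = 0) -> q j0 = 0.
Proof.
elim: s => [|v s [j0 [pj0 qj0]]]; first by exists 0; split=> // q _; apply: bfun0.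
(* d is the part of v that j0 does not yet fix and x a quasi-inverse of [p d]. The factor 1 - p j0
   in the new element leaves the earlier generators fixed. *)
pose d := v - ract j0 (p v : A); have [x dx] := hA (p d).
have pd : (p d : A) = (p v : A) - (p j0 : A) * (p v : A).
  by rewrite bfunB bfunR.
exists (j0 + ract d (x * (1 - (p j0 : A)))); split=> [u us|q q0]; last first.
  have qj : q j0 = 0 by apply: qj0 => u us; rewrite q0 // inE us orbT.
  have qd : q d = 0 by rewrite bfunB bfunR q0 ?mem_head // qj ract0l subr0.
  by rewrite bfunD bfunR qj qd ract0l addr0.
have -> : (p (j0 + ract d (x * (1 - (p j0 : A)))) : A) =
    (p j0 : A) + (p d : A) * (x * (1 - (p j0 : A))).
  by rewrite bfunD bfunR.
rewrite mulrDl -!mulrA mulrBl mul1r; move: us; rewrite inE => /orP[/eqP ->|us].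
  by rewrite -pd mulrA -dx pd addrC subrK.
by rewrite pj0 // subrr !mulr0 addr0.
Qed.

Section Image.
Context {S : eqType} {F : kalg k}.
Variables (J : bimod (kself k) A) (i : bihom J (@free k A S)).
Variables (V V' : bimod A F) (h : bihom V' V).

Let p x : bihom J (rforget (breg A)) := bcomp (fpi x) i.
Let sum (s : seq (J * V)) : J ⊗b V := \sum_(u <- s) u.1 ⊗ u.2.

(* Over a regular ring the values [p x u.1], for [u] in a finite list, are    *)
(* fixed by left multiplication by one of their right combinations [p x j0];  *)
(* replacing [u.1] by [u.1 - j0 * p x u.1] kills the coordinate [x] and       *)
(* changes the tensor by [j0 ⊗ coord].                                        *)
Lemma vnr_elim (l : seq S) (s : seq (J * V)) :
  (forall x, x \in l -> exists y, h y = coord (p x) V (sum s)) ->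
  exists z s', [/\ sum s = tmap (bid J) h z + sum s',
    forall x u, x \in l -> u \in s' -> p x u.1 = 0 &
    forall x, (forall u, u \in s -> p x u.1 = 0) ->
      forall u, u \in s' -> p x u.1 = 0].
Proof.
elim: l => [|x l IHl] hl; first by exists 0, s; rewrite bfun0 add0r.
have [|z [s' [sE s'l s'0]]] := IHl; first by move=> y yl; apply: hl; rewrite inE yl orbT.
have [y0 hy0] : exists y, h y = coord (p x) V (sum s').
  have [y hy] := hl x (mem_head _ _); exists (y - coord (p x) V' z).
  rewrite [h _]bfunB hy sE bfunD coord_natr addrC.
  exact: (@addKr V (h (coord (p x) V' z)) (coord (p x) V (sum s'))).
have [j0 [pj0 qj0]] := vnr_gen (p x) [seq u.1 | u <- s'].
exists (z + j0 ⊗ y0), [seq (u.1 - ract j0 (p x u.1 : A), u.2) | u <- s']; split.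
- rewrite bfunD tmapE hy0 sE -addrA; congr (_ + _); rewrite /sum big_map.
  elim: (s') => [|u r IHr]; first by rewrite !big_nil bfun0 bpure0r addr0.
  rewrite !big_cons bfunD bpureDr coordE -bpureM addrACA -IHr; congr (_ + _).
  rewrite -bpureDl; congr (_ ⊗ _); rewrite addrC; apply: esym.
  exact: (subrK (ract j0 (p x u.1 : A)) u.1).
- move=> y u; rewrite inE => /orP[/eqP ->|yl] /mapP[v vs ->] /=.
    rewrite -[LHS]/(p x (v.1 - ract j0 (p x v.1 : A))) bfunB bfunR.
    by rewrite [ract _ _]pj0 ?subrr //; apply: map_f.
  rewrite -[LHS]/(p y (v.1 - ract j0 (p x v.1 : A))) bfunB bfunR.
  rewrite s'l // qj0 ?ract0l ?subr0 // => _ /mapP[w ws ->].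
  exact: s'l.
move=> y y0' u /mapP[v vs ->] /=.
rewrite -[LHS]/(p y (v.1 - ract j0 (p x v.1 : A))) bfunB bfunR.
rewrite s'0 // qj0 ?ract0l ?subr0 // => _ /mapP[w ws ->].
exact: s'0.
Qed.

(** Eliminate one by one the finitely many coordinates that occur in the first factors of t; the
    remaining first factors then have all coordinates zero, hence vanish. With h = 0 this says that
    J ⊗ V embeds in free ⊗ V. *)
Lemma vnr_image (t : J ⊗b V) : injective i ->
  (forall x, exists y, h y = coord (p x) V t) -> exists z, tmap (bid J) h z = t.
Proof.
move=> iI ht; have [s ts] : exists s, t = sum s.
  move: (t); apply: bpure_ind => [|x y [s1 ->] [s2 ->]|m v].
  - by exists [::]; rewrite /sum big_nil.
  - by exists (s1 ++ s2); rewrite /sum big_cat.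
  - by exists [:: (m, v)]; rewrite /sum big_seq1.
pose l := flatten [seq fsupp (i u.1) | u <- s].
have [|z [s' [sE s'l s'0]]] := @vnr_elim l s; first by move=> x _; rewrite -ts.
exists z; rewrite ts sE [sum s'](_ : _ = 0) ?addr0 // /sum big_seq big1 // => u us.
suff -> : u.1 = 0 by rewrite bpure0l.
apply: iI; rewrite bfun0; apply: free_ext => x; rewrite [RHS]bfun0.
have [xl|xl] := boolP (x \in l); first exact: (s'l x u).
apply: (s'0 x) us => v vs; apply: fsuppP; apply: contra xl => xv.
by apply/flattenP; exists (fsupp (i v.1)) => //; apply: (map_f (fun w => fsupp (i w.1)) vs).
Qed.

End Image.

Definition free_cover (W : bimod (kself k) A) : bihom (@free k A W) W :=
  free_out id.

Lemma free_cover_surj (W : bimod (kself k) A) w : exists p, free_cover W p = w.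
Proof. by exists (fone w); rewrite free_outE. Qed.

(** Lift t to t' over a free cover c of W. Then h maps t' into ker c ⊗ N, and [vnr_image] writes the
    result as the image of some z in ker c ⊗ M. Subtracting z from t' leaves a tensor over a free
    module killed by h, whose coordinates lie in ker h. *)
Lemma vnr_left_exact (F : kalg k) (W : bimod (kself k) A) (M N : bimod A F)
    (h : bihom M N) (t : W ⊗b M) : tmap (bid W) h t = 0 ->
  exists s, tmap (bid W) (kin h) s = t.
Proof.
move=> t0; pose c := free_cover W; have cS := @free_cover_surj W.
have [t' tE] := tens_surj cS t.
have [|y yE] := tens_right_exact (kin_exact c) cS (t := tmap (bid _) h t').
  by rewrite tmap_swap tE t0.
have [|z zE] := @vnr_image _ _ _ (kin c) _ _ h y (@kin_inj _ _ _ _ _ c).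
  by move=> x; exists (coord (fpi x) M t'); rewrite -coord_natr -yE coord_natl.
have [|s sE] := @free_lift _ _ _ _ _ _ (kin h) (t' - tmap (kin c) (bid M) z).
  move=> x; apply/(kin_exact h).
  by rewrite -coord_natr bfunB -yE -zE tmap_swap subrr bfun0.
exists (tmap c (bid _) s); rewrite -tE.
rewrite -tmap_swap.
by rewrite sE bfunB (tens_exact0 (kin_exact c)) subr0.
Qed.

Lemma vnr_inj (F : kalg k) (W : bimod (kself k) A) (M N : bimod A F)
    (h : bihom M N) : injective h -> injective (tmap (bid W) h).
Proof.
move=> hI; apply: bihom_inj => t /vnr_left_exact[s <-].
rewrite -[RHS](@tmap_zeror _ _ _ _ W W (kerb h) M (bid W) s); apply: tmap_ext => // x.
by apply: hI; rewrite kinE bfun0.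
Qed.

Lemma vnr_pure (F : kalg k) (M N : bimod A F) (h : bihom M N) : pure h.
Proof.
move=> W; split; first exact/vnr_inj/kin_inj.
move=> t; split=> [/vnr_left_exact //|[s <-]].
rewrite tmap_comp -[RHS](@tmap_zeror _ _ _ _ W W (kerb h) N (bid W) s).
by apply: tmap_ext => // x; apply: kinE.
Qed.

(** With c the free cover of W2 and d its composite with the cokernel of f, W1 is the quotient of
    ker d by ker c. A tensor killed by f lifts to ker d ⊗ V, and its image in free ⊗ V comes from
    ker c ⊗ V; as ker d ⊗ V embeds in free ⊗ V, the lift itself comes from ker c ⊗ V. *)
Lemma vnr_flat_l (F : kalg k) (V : bimod A F) : flat_l V.
Proof.
apply: flat_l_of_inj => W1 W2 f fI; apply: bihom_inj => t t0.
pose c := free_cover W2; have cS := @free_cover_surj W2.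
pose d := bcomp (cokp f) c.
have ex (x : kerb d) : exists y, f y = c (kin d x).
  by apply/cokp_exact; apply: (kinE x).
have [pi piE] := bihom_factor (f := bcomp c (kin d)) fI ex.
have piS y : exists x, pi x = y.
  have [p pE] := cS (f y); have dp : d p = 0 by rewrite bcompE [c p]pE; apply/cokp_exact; exists y.
  by exists (kmk dp); apply: fI; rewrite piE.
have [t' tE] := tens_surj piS t.
have [|y yE] := tens_right_exact (kin_exact c) cS (t := tmap (kin d) (bid V) t').
  rewrite -[RHS]t0 -tE !tmap_comp; apply: tmap_ext => // x.
  by rewrite !bcompE piE.
have dk (x : kerb c) : d (kin c x) = 0 by rewrite bcompE (kinE x) (bfun0 (cokp f)).
pose ka : bihom (kerb c) (kerb d) := klift dk.
have kaE x : kin d (ka x) = kin c x by [].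
suff t'E : t' = tmap ka (bid V) y.
  rewrite -tE t'E tmap_comp -[RHS](@tmap_zerol _ _ _ _ (kerb c) W1 V V (bid V) y).
  by apply: tmap_ext => // x; apply: fI; rewrite bcompE piE bfun0; apply: kinE.
apply/subr0_eq.
have [|z <-] := @vnr_image _ _ _ (kin d) _ _ (bzero V V)
  (t' - tmap ka (bid V) y) (@kin_inj _ _ _ _ _ d).
  move=> x; exists 0; rewrite -coord_natl bfunB -yE tmap_comp.
  have -> : tmap (bcomp (kin d) ka) (bcomp (bid V) (bid V)) y = tmap (kin c) (bid V) y.
    exact: tmap_ext.
  by rewrite subrr !bfun0.
exact: tmap_zeror.
Qed.

End VonNeumannRegular.

(** * Cotensor products *)

Section CotensorMaps.
Context {k : comPzRingType}.
Implicit Types E A B F : kalg k.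

(** This turns kernels of [W ⊗ omega], hence purity, into cotensor products with the comodule W ⊗
    X. *)
Lemma omega_assoc E A B F (D : coring B) (W : bimod E A) (X : rcomod A D)
    (L : lcomod F D) t :
  assoc W X (D ⊗b L) (omega (tens_rcomod W X) L t) =
  tmap (bid W) (omega X L) (assoc W X L t).
Proof.
rewrite tmap_bsubr omegaE bfunB; congr (_ - _).
  tind t => u l; tind u => w x; rewrite assocE tmapE !bcompE !tmapE tens_rhoE.
  by move: (rho X x) => s; tind s => x' d; rewrite !(assocE, assocVE).
by tind t => u l; tind u => w x; rewrite /omega_r !(assocE, tmapE).
Qed.

Lemma tens_rho_nat E A B (D : coring B) (M M' : bimod E A) (N : rcomod A D)
    (f : bihom M M') t :
  tens_rho M' N (tmap f (bid N) t) = tmap (tmap f (bid N)) (bid D) (tens_rho M N t).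
Proof.
tind t => m n; rewrite tmapE !tens_rhoE; move: (rho N n) => s.
by tind s => n' d; rewrite !(assocVE, tmapE).
Qed.

Definition tens_rchom E A B (D : coring B) (M M' : bimod E A) (f : bihom M M')
    (N : rcomod A D) : rchom (tens_rcomod M N) (tens_rcomod M' N) :=
  @Rchom _ _ _ _ (tens_rcomod M N) (tens_rcomod M' N) (tmap f (bid N))
    (@tens_rho_nat _ _ _ _ _ _ N f).

Lemma omega_nat E A F (C : coring A) (M M' : rcomod E C) (f : rchom M M')
    (N : lcomod F C) t :
  omega M' N (tmap f (bid N) t) = tmap f (bid _) (omega M N t).
Proof.
rewrite !omegaE bfunB; congr (_ - _).
  tind t => m n; rewrite !bcompE !tmapE rchE; move: (rho M m) => s.
  by tind s => m' c; rewrite !(tmapE, assocE).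
by tind t => m n; rewrite !tmapE.
Qed.

Definition rcforget_rho E A (C : coring A) (M : rcomod E C) :
    bihom (rforget M) (rforget M ⊗b C) :=
  @bihomR _ _ (rforget M) (rforget M ⊗b C) (rho M) (bfunB (rho M)) (bfunR (rho M)).

Definition rcforget E A (C : coring A) (M : rcomod E C) : rcomod (kself k) C :=
  @Rcomod _ _ _ C (rforget M) (rcforget_rho M) (@rhoA _ _ _ _ M) (@rho_eps _ _ _ _ M).

(** Apply the counit to the first factor of omega_l t = omega_r t. The coaction is thus the inverse
    of the isomorphism C ◻ X -> X. *)
Lemma omega_cor_eps A F (C : coring A) (X : lcomod F C) (t : C ⊗b X) :
  omega (cor_bicomod C) X t = 0 ->
  lam X (lunit X (tmap (ceps C) (bid X) t)) = t.
Proof.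
move/omegaP => tE.
pose e : bihom (C ⊗b (C ⊗b X)) (C ⊗b X) := bcomp (lunit _) (tmap (ceps C) (bid _)).
have eE c u : e (c ⊗ u) = lact (ceps C c : A) u by rewrite bcompE tmapE lunitE.
have -> : lam X (lunit X (tmap (ceps C) (bid X) t)) = e (omega_r (cor_bicomod C) X t).
  by clear tE; tind t => c x; rewrite tmapE lunitE [omega_r _ _ _]tmapE eE bfunL.
rewrite -tE; clear tE; tind t => c x; rewrite [omega_l _ _ _]bcompE tmapE.
rewrite -{2}[c](cdelta_epsl c) -[rho (cor_bicomod C) c]/(cdelta C c).
move: (cdelta C c) => s; tind s => c' c''.
by rewrite !(assocE, tmapE, lunitE) eE lact_bpure.
Qed.

Lemma omega_cor_epsr E A (C : coring A) (X : rcomod E C) (t : X ⊗b C) :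
  omega X (cor_bicomod C) t = 0 ->
  rho X (runit X (tmap (bid X) (ceps C) t)) = t.
Proof.
move/omegaP => tE.
pose e : bihom (X ⊗b (C ⊗b C)) (X ⊗b C) :=
  tmap (bid X) (bcomp (runit C) (tmap (bid C) (ceps C))).
have eE x c d : e (x ⊗ (c ⊗ d)) = x ⊗ ract c (ceps C d : A).
  by rewrite tmapE bcompE tmapE runitE.
have -> : rho X (runit X (tmap (bid X) (ceps C) t)) = e (omega_l X (cor_bicomod C) t).
  clear tE; tind t => x c; rewrite tmapE runitE bcompE tmapE bfunR.
  by move: (rho X x) => s; tind s => x' c'; rewrite assocE eE ract_bpure.
rewrite tE; clear tE; tind t => x c; rewrite [omega_r _ _ _]tmapE tmapE.
by rewrite bcompE -[lam (cor_bicomod C) c]/(cdelta C c) cdelta_epsr.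
Qed.

End CotensorMaps.

Section TensorCotensor.
Context {k : comPzRingType} {A B : kalg k} {C : coring A} {D : coring B}.
Variables (hD : flat_l D) (X : bicomod C D).

Definition kin_rchom (E : kalg k) (M : rcomod E C) :
  rchom (cot_rcomod X hD M) (tens_rcomod M X) :=
  @Rchom _ _ _ _ (cot_rcomod X hD M) (tens_rcomod M X) (kin (omega M X))
    (fun x => esym (cot_rhoE x)).

Section Free.
Context {E : kalg k} (W : bimod E A).
Let T := tens_rcomod W (cor_bicomod C).

Definition epsr : bihom (W ⊗b C) W := bcomp (runit W) (tmap (bid W) (ceps C)).

Lemma epsrE w c : epsr (w ⊗ c) = ract w (ceps C c : A).
Proof. by rewrite bcompE tmapE runitE. Qed.

Definition cot_epsr : rchom (cot_rcomod X hD T) (tens_rcomod W X) :=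
  rccomp (@tens_rchom _ _ _ _ _ T W epsr X) (kin_rchom T).

Lemma cot_epsrE x : cot_epsr x = tmap epsr (bid X) (kin (omega T X) x).
Proof. by []. Qed.

Let coac : bihom (W ⊗b X) (T ⊗b X) := bcomp (assocV W C X) (tmap (bid W) (lam X)).

Let coac_omega t : omega T X (coac t) = 0.
Proof.
apply/omegaP; tind t => w x; rewrite [coac _]bcompE tmapE.
have h1 s : omega_l T X (assocV W C X (w ⊗ s)) =
    assocV W C (C ⊗b X) (w ⊗ assoc C C X (tmap (cdelta C) (bid X) s)).
  tind s => c x'; rewrite assocVE bcompE !tmapE tens_rhoE -[rho (cor_bicomod C) c]/(cdelta C c).
  by move: (cdelta C c) => u; tind u => c' c''; rewrite !(assocVE, assocE).
have h2 s : omega_r T X (assocV W C X (w ⊗ s)) =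
    assocV W C (C ⊗b X) (w ⊗ tmap (bid C) (lam X) s).
  by tind s => c x'; rewrite !assocVE !tmapE assocVE.
by rewrite h1 h2 lamA.
Qed.

(** The inverse of (W ⊗ C) ◻ X -> W ⊗ X is W ⊗ lam: coassociativity puts its values in the kernel of
    omega. *)
Lemma cot_epsr_bij : bijective cot_epsr.
Proof.
exists (klift coac_omega) => [u|t]; last first.
  rewrite cot_epsrE -[kin _ _]/(coac t); tind t => w x; rewrite [coac _]bcompE tmapE.
  rewrite -{2}[x](lam_eps x); move: (lam X x) => s; tind s => c x'.
  by rewrite !(assocVE, tmapE, lunitE) epsrE bpureM.
apply: (@kin_inj _ _ _ _ _ (omega T X)); rewrite -[LHS]/(coac (cot_epsr u)) cot_epsrE.
have := kinE u; move: (kin _ u) => t /omegaP tE.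
rewrite -[RHS](@assocK _ _ _ _ _ W C X); congr (assocV W C X _).
have -> : tmap (bid W) (lam X) (tmap epsr (bid X) t) =
    tmap epsr (bid _) (omega_r T X t).
  by clear tE; tind t => v x; rewrite !tmapE.
rewrite -tE; clear tE; tind t => v x; tind v => w c.
rewrite bcompE !tmapE assocE tens_rhoE -[rho (cor_bicomod C) c]/(cdelta C c).
rewrite -{2}[c](cdelta_epsl c); move: (cdelta C c) => s; tind s => c' c''.
by rewrite !(assocE, assocVE, tmapE, lunitE) epsrE bpureM lact_bpure.
Qed.

End Free.

Lemma cot_epsr_nat (E : kalg k) (W W' : bimod E A) (f : bihom W W') x :
  cot_epsr W' (cot_rchom X hD (tens_rchom f (cor_bicomod C)) x) =
  tmap f (bid X) (cot_epsr W x).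
Proof.
rewrite !cot_epsrE.
have -> : kin (omega (tens_rcomod W' (cor_bicomod C)) X)
    (cot_rchom X hD (tens_rchom f (cor_bicomod C)) x) =
  tmap (tmap f (bid C)) (bid X) (kin (omega (tens_rcomod W (cor_bicomod C)) X) x) by [].
rewrite !tmap_comp; apply: tmap_ext => // t; tind t => w c.
by rewrite !bcompE !(tmapE, runitE) bfunR.
Qed.

(** On the cofree comodules W ⊗ C the functor - ◻ X is W |-> W ⊗ X. *)
Lemma flat_l_of_cot :
  (forall (W W' : bimod (kself k) A) (f : bihom W W'), injective f ->
     injective (cotmapl X (tens_rchom f (cor_bicomod C)))) -> flat_l X.
Proof.
move=> hX; apply: flat_l_of_inj => W W' f fI s t st.
have [g gK Kg] := cot_epsr_bij W; have W'I := bij_inj (cot_epsr_bij W').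
rewrite -[s]Kg -[t]Kg; congr (cot_epsr W _).
by apply/(hX _ _ f fI)/W'I; rewrite !cot_epsr_nat !Kg.
Qed.

End TensorCotensor.

(** * From a unit to a bicolinear map and back *)

Section CotInverse.
Context {k : comPzRingType} {A B : kalg k} {C : coring A} {D : coring B}.
Variables (hC : flat_l C) (hD : flat_l D) (X : bicomod C D) (L : bicomod D C).

(** phi plays the inverse of f followed by the inclusion of X ◻ L. Quantifying the last two clauses
    over W encodes purity as well; W = A gives bijectivity onto the kernel. *)
Definition is_cot_inverse (phi : bihom C (X ⊗b L)) : Prop :=
  [/\ forall c, omega X L (phi c) = 0,
      forall c, tens_lam X L (phi c) = tmap (bid C) phi (cdelta C c),
      forall c, tens_rho X L (phi c) = tmap phi (bid C) (cdelta C c),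
      forall W : bimod (kself k) A, injective (tmap (bid W) phi) &
      forall (W : bimod (kself k) A) t, tmap (bid W) (omega X L) t = 0 ->
        exists s, tmap (bid W) phi s = t].

Definition cot2 (M : rcomod (kself k) C) : rcomod (kself k) C :=
  cot_rcomod L hC (cot_rcomod X hD M).

Definition cot_emb (M : rcomod (kself k) C) : bihom (cot2 M) (M ⊗b (X ⊗b L)) :=
  bcomp (assoc M X L)
    (bcomp (tmap (kin (omega M X)) (bid L)) (kin (omega (cot_rcomod X hD M) L))).

Lemma cot_embE M x : cot_emb M x = assoc M X L (tmap (kin (omega M X)) (bid L)
  (kin (omega (cot_rcomod X hD M) L) x)).
Proof. by []. Qed.

Let C0 : rcomod (kself k) C := rcforget (cor_bicomod C).
Let F0 : rcomod (kself k) D := cot_rcomod X hD C0.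
Let epsl : bihom (C ⊗b X) X := bcomp (lunit X) (tmap (ceps C) (bid X)).
Let epslE c x : epsl (c ⊗ x) = lact (ceps C c : A) x.
Proof. by rewrite bcompE tmapE lunitE. Qed.

Definition cot_epsl : bihom F0 (rforget X).
Proof.
apply: (@bihomR _ _ F0 (rforget X) (fun y => epsl (kin (omega C0 X) y))).
- by move=> x y; rewrite (bfunB (kin (omega C0 X))); apply: (bfunB epsl).
- by move=> x b; rewrite (bfunR (kin (omega C0 X))); apply: (bfunR epsl).
Defined.

Lemma cot_epslE y :
  cot_epsl y = lunit X (tmap (ceps C) (bid X) (kin (omega C0 X) y)).
Proof. by []. Qed.

Section FromUnit.
Variable eta : forall M : rcomod (kself k) C, rchom M (cot2 M).
Hypothesis etaB : forall M, bijective (eta M).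
Hypothesis etaN : forall M N (f : rchom M N) x,
  eta N (f x) = cot_rchom L hC (cot_rchom X hD f) (eta M x).

Let b0 := cot_epsl.
Let b0E y : b0 y = epsl (kin (omega C0 X) y). Proof. by []. Qed.

Let u0 (c : C) : F0 ⊗b L := kin (omega F0 L) (eta C0 c).

(** The unit at C followed by the identification of C ◻ X with X. *)
Let phi0 (c : C) : X ⊗b L := tmap b0 (bid L) (u0 c).

(* A morphism out of [C0] transports [eta] from [C0]. *)
Let u0_nat (M : rcomod (kself k) C) (f : rchom C0 M) c :
  kin (omega (cot_rcomod X hD M) L) (eta M (f c)) =
  tmap (cot_rchom X hD f) (bid L) (u0 c).
Proof. by rewrite etaN. Qed.

(** Left multiplication by a is a right colinear endomorphism of C, so naturality of the unit
    applies to it. *)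
Let phi0L a c : phi0 (lact a c) = lact a (phi0 c).
Proof.
have lB : zmod_morphism (fun c : C => lact a c) by move=> x y; rewrite lactDr lactNr.
have lR (x : C) b : lact a (ract x b) = ract (lact a x) b by rewrite lractA.
pose l0 : bihom C0 C0 := @bihomR _ _ C0 C0 (fun c : C => lact a c) lB lR.
have lC (x : C0) : rho C0 (l0 x) = tmap l0 (bid C) (rho C0 x).
  rewrite -[LHS]/(cdelta C (lact a x)) bfunL -[rho C0 x]/(cdelta C x).
  by move: (cdelta C x) => s; tind s => c' c''; rewrite tmapE lact_bpure.
pose l : rchom C0 C0 := @Rchom _ _ _ _ C0 C0 l0 lC.
have E : u0 (lact a c) = tmap (cot_rchom X hD l) (bid L) (u0 c) by apply: (u0_nat l).
rewrite /phi0 E; move: (u0 c) => v.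
tind v => y x; rewrite !tmapE lact_bpure; congr (_ ⊗ _).
rewrite !b0E -[kin _ (cot_rchom X hD l y)]/(tmap l (bid X) (kin (omega C0 X) y)).
move: (kin _ y) => t; move: t; apply: bpure_ind => [|t t' ht ht'|c' x'].
- by rewrite !bfun0 lact0r.
- by rewrite !bfunD lactDr ht ht'.
by rewrite tmapE !epslE bfunL lactM.
Qed.

Let phi : bihom C (X ⊗b L).
Proof.
exists phi0; last 1 first.
- by move=> c a; rewrite /phi0 /u0 (bfunR (eta C0)) !bfunR.
- by move=> c d; rewrite /phi0 /u0 (bfunB (eta C0)) !bfunB.
- exact: phi0L.
Defined.

Let phiE c : phi c = tmap b0 (bid L) (u0 c). Proof. by []. Qed.

Let T (W : bimod (kself k) A) : rcomod (kself k) C := tens_rcomod W (cor_bicomod C).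
Let Gb (W : bimod (kself k) A) := cot_rchom L hC (cot_epsr hD X W).

Let GbB W : bijective (Gb W).
Proof. exact: (@fmor_bij _ _ _ _ _ (cot_functor L hC) _ _ _ (cot_epsr_bij hD X W)). Qed.

Let kin_Gb W u : kin (omega (tens_rcomod W X) L) (Gb W u) =
  tmap (cot_epsr hD X W) (bid L) (kin _ u).
Proof. by []. Qed.

Let phi_tens (W : bimod (kself k) A) (t : W ⊗b C) :
  tmap (bid W) phi t = assoc W X L (kin _ (Gb W (eta (T W) t))).
Proof.
tind t => w c; rewrite tmapE kin_Gb.
have wB : zmod_morphism (fun c : C => w ⊗ c).
  by move=> x y; apply/eqP; rewrite eq_sym subr_eq -bpureDr subrK.
have wR (x : C) b : w ⊗ (ract x b) = ract (w ⊗ x) b by rewrite ract_bpure.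
pose w0 : bihom C0 (T W) := @bihomR _ _ C0 (T W) (fun c : C => w ⊗ c) wB wR.
have wC (x : C0) : rho (T W) (w0 x) = tmap w0 (bid C) (rho C0 x).
  rewrite [LHS]tens_rhoE -[rho (cor_bicomod C) x]/(cdelta C x) -[rho C0 x]/(cdelta C x).
  by move: (cdelta C x) => s; tind s => c' c''; rewrite tmapE assocVE.
pose wh : rchom C0 (T W) := @Rchom _ _ _ _ C0 (T W) w0 wC.
rewrite [kin _ _](u0_nat wh) phiE; move: (u0 c) => v.
move: v; apply: bpure_ind => [|x y hx hy|y l].
- by rewrite !bfun0 bpure0r.
- by rewrite !bfunD bpureDr hx hy.
rewrite !tmapE -[LHS]assocE; congr (assoc _ _ _ (_ ⊗ _)).
rewrite cot_epsrE -[kin _ _]/(tmap wh (bid X) (kin (omega C0 X) y)) b0E.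
move: (kin _ y) => t; move: t; apply: bpure_ind => [|t t' ht ht'|c' x'].
- by rewrite !bfun0 bpure0r.
- by rewrite !bfunD bpureDr ht ht'.
by rewrite !tmapE epslE epsrE bpureM.
Qed.

Let phi_emb M m : cot_emb M (eta M m) = tmap (bid M) phi (rho M m).
Proof.
have rC (x : M) : rho (T M) (rho M x) = tmap (rho M) (bid C) (rho M x).
  rewrite [LHS]bcompE -[tmap (bid M) _ _]/(tmap (bid M) (cdelta C) (rho M x)) -rhoA.
  exact: assocK.
pose r : rchom M (T M) := @Rchom _ _ _ _ M (T M) (rho M) rC.
rewrite phi_tens kin_Gb -[rho M m]/(r m) etaN cot_embE; congr (assoc _ _ _ _).
rewrite -[kin _ (cot_rchom _ _ _ _)]/(tmap (cot_rchom X hD r) (bid L) (kin _ (eta M m))).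
rewrite tmap_comp; apply: tmap_ext => // y; rewrite bcompE cot_epsrE.
rewrite -[kin _ (cot_rchom _ _ _ _)]/(tmap r (bid X) (kin _ y)) tmap_comp tmap_id //.
by move=> x; rewrite bcompE -[RHS]rho_eps.
Qed.

Lemma unit_cot_inverse : exists phi : bihom C (X ⊗b L), is_cot_inverse phi /\
  forall M m, cot_emb M (eta M m) = tmap (bid M) phi (rho M m).
Proof.
exists phi; split; last exact: phi_emb.
have phi_om (W : bimod (kself k) A) t : tmap (bid W) (omega X L) (tmap (bid W) phi t) = 0.
  by rewrite phi_tens -omega_assoc kinE bfun0.
split.
(* Take W = A and the tensor 1 ⊗ c. *)
- move=> c; have := phi_om (rforget (breg A)) (((1 : A) : rforget (breg A)) ⊗ c).
  rewrite !tmapE => /(congr1 (lunit (X ⊗b (D ⊗b L)))).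
  by rewrite lunitE lact1 bfun0.
(* Left colinearity: [phi_emb] at C gives the right side, and the left side agrees because elements
   of C ◻ X are coactions of their images in X. *)
- move=> c; transitivity (cot_emb C0 (eta C0 c)); last by rewrite phi_emb.
  rewrite phiE cot_embE -/(u0 c); move: (u0 c) => v.
  move: v; apply: bpure_ind => [|x y hx hy|y l].
  + by rewrite !bfun0.
  + by rewrite !bfunD hx hy.
  rewrite !tmapE [LHS]tens_lamE; congr (assoc C X L (_ ⊗ l)).
  by rewrite b0E; apply: omega_cor_eps; apply: (kinE y).
- move=> c; transitivity (tmap (tmap b0 (bid L)) (bid C) (tens_rho F0 L (u0 c))).
    rewrite phiE; move: (u0 c) => v; move: v; apply: bpure_ind => [|x y hx hy|y l].
    + by rewrite !bfun0.
    + by rewrite !bfunD hx hy.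
    rewrite tmapE [LHS]tens_rhoE [tens_rho _ _ _]tens_rhoE; move: (rho L l) => s.
    move: s; apply: bpure_ind => [|x x' hx hx'|l' c'].
    + by rewrite !bpure0r !bfun0.
    + by rewrite !bpureDr !bfunD hx hx'.
    by rewrite !assocVE !tmapE.
  rewrite -[tens_rho _ _ _](@cot_rhoE _ _ _ _ _ L hC _ F0 (eta C0 c)).
  rewrite rchE -[rho C0 c]/(cdelta C c); move: (cdelta C c) => s.
  move: s; apply: bpure_ind => [|x x' hx hx'|c' c''].
  + by rewrite !bfun0.
  + by rewrite !bfunD hx hx'.
  by rewrite !tmapE.
- move=> W s t; rewrite !phi_tens => /(bij_inj (assoc_bij W X L)) /kin_inj.
  by move=> /(bij_inj (GbB W)) /(bij_inj (etaB (T W))).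
- move=> W t t0; have [v vE] : exists v, kin (omega (tens_rcomod W X) L) v = assocV W X L t.
    apply/kin_exact; apply: (bij_inj (assoc_bij W X (D ⊗b L))).
    by rewrite [LHS](omega_assoc (W := W) (X := X)) assocVK t0 bfun0.
  have [u uE] := bij_surj (GbB W) v; have [s sE] := bij_surj (etaB (T W)) u.
  by exists s; rewrite phi_tens sE uE vE assocVK.
Qed.
End FromUnit.

End CotInverse.

Section FromInverse.
Context {k : comPzRingType} {A B : kalg k} {C : coring A} {D : coring B}.
Variables (hC : flat_l C) (hD : flat_l D) (X : bicomod C D) (L : bicomod D C).
Variable phi : bihom C (X ⊗b L).
Hypothesis phiP : is_cot_inverse phi.
Hypothesis omegaL : forall M : rcomod (kself k) C,
  left_exact (tmap (kin (omega M X)) (bid L)) (tmap (omega M X) (bid L)).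
Hypothesis omegaDL : forall M : rcomod (kself k) C,
  injective (tmap (kin (omega M X)) (bid (D ⊗b L))).

Let emb := cot_emb hC hD X L.

Lemma cot_emb_inj M : injective (emb M).
Proof.
move=> x y /(bij_inj (assoc_bij _ _ _)) /(proj1 (omegaL M)).
exact: kin_inj.
Qed.

Lemma cot_emb_omega (M : rcomod (kself k) C) x : tmap (bid M) (omega X L) (emb M x) = 0.
Proof.
rewrite /emb cot_embE -omega_assoc.
have := omega_nat (kin_rchom hD X M) (kin (omega (cot_rcomod X hD M) L) x).
by rewrite kinE bfun0 => ->; rewrite bfun0.
Qed.

Lemma cot_emb_omegal (M : rcomod (kself k) C) x :
  tmap (omega M X) (bid L) (assocV M X L (emb M x)) = 0.
Proof. by rewrite /emb cot_embE assocK; apply/(proj2 (omegaL M)); eexists. Qed.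

(** The second equation places t in (M ◻ X) ⊗ L by stability of the kernel. The first then says that
    this lift is killed by the omega of M ◻ X and L, tested after the injection into M ⊗ X ⊗ (D ⊗
    L). *)
Lemma cot_embP (M : rcomod (kself k) C) t : tmap (bid M) (omega X L) t = 0 ->
  tmap (omega M X) (bid L) (assocV M X L t) = 0 -> exists x, emb M x = t.
Proof.
move=> h1 /(proj2 (omegaL M))[v vE].
have v0 : omega (cot_rcomod X hD M) L v = 0.
  apply: (omegaDL (M := M)); rewrite bfun0.
  rewrite -[LHS](omega_nat (kin_rchom hD X M) v).
  apply: (bij_inj (assoc_bij M X (D ⊗b L))); rewrite [LHS](omega_assoc (W := M) (X := X)) bfun0.
  by rewrite -[tmap _ _ v]/(tmap (kin (omega M X)) (bid L) v) vE assocVK.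
by exists (kmk v0); rewrite /emb cot_embE -[kin _ (kmk v0)]/v vE assocVK.
Qed.

Lemma cot_emb_rho (M : rcomod (kself k) C) x : tmap (emb M) (bid C) (rho (cot2 hC hD X L M) x) =
  tens_rho M (tens_rcomod X L) (emb M x).
Proof.
have E t : tens_rho M (tens_rcomod X L) (assoc M X L t) =
    tmap (assoc M X L) (bid C) (tens_rho (M ⊗b X) L t).
  tind t => u l; tind u => m y; rewrite assocE [LHS]tens_rhoE.
  rewrite -[rho (tens_rcomod X L) _]/(tens_rho X L (y ⊗ l)) !tens_rhoE.
  move: (rho L l) => s; move: s; apply: bpure_ind => [|s s' hs hs'|l' c].
  - by rewrite !bpure0r !bfun0 !bpure0r !bfun0.
  - by rewrite !bpureDr !bfunD !bpureDr !bfunD hs hs'.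
  by rewrite !assocVE tmapE assocE.
rewrite /emb cot_embE E tens_rho_nat.
rewrite -[tens_rho _ L (kin _ x)](@cot_rhoE _ _ _ _ _ L hC _ (cot_rcomod X hD M) x).
rewrite !tmap_comp; exact: tmap_ext.
Qed.

Lemma cot_emb_nat (M N : rcomod (kself k) C) (f : rchom M N) x :
  emb N (cot_rchom L hC (cot_rchom X hD f) x) = tmap f (bid _) (emb M x).
Proof.
rewrite /emb !cot_embE.
rewrite -[kin _ (cot_rchom _ _ _ x)]/(tmap (cot_rchom X hD f) (bid L) (kin _ x)).
move: (kin _ x) => v; move: v; apply: bpure_ind => [|u v hu hv|y l].
- by rewrite !bfun0.
- by rewrite !bfunD hu hv.
rewrite !tmapE -[kin _ (cot_rchom _ _ _ y)]/(tmap f (bid X) (kin _ y)).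
move: (kin _ y) => t; move: t; apply: bpure_ind => [|u v hu hv|m z].
- by rewrite !(bfun0, bpure0l).
- by rewrite !(bfunD, bpureDl) hu hv.
by rewrite !(tmapE, assocE).
Qed.

Let R (M : rcomod (kself k) C) :
    bihom (M ⊗b (C ⊗b X) ⊗b L) (M ⊗b C ⊗b (X ⊗b L)) :=
  bcomp (assoc (M ⊗b C) X L) (tmap (assocV M C X) (bid L)).

Let R_inj M : injective (R M).
Proof.
have aB : bijective (assocV M C X).
  by exists (assoc M C X); [exact: assocVK|exact: assocK].
by move=> x y /(bij_inj (assoc_bij _ _ _)) /(bij_inj (tmap_bij aB (bid_bij _))).
Qed.

Let RE (M : rcomod (kself k) C) m c x l : R M (m ⊗ (c ⊗ x) ⊗ l) = m ⊗ c ⊗ (x ⊗ l).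
Proof. by rewrite bcompE tmapE assocVE assocE. Qed.

(** Left colinearity of phi turns the omega of M and X into that of M and C, so the second equation
    of [cot_embP] for (M ⊗ phi) s says that s lies in M ◻ C. *)
Let omega_phi (M : rcomod (kself k) C) s :
  R M (tmap (omega M X) (bid L) (assocV M X L (tmap (bid M) phi s))) =
  tmap (bid (M ⊗b C)) phi
    (tmap (rho M) (bid C) s - assocV M C C (tmap (bid M) (cdelta C) s)).
Proof.
have [_ phiL _ _ _] := phiP.
rewrite tmap_bsubl !bfunB; congr (_ - _); tind s => m c; rewrite !tmapE.
  have h u : R M (tmap (omega_l M X) (bid L) (assocV M X L (m ⊗ u))) = rho M m ⊗ u.
    tind u => x l; rewrite assocVE tmapE [omega_l _ _ _]bcompE tmapE.
    by move: (rho M m) => s; tind s => m' c'; rewrite assocE RE.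
  exact: h.
have h u : R M (tmap (omega_r M X) (bid L) (assocV M X L (m ⊗ u))) =
    assocV M C (X ⊗b L) (m ⊗ tens_lam X L u).
  tind u => x l; rewrite assocVE tmapE tmapE tens_lamE.
  by move: (lam X x) => s; tind s => c' x'; rewrite assocE assocVE RE.
rewrite h phiL; move: (cdelta C c) => s.
by tind s => c' c''; rewrite !(assocVE, tmapE).
Qed.

Lemma cot_inverse_unit :
  natiso (cfid C) (cfcomp (cot_functor L hC) (cot_functor X hD)).
Proof.
have [phi0 _ phiR phiI phiS] := phiP.
have ex (M : rcomod (kself k) C) (m : M) : exists x, emb M x = bcomp (tmap (bid M) phi) (rho M) m.
  rewrite bcompE; apply: cot_embP.
    rewrite tmap_comp -[RHS](@tmap_zeror _ _ _ _ M M C (X ⊗b (D ⊗b L)) (bid M) (rho M m)).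
    by apply: tmap_ext => // c; apply: phi0.
  apply: R_inj; rewrite omega_phi -rhoA assocK subrr.
  by rewrite !bfun0.
pose e0 (M : rcomod (kself k) C) := projT1 (cid (bihom_factor (@cot_emb_inj M) (@ex M))).
have e0E M m : emb M (e0 M m) = tmap (bid M) phi (rho M m).
  exact: (projT2 (cid (bihom_factor (@cot_emb_inj M) (@ex M)))).
have eR (M : rcomod (kself k) C) m :
    rho (cot2 hC hD X L M) (e0 M m) = tmap (e0 M) (bid C) (rho M m).
  apply: (flat_l_inj hC (@cot_emb_inj M)); rewrite cot_emb_rho e0E.
  rewrite tmap_comp [RHS](@tmap_ext _ _ _ _ _ _ _ _ _
    (bcomp (tmap (bid M) phi) (rho M)) _ (bcomp (bid C) (bid C)));
    [|exact: e0E|by []].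
  rewrite -tmap_comp.
  have <- : assocV M C C (tmap (bid M) (cdelta C) (rho M m)) = tmap (rho M) (bid C) (rho M m).
    by rewrite -rhoA assocK.
  move: (rho M m) => s; tind s => m' c; rewrite !tmapE tens_rhoE [rho _ _]phiR.
  by move: (cdelta C c) => s; tind s => c' c''; rewrite !(assocVE, tmapE).
pose eta := fun M : rcomod (kself k) C => @Rchom _ _ _ _ M (cot2 hC hD X L M) (e0 M) (eR M).
apply: (natiso_of_bij (F := cfid C)
  (G := cfcomp (cot_functor L hC) (cot_functor X hD)) (eta := eta)) => [M|M N f m].
  apply: inj_surj_bij => [|x].
    move=> m m' mm'; rewrite -[m]rho_eps -[m']rho_eps; congr (runit M (tmap _ _ _)).
    by apply: (phiI M); rewrite -!e0E -[e0 M m]/(eta M m) mm'.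
  have [s sE] := phiS M _ (cot_emb_omega x).
  have rs : tmap (rho M) (bid C) s = assocV M C C (tmap (bid M) (cdelta C) s).
    apply/subr0_eq/(phiI (M ⊗b C)); rewrite -omega_phi sE cot_emb_omegal.
    by rewrite !bfun0.
  (* s lies in M ◻ C, so it is the coaction of the element obtained by applying the counit. *)
  exists (runit M (tmap (bid M) (ceps C) s)); apply: cot_emb_inj; rewrite [LHS]e0E -sE.
  congr (tmap _ _ _); apply: omega_cor_epsr; apply/omegaP.
  by rewrite /omega_l bcompE rs assocVK.
apply: cot_emb_inj; rewrite [LHS]e0E [RHS]cot_emb_nat [in RHS]e0E.
rewrite [fmor _ _ _]/= rchE; move: (rho M m) => s.
by tind s => m' c; rewrite !tmapE.
Qed.

End FromInverse.

(** * Coflatness *)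

Section Coflat.
Context {k : comPzRingType}.

Lemma tens_short_exact (E A F : kalg k) (M N P : bimod E A) (f : bihom M N)
    (g : bihom N P) (V : bimod A F) : flat_l V ->
  short_exact f g -> short_exact (tmap f (bid V)) (tmap g (bid V)).
Proof.
move=> hV [fI fg gS]; split; first exact: flat_l_inj.
  exact: flat_l_exact.
exact: tens_surj.
Qed.

(** Tensoring an injection and its cokernel with the flat C gives a short exact sequence of cofree
    comodules, on which - ◻ X is - ⊗ X. *)
Lemma coflat_flat_l (A B : kalg k) (C : coring A) (D : coring B) (X : bicomod C D) :
  flat_l C -> flat_l D -> coflat X -> flat_l X.
Proof.
move=> hC hD hX; apply: (flat_l_of_cot hD) => W W' f fI.
have fS : short_exact f (cokp f).
  by split=> //; [exact: cokp_exact|exact: cokp_surj].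
by have [] := hX _ _ _ (tens_rchom f (cor_bicomod C))
  (tens_rchom (cokp f) (cor_bicomod C)) (tens_short_exact hC fS).
Qed.

(* Coflatness makes [W |-> ker (W ⊗ omega)] exact, and it agrees with         *)
(* [W ⊗ ker omega] on free modules: compare both on a free presentation.      *)
Lemma coflat_pure (A B F : kalg k) (D : coring B) (X : rcomod A D) (L : lcomod F D) :
  flat_l X -> coflat L -> pure (omega X L).
Proof.
move=> hX hL; pose om := omega X L.
pose ok (W : bimod (kself k) A) (t : W ⊗b (X ⊗b L)) := tmap (bid W) om t = 0.
have pres (W : bimod (kself k) A) : let c := free_cover W in
    (forall t, ok W t -> exists t', ok _ t' /\ tmap c (bid _) t' = t) /\
    (forall t, ok _ t -> tmap c (bid _) t = 0 ->
       exists s, ok _ s /\ tmap (kin c) (bid _) s = t).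
  move=> c; have cS : short_exact (kin c) c.
    split; [exact: kin_inj|exact: kin_exact|exact: free_cover_surj].
  have [_ cE cS'] := hL _ _ _ (tens_rchom (kin c) X) (tens_rchom c X) (tens_short_exact hX cS).
  have mk (V : bimod (kself k) A) t : ok V t ->
      exists u, kin (omega (tens_rcomod V X) L) u = assocV V X L t.
    move=> t0; apply/kin_exact; apply: (bij_inj (assoc_bij V X (D ⊗b L))).
    by rewrite [LHS](omega_assoc (W := V)) assocVK bfun0.
  have okk (V : bimod (kself k) A) u : ok V (assoc V X L (kin (omega (tens_rcomod V X) L) u)).
    by rewrite /ok -omega_assoc kinE bfun0.
  split=> [t /mk[u uE]|t /mk[u uE] t0].
    have [v vE] := cS' u; exists (assoc _ X L (kin _ v)); split=> //.
    rewrite -[t]assocVK -uE -vE.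
  rewrite -[kin _ (cotmapl L _ v)]/(tmap (tmap c (bid X)) (bid L) (kin _ v)).
    by rewrite assoc_nat; apply: tmap_ext => // x; rewrite tmap_id.
  have [|v vE] := (cE u).1.
    apply: kin_inj; rewrite bfun0.
    rewrite -[kin _ (cotmapl L _ u)]/(tmap (tmap c (bid X)) (bid L) (kin _ u)).
    rewrite uE -assocV_nat -[RHS](bfun0 (assocV _ _ _)) -t0; congr (assocV _ _ _ _).
    by apply: tmap_ext => // x; rewrite tmap_id.
  exists (assoc _ X L (kin _ v)); split=> //.
  rewrite -[t]assocVK -uE -vE.
  rewrite -[kin _ (cotmapl L _ v)]/(tmap (tmap (kin c) (bid X)) (bid L) (kin _ v)).
  by rewrite assoc_nat; apply: tmap_ext => // x; rewrite tmap_id.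
have okS W t : ok W t -> exists s, tmap (bid W) (kin om) s = t.
  move=> /(proj1 (pres W))[t' [t'0 <-]].
  have [x|s <-] := free_lift (h := kin om) (t := t').
    by apply/(kin_exact om); rewrite -coord_natr t'0 bfun0.
  by exists (tmap (free_cover W) (bid _) s); rewrite tmap_swap.
move=> W; split=> [|t]; last first.
  split=> [/okS //|[s <-]].
  rewrite tmap_comp -[RHS](@tmap_zeror _ _ _ _ W W (kerb om) (X ⊗b (D ⊗b L)) (bid W) s).
  by apply: tmap_ext => // x; apply: kinE.
apply: bihom_inj => s; have [s' <-] := tens_surj (@free_cover_surj _ _ W) s.
rewrite -tmap_swap => t0.
have [|r [/okS[r' <-]]] := proj2 (pres W) _ _ t0.
  rewrite /ok tmap_comp -[RHS](@tmap_zeror _ _ _ _ _ _ (kerb om) (X ⊗b (D ⊗b L)) (bid _) s').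
  by apply: tmap_ext => // x; apply: kinE.
rewrite tmap_swap => E; have -> : s' = tmap (kin (free_cover W)) (bid _) r'.
  apply/subr0_eq/free_coord_eq0 => x; apply: (@kin_inj _ _ _ _ _ om).
  set u := s' - _; rewrite [LHS](_ : _ = kin om (coord (fpi x) (kerb om) u)) //.
  by rewrite -coord_natr /u bfunB E subrr bfun0 bfun0.
exact: (tens_exact0 (kin_exact _)).
Qed.

End Coflat.

(** * The two squares *)

Section Triangle.
Context {k : comPzRingType} {A B : kalg k} {C : coring A} {D : coring B}.
Variables (hC : flat_l C) (hD : flat_l D) (X : bicomod C D) (L : bicomod D C).
Variable eta : forall M : rcomod (kself k) C, rchom M (cot2 hC hD X L M).
Variable eta' : forall N : rcomod (kself k) D, rchom N (cot2 hD hC L X N).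
Variables (phi : bihom C (X ⊗b L)) (psi : bihom D (L ⊗b X)).
Hypothesis etaE : forall M m,
  cot_emb hC hD X L M (eta M m) = tmap (bid M) phi (rho M m).
Hypothesis eta'E : forall N n,
  cot_emb hD hC L X N (eta' N n) = tmap (bid N) psi (rho N n).
Hypothesis triangle : forall M x,
  cot_rchom X hD (eta M) x = eta' (cot_rcomod X hD M) x.

Let C0 := rcforget (cor_bicomod C).
Let F0 := cot_rcomod X hD C0.

(** Evaluate the triangle identity at the comodule C on the element lam x of C ◻ X, then apply the
    counit of C to the outer factor. *)
Lemma triangle_coherence (x : X) :
  assoc X L X (tmap phi (bid X) (lam X x)) = tmap (bid X) psi (rho X x).
Proof.
pose b := cot_epsl hD X.
have om0 : omega C0 X (lam X x) = 0 by apply/omegaP; apply: lamA.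
pose y : F0 := kmk om0; have yE : kin (omega C0 X) y = lam X x by [].
(* This recovers phi from the unit at C by counitality. *)
have bphi c : tmap b (bid L) (kin (omega F0 L) (eta C0 c)) = phi c.
  rewrite -[in RHS](cdelta_epsl c) lunit_nat -tmap_swap -[cdelta C c]/(rho C0 c).
  transitivity (lunit (X ⊗b L) (tmap (ceps C) (bid _) (cot_emb hC hD X L C0 (eta C0 c)))).
    rewrite cot_embE; move: (kin _ (eta C0 c)) => v.
    move: v; apply: bpure_ind => [|u v hu hv|z l].
    - by rewrite !bfun0.
    - by rewrite !bfunD hu hv.
    rewrite !tmapE cot_epslE; move: (kin _ z) => t.
    move: t; apply: bpure_ind => [|u v hu hv|c' x'].
    - by rewrite !(bfun0, bpure0l).
    - by rewrite !(bfunD, bpureDl) hu hv.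
    by rewrite !(tmapE, assocE, lunitE) lact_bpure.
  by rewrite etaE.
have brho : tmap b (bid D) (rho F0 y) = rho X x.
  have h (v : F0 ⊗b D) : tmap b (bid D) v =
     tmap (bcomp (lunit X) (tmap (ceps C) (bid X))) (bid D) (tmap (kin (omega C0 X)) (bid D) v).
    move: v; apply: bpure_ind => [|u v hu hv|z d].
    - by rewrite !bfun0.
    - by rewrite !bfunD hu hv.
    by rewrite !tmapE.
  rewrite h cot_rhoE yE -[in RHS](lam_eps x); move: (lam X x) => s.
  tind s => c x'; rewrite tmapE lunitE bfunL tens_rhoE.
  by move: (rho X x') => s; tind s => x'' d; rewrite assocVE !tmapE bcompE tmapE lunitE lact_bpure.
have := congr1 (tmap b (bid (L ⊗b X))) (eta'E y).
rewrite -triangle cot_embE.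
rewrite -[kin _ (cot_rchom _ _ _ y)]/(tmap (eta C0) (bid X) (kin (omega C0 X) y)) yE.
rewrite [tmap b _ (tmap _ psi _)](_ : _ = tmap (bid X) psi (tmap b (bid D) (rho F0 y))); last first.
  exact: (tmap_swap b psi).
rewrite brho => <-; move: (lam X x) => s; tind s => c x'.
rewrite !tmapE -bphi; move: (kin _ (eta C0 c)) => v.
move: v; apply: bpure_ind => [|u v hu hv|z l].
- by rewrite !(bfun0, bpure0l, bfun0).
- by rewrite !(bfunD, bpureDl, bfunD) hu hv.
by rewrite !(tmapE, assocE).
Qed.

End Triangle.

Lemma cotmapl_can (k : comPzRingType) (E A F : kalg k) (C : coring A)
    (M N : rcomod E C) (P : lcomod F C)
    (f : rchom M N) (g : rchom N M) :
  cancel f g -> cancel (cotmapl P f) (cotmapl P g).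
Proof.
move=> fK x; apply: kin_inj.
rewrite -[LHS]/(tmap g (bid P) (tmap f (bid P) (kin _ x))).
by rewrite tmap_comp tmap_id.
Qed.

Lemma cotmapr_can (k : comPzRingType) (E A F : kalg k) (C : coring A)
    (P : rcomod E C) (M N : lcomod F C)
    (f : lchom M N) (g : lchom N M) :
  cancel f g -> cancel (cotmapr P f) (cotmapr P g).
Proof.
move=> fK x; apply: kin_inj.
rewrite -[LHS]/(tmap (bid P) g (tmap (bid P) f (kin _ x))).
by rewrite tmap_comp tmap_id.
Qed.

Section Square.
Context {k : comPzRingType} {A B : kalg k} {C : coring A} {D : coring B}.

Variables (X : bicomod C D) (L : bicomod D C).
Variables (hXL : bistable (omega_bichom X L)) (hLX : bistable (omega_bichom L X)).
Variables (f : bichom (cot_bicomod hXL) (cor_bicomod C)).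
Variables (f' : bichom (cor_bicomod C) (cot_bicomod hXL)).
Variables (g : bichom (cot_bicomod hLX) (cor_bicomod D)).
Variables (g' : bichom (cor_bicomod D) (cot_bicomod hLX)).
Hypotheses (fK : cancel (bich f) (bich f')) (f'K : cancel (bich f') (bich f)).
Hypotheses (gK : cancel (bich g) (bich g')) (g'K : cancel (bich g') (bich g)).
Hypothesis coh : forall x : X,
  assoc X L X (tmap (bcomp (kin (omega X L)) (bich f')) (bid X) (lam X x)) =
  tmap (bid X) (bcomp (kin (omega L X)) (bich g')) (rho X x).

Let lam_om (x : X) : omega (cor_bicomod C) X (lam X x) = 0.
Proof. by apply/omegaP; apply: lamA. Qed.
Let rho_om (x : X) : omega X (cor_bicomod D) (rho X x) = 0.
Proof. by apply/omegaP; apply: rhoA. Qed.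

Let l0 : bihom X (cotens (cor_bicomod C) X) := klift lam_om.
Let r0 : bihom X (cotens X (cor_bicomod D)) := klift rho_om.

Let l0K : cancel l0 (cot_unitl X). Proof. by move=> x; apply: lam_eps. Qed.
Let r0K : cancel r0 (cot_unitr X). Proof. by move=> x; apply: (@rho_eps _ _ _ _ X x). Qed.
Let l0Kv : cancel (cot_unitl X) l0.
Proof. by move=> v; apply: kin_inj; apply: omega_cor_eps; apply: kinE. Qed.
Let r0Kv : cancel (cot_unitr X) r0.
Proof. by move=> v; apply: kin_inj; apply: omega_cor_epsr; apply: kinE. Qed.

(** The associativity map is defined as the composite that makes the square commute. Its
    compatibility with the embeddings into X ⊗ L ⊗ X is then exactly [coh]. *)
Lemma coherence_triple_square : triple_square f g.
Proof.
have flK := cotmapl_can (P := X) (f := rchom_of f) (g := rchom_of f') fK.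
have flKv := cotmapl_can (P := X) (f := rchom_of f') (g := rchom_of f) f'K.
have grK := cotmapr_can (P := X) (f := lchom_of g) (g := lchom_of g') gK.
have grKv := cotmapr_can (P := X) (f := lchom_of g') (g := lchom_of g) g'K.
pose r := bcomp (cotmapr X g') r0; pose l := bcomp (cotmapl X f') l0.
pose al := bcomp r (bcomp (cot_unitl X) (cotmapl X f)).
have alE v : al v = cotmapr X g' (r0 (cot_unitl X (cotmapl X f v))) by [].
pose be := bcomp l (bcomp (cot_unitr X) (cotmapr X g)).
have beE v : be v = cotmapl X f' (l0 (cot_unitr X (cotmapr X g v))) by [].
exists al; split; last by move=> v; rewrite alE grKv r0K.
split.
  exists be => v; first by rewrite beE alE grKv r0K l0Kv flK.
  by rewrite alE beE flKv l0K r0Kv grK.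
move=> v; pose x := cot_unitl X (cotmapl X f v).
have vE : v = cotmapl X f' (l0 x) by rewrite l0Kv flK.
rewrite alE -/x [in RHS]vE.
rewrite -[kin _ (cotmapr _ _ _)]/(tmap (bid X) (bich g') (rho X x)).
rewrite -[kin _ (cotmapl _ _ _)]/(tmap (bich f') (bid X) (lam X x)).
rewrite !tmap_comp.
transitivity (tmap (bid X) (bcomp (kin (omega L X)) (bich g')) (rho X x)).
  exact: tmap_ext.
by rewrite -coh; congr (assoc _ _ _ _); apply: tmap_ext.
Qed.

End Square.

(** * Isomorphisms of bicomodules *)

Section Inverse.
Context {k : comPzRingType} {A B : kalg k} {C : coring A} {D : coring B}.
Variables (X : bicomod C D) (L : bicomod D C).

Lemma cot_inverse_ker (phi : bihom C (X ⊗b L)) : is_cot_inverse phi ->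
  exists p : bihom C (cotens X L),
    bijective p /\ forall c, kin (omega X L) (p c) = phi c.
Proof.
case=> phi0 _ _ phiI phiS.
have ex c : exists y, kin (omega X L) y = phi c by apply/kin_exact.
have [p pE] := bihom_factor (@kin_inj _ _ _ _ _ _) ex.
pose R : bimod (kself k) A := rforget (breg A).
exists p; split=> //; apply: inj_surj_bij => [|y].
  apply: bihom_inj => c pc; rewrite -[c]lact1 -[RHS](bfun0 (lunit C)) -lunitE.
  congr (lunit C _); apply: (phiI R).
  by rewrite bfun0 tmapE -pE pc bfun0 bpure0r.
have [|s sE] := phiS R (((1 : A) : R) ⊗ kin (omega X L) y).
  by rewrite tmapE kinE bpure0r.
exists (lunit C s); apply: kin_inj; rewrite pE lunit_nat.
transitivity (lunit (X ⊗b L) (((1 : A) : R) ⊗ kin (omega X L) y)).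
  by rewrite -sE.
by rewrite lunitE lact1.
Qed.

Lemma cot_inverse_pure (phi : bihom C (X ⊗b L)) : is_cot_inverse phi -> pure (omega X L).
Proof.
move=> phiP; have [p [pB pE]] := cot_inverse_ker phiP.
have [_ _ _ phiI phiS] := phiP.
move=> W; have WpE s : tmap (bid W) phi s = tmap (bid W) (kin (omega X L)) (tmap (bid W) p s).
  by rewrite tmap_comp; apply: tmap_ext => // c; rewrite bcompE pE.
split=> [s t|t].
  have WpB := tmap_bij (bid_bij W) pB.
  have [s' <-] := bij_surj WpB s; have [t' <-] := bij_surj WpB t.
  by rewrite -!WpE => /phiI ->.
split=> [/phiS[s <-]|[s <-]]; first by exists (tmap (bid W) p s).
rewrite tmap_comp -[RHS](@tmap_zeror _ _ _ _ W W (cotens X L) (X ⊗b (D ⊗b L)) (bid W) s).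
by apply: tmap_ext => // x; apply: kinE.
Qed.

Variable hXL : bistable (omega_bichom X L).
Let XL := cot_bicomod hXL.

Lemma cot_lamE (y : XL) :
  tmap (bid C) (kin (omega X L)) (lam XL y) = tens_lam X L (kin (omega X L) y).
Proof. exact: (@ker_lamE _ _ _ _ _ _ (lchom_of (omega_bichom X L))). Qed.

Lemma cot_bicomod_rhoE (y : XL) :
  tmap (kin (omega X L)) (bid C) (rho XL y) = tens_rho X L (kin (omega X L) y).
Proof. exact: (@ker_rhoE _ _ _ _ _ _ (rchom_of (omega_bichom X L))). Qed.

Lemma cot_inverse_iso (phi : bihom C (X ⊗b L)) : is_cot_inverse phi ->
  exists (f : bichom XL (cor_bicomod C)) (f' : bichom (cor_bicomod C) XL),
  [/\ cancel (bich f) (bich f'), cancel (bich f') (bich f) &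
      forall c, kin (omega X L) (bich f' c) = phi c].
Proof.
move=> phiP; have [p [pB pE]] := cot_inverse_ker phiP.
have [_ phiL phiR _ _] := phiP; have [[[hl _] _] [[hr _] _] _] := hXL.
have pL c : blam XL (p c) = tmap (bid C) p (blam (cor_bicomod C) c).
  apply: hl; rewrite [LHS]cot_lamE pE phiL tmap_comp.
  by apply: tmap_ext => // x; rewrite bcompE pE.
have pR c : brho XL (p c) = tmap p (bid C) (brho (cor_bicomod C) c).
  apply: hr; rewrite [LHS]cot_bicomod_rhoE pE phiR tmap_comp.
  by apply: tmap_ext => // x; rewrite bcompE pE.
pose f' := @Bichom _ _ _ _ _ (cor_bicomod C) XL p pL pR.
by have [f [fK f'K]] := bic_iso_bij (f := f') pB; exists f, f'.
Qed.

(** Purity keeps the inclusion of X ◻ L a kernel after tensoring with every W. *)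
Lemma iso_cot_inverse (f : bichom XL (cor_bicomod C)) :
  bic_iso f -> pure (omega X L) -> exists phi : bihom C (X ⊗b L), is_cot_inverse phi.
Proof.
case=> f' [fK f'K] hp; pose i := kin (omega X L).
have WE (W : bimod (kself k) A) s :
    tmap (bid W) (bcomp i (bich f')) s = tmap (bid W) i (tmap (bid W) (bich f') s).
  by rewrite tmap_comp; apply: tmap_ext.
have fB : bijective (bich f') by exists (bich f).
exists (bcomp i (bich f')); split=> [c|c|c|W|W t].
- exact: kinE.
- by rewrite -cot_lamE [lam XL _](bichL f') tmap_comp; apply: tmap_ext.
- by rewrite -cot_bicomod_rhoE [rho XL _](bichR f') tmap_comp; apply: tmap_ext.
- move=> s t; rewrite !WE => /(proj1 (hp W)).
  exact: (bij_inj (tmap_bij (bid_bij W) fB)).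
move=> /(proj2 (hp W))[s <-].
have [s' <-] := bij_surj (tmap_bij (bid_bij W) fB) s.
by exists s'; rewrite WE.
Qed.

End Inverse.

(** * From equivalences to isomorphisms and back *)

Section Assembly.
Context {k : comPzRingType} {A B : kalg k} {C : coring A} {D : coring B}.
Variables (hC : flat_l C) (hD : flat_l D) (X : bicomod C D) (L : bicomod D C).
Let F := cot_functor X hD.
Let G := cot_functor L hC.

Lemma equivalence_cot_inverse : inverse_equivalences F G ->
  exists (phi : bihom C (X ⊗b L)) (psi : bihom D (L ⊗b X)),
  [/\ is_cot_inverse phi, is_cot_inverse psi,
      forall x : X, assoc X L X (tmap phi (bid X) (lam X x)) =
        tmap (bid X) psi (rho X x) &
      forall l : L, assoc L X L (tmap psi (bid L) (lam L l)) =
        tmap (bid L) phi (rho L l)].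
Proof.
move=> /adjoint_equivalence[eta [eta' [[etaB etaN] [eta'B eta'N] t1 t2]]].
have [phi [phiP phiE]] := unit_cot_inverse etaB etaN.
have [psi [psiP psiE]] := unit_cot_inverse eta'B eta'N.
exists phi, psi; split=> //.
  exact: (triangle_coherence phiE psiE t1).
exact: (triangle_coherence psiE phiE t2).
Qed.

Lemma equivalence_isos (hXL : bistable (omega_bichom X L))
    (hLX : bistable (omega_bichom L X)) : inverse_equivalences F G ->
  exists (f : bichom (cot_bicomod hXL) (cor_bicomod C))
         (g : bichom (cot_bicomod hLX) (cor_bicomod D)),
  [/\ bic_iso f, bic_iso g, triple_square g f & triple_square f g].
Proof.
move=> /equivalence_cot_inverse[phi [psi [phiP psiP c1 c2]]].
have [f [f' [fK f'K f'E]]] := cot_inverse_iso hXL phiP.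
have [g [g' [gK g'K g'E]]] := cot_inverse_iso hLX psiP.
exists f, g; split; [by exists f'|by exists g'| |].
  apply: (coherence_triple_square gK g'K fK f'K) => l.
  rewrite (@tmap_ext _ _ _ _ _ _ _ _ _ psi _ (bid L)) //.
  by rewrite c2; apply: tmap_ext => // c; rewrite bcompE f'E.
apply: (coherence_triple_square fK f'K gK g'K) => x.
rewrite (@tmap_ext _ _ _ _ _ _ _ _ _ phi _ (bid X)) //.
by rewrite c1; apply: tmap_ext => // d; rewrite bcompE g'E.
Qed.

Lemma equivalence_flat : inverse_equivalences F G -> flat_l X.
Proof.
move=> FG; apply: (flat_l_of_cot hD) => W W' f fI.
exact: (equivalence_inj hD FG (f := tens_rchom f (cor_bicomod C)) (flat_l_inj hC fI)).
Qed.

End Assembly.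

(** What [cot_inverse_unit] asks of X and L. It has two sources: flatness, and the splitting of
    [omega M X] given by coseparability of C. *)
Definition cotens_stable (k : comPzRingType) (A B : kalg k) (C : coring A)
    (D : coring B) (X : bicomod C D) (L : bicomod D C) : Prop :=
  forall M : rcomod (kself k) C,
  left_exact (tmap (kin (omega M X)) (bid L)) (tmap (omega M X) (bid L)) /\
  injective (tmap (kin (omega M X)) (bid (D ⊗b L))).

Section Conditions.
Context {k : comPzRingType} {A B : kalg k} {C : coring A} {D : coring B}.
Variables (X : bicomod C D) (L : bicomod D C).

Lemma flat_cotens_stable : flat_l D -> flat_l L -> cotens_stable X L.
Proof.
move=> hD hL M; have iI := flat_l_inj hL (@kin_inj _ _ _ _ _ (omega M X)).
split; first by split=> //; apply: flat_l_exact (kin_exact _).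
have iDL := flat_l_inj hL (flat_l_inj hD (@kin_inj _ _ _ _ _ (omega M X))).
move=> s t st; rewrite -[s]assocVK -[t]assocVK; congr (assoc _ _ _ _).
apply: iDL; rewrite -!assocV_nat; congr (assocV _ _ _ _).
have E u : tmap (kin (omega M X)) (tmap (bid D) (bid L)) u =
    tmap (kin (omega M X)) (bid (D ⊗b L)) u.
  by apply: tmap_ext => // x; rewrite tmap_id.
by rewrite !E.
Qed.

Lemma cosep_cotens_stable : coseparable C -> cotens_stable X L.
Proof.
case=> p pK M; have [e [sg [he eE]]] := cosep_split pK M X.
split; first exact: (split_exactr he eE L).
by case: (split_exactr he eE (D ⊗b L)).
Qed.

Lemma cosep_pure : coseparable D -> pure (omega X L).
Proof.
case=> p pK W; have [e [sg [he eE]]] := cosep_split pK X L.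
exact: (split_exactl he eE W).
Qed.

End Conditions.

Lemma isos_equivalence (k : comPzRingType) (A B : kalg k)
    (C : coring A) (D : coring B) (hC : flat_l C) (hD : flat_l D)
    (X : bicomod C D) (L : bicomod D C)
    (hXL : bistable (omega_bichom X L)) (hLX : bistable (omega_bichom L X))
    (f : bichom (cot_bicomod hXL) (cor_bicomod C))
    (g : bichom (cot_bicomod hLX) (cor_bicomod D)) :
  bic_iso f -> bic_iso g -> pure (omega X L) -> pure (omega L X) ->
  cotens_stable X L -> cotens_stable L X ->
  inverse_equivalences (cot_functor X hD) (cot_functor L hC).
Proof.
move=> fI gI pXL pLX sXL sLX.
have [phi phiP] := iso_cot_inverse fI pXL.
have [psi psiP] := iso_cot_inverse gI pLX.
split; first by apply: (cot_inverse_unit hC hD phiP) => M; case: (sXL M).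
by apply/natiso_sym/(cot_inverse_unit hD hC psiP) => M; case: (sLX M).
Qed.

Theorem proposition3p2p2 (k : comPzRingType) (A B : kalg k)
    (C : coring A) (D : coring B) (hC : flat_l C) (hD : flat_l D)
    (X : bicomod C D) (L : bicomod D C) :
  let inv_equiv :=
    inverse_equivalences (cot_functor X hD) (cot_functor L hC) in
  let cond_a :=
    [/\ flat_l X, flat_l L, pure (omega X L) & pure (omega L X)] in
  let cond_b := coflat X /\ coflat L in
  (forall (hC' : flat_r C) (hD' : flat_r D),
     let XL := cot_bicomod (flat_bistable hC' hC (omega_bichom X L)) in
     let LX := cot_bicomod (flat_bistable hD' hD (omega_bichom L X)) in
     [/\ inv_equiv <->
           (exists (f : bichom XL (cor_bicomod C))
                   (g : bichom LX (cor_bicomod D)),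
              [/\ bic_iso f, bic_iso g & cond_a \/ cond_b]),
         inv_equiv ->
           (exists (f : bichom XL (cor_bicomod C))
                   (g : bichom LX (cor_bicomod D)),
              [/\ bic_iso f, bic_iso g, cond_a \/ cond_b,
                  triple_square g f & triple_square f g]) &
         von_neumann_regular A -> von_neumann_regular B ->
           (inv_equiv <->
              (exists (f : bichom XL (cor_bicomod C))
                      (g : bichom LX (cor_bicomod D)),
                 bic_iso f /\ bic_iso g)) /\
           (inv_equiv ->
              (exists (f : bichom XL (cor_bicomod C))
                      (g : bichom LX (cor_bicomod D)),
                 [/\ bic_iso f, bic_iso g,
                     triple_square g f & triple_square f g]))]) /\
  (forall (sC : coseparable C) (sD : coseparable D),
     let XL := cot_bicomod (cosep_bistable X L sD) in
     let LX := cot_bicomod (cosep_bistable L X sC) in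
     (inv_equiv <->
        (exists (f : bichom XL (cor_bicomod C))
                (g : bichom LX (cor_bicomod D)),
           bic_iso f /\ bic_iso g)) /\
     (inv_equiv ->
        (exists (f : bichom XL (cor_bicomod C))
                (g : bichom LX (cor_bicomod D)),
           [/\ bic_iso f, bic_iso g,
               triple_square g f & triple_square f g]))).
Proof.
move=> inv_equiv cond_a cond_b.
have isos hXL hLX := @equivalence_isos _ _ _ _ _ hC hD X L hXL hLX.
have equiv_a : inv_equiv -> cond_a.
  move=> FG; have [phi [psi [phiP psiP _ _]]] := equivalence_cot_inverse FG.
  split; [exact: equivalence_flat FG| |exact: cot_inverse_pure phiP
         |exact: cot_inverse_pure psiP].
  (* Flatness of L is the same statement for the inverse equivalence. *)
  by apply: (equivalence_flat (hC := hD) (hD := hC) (X := L) (L := X));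
    case: FG => FG GF; split; apply: natiso_sym.
split=> [hC' hD'|sC sD] XL LX.
- have b_a : cond_b -> cond_a.
    case=> cX cL; have fX := coflat_flat_l hC hD cX; have fL := coflat_flat_l hD hC cL.
    by split=> //; apply: coflat_pure.
  have a_equiv (f : bichom XL (cor_bicomod C)) (g : bichom LX (cor_bicomod D)) :
      bic_iso f -> bic_iso g -> cond_a -> inv_equiv.
    move=> fI gI [fX fL pXL pLX].
    by apply: (isos_equivalence hC hD fI gI pXL pLX); apply: flat_cotens_stable.
  split=> [||rA rB].
  + split=> [FG|[f [g [fI gI ab]]]]; last by apply: a_equiv fI gI _; case: ab.
    have [f [g [fI gI _ _]]] := isos (flat_bistable hC' hC (omega_bichom X L))
      (flat_bistable hD' hD (omega_bichom L X)) FG.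
    by exists f, g; split=> //; left; apply: equiv_a.
  + move=> FG; have [f [g [fI gI t1 t2]]] := isos
      (flat_bistable hC' hC (omega_bichom X L))
      (flat_bistable hD' hD (omega_bichom L X)) FG.
    by exists f, g; split=> //; left; apply: equiv_a.
  split=> [|FG]; last exact: isos FG.
  split=> [FG|[f [g [fI gI]]]].
    have [f [g [fI gI _ _]]] := isos (flat_bistable hC' hC (omega_bichom X L))
      (flat_bistable hD' hD (omega_bichom L X)) FG.
    by exists f, g.
  apply: a_equiv fI gI _.
  by split; [exact: vnr_flat_l|exact: vnr_flat_l|exact: vnr_pure|exact: vnr_pure].
split=> [|FG]; last exact: isos FG.
split=> [FG|[f [g [fI gI]]]].
  have [f [g [fI gI _ _]]] := isos (cosep_bistable X L sD) (cosep_bistable L X sC) FG.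
  by exists f, g.
apply: (isos_equivalence hC hD fI gI).
- exact: cosep_pure.
- exact: cosep_pure.
- exact: cosep_cotens_stable.
exact: cosep_cotens_stable.
Qed.
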